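(* Let $\alpha<0$, let $\overline\Pi$ be an irreducible homogeneous multi-type fragmentation process started from the single block $\mathbb N$ with type $i\in[K]$, and let $\overline\Pi^{(\alpha)}$ be the associated $\alpha$-self-similar fragmentation process. Almost surely, there exists a unique (up to isometries preserving the root and the points $Q_n$) compact rooted $\mathbb R$-tree $(\mathcal T,\rho)$ equipped with a set of points $(Q_n)_{n\in\mathbb N}$ such that: - for all $n$, $ht(Q_n)=\inf\{t\ge0:\ \{n\}\text{ is a block of }\Pi^{(\alpha)}(t)\}$; - for all $n\ne m$, $ht(Q_n\wedge Q_m)=\inf\{t\ge0:\ n\notin\Pi^{(\alpha)}_{(m)}(t)\}$; - the set $\bigcup_{n\in\mathbb N}[[\rho,Q_n]]$ is dense in $\mathcal T$.
   Context: Fix $K\in\mathbb N=\{1,2,\dots\}$ and $[K]=\{1,\dots,K\}$. Mass partitions. $\overline{\mathcal S}^{\downarrow}$ is the set of sequences $\bar{\mathbf s}=(s_n,i_n)_{n\in\mathbb N}$ with $s_1\ge s_2\ge\dots\ge0$, $\sum_n s_n\le 1$, $i_n\in\{0,\dots,K\}$, $i_n=0$ iff $s_n=0$, nonincreasing for the lexicographic order on $[0,1]\times\{0,\dots,K\}$. Partitions. $\overline{\mathcal P}_{\mathbb N}$ is the set of $\bar\pi=(\pi_n,i_n)_{n\in\mathbb N}$ where $\pi_1,\pi_2,\dots$ are the blocks of a partition $\pi$ of $\mathbb N$ in increasing order of least element (completed by empty sets), and $i_n\in\{0,\dots,K\}$ is the type of $\pi_n$, with $i_n=0$ iff $\pi_n$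 is empty or a singleton; partitions of subsets of $\mathbb N$ are defined likewise. $\pi_{(m)}$ is the block containing $m$ and $i_{(m)}$ its type. For $A\subset\mathbb N$, $\bar\pi\cap A$ is the partition of $A$ obtained by intersecting blocks with $A$, types being inherited except that empty sets and singletons get type $0$. The metric is $d(\bar\pi,\bar\pi')=1/\sup\{n:\bar\pi\cap[n]=\bar\pi'\cap[n]\}$. The asymptotic frequency of a block $B$ is $|B|=\lim_n\#(B\cap[n])/n$ when it exists. For a bijection $\sigma$ of $\mathbb N$, $\sigma\bar\pi$ has as blocks the inverse images by $\sigma$ of the blocks of $\bar\pi$, with inherited types; a random partition (or process) is exchangeable if its law is invariant under all $\sigma$. For $\bar{\mathbf s}\in\overline{\mathcal S}^\downarrow$, $\kappa_{\bar{\mathbf s}}$ is the law of the exchangeable random multi-type partition (unique in law) whose decreasingly (lexicographically) rearranged sequence of asymptotic frequencies and types is $\bar{\mathbf s}$. Fragmentations. An $\alpha$-self-similar fragmentation is a c\`adl\`ag $\overline{\mathcal P}_{\mathbb N}$-valued Markov process, with law $\mathbb P_{\bar\pi}$ when started from $\bar\pi$ and $\mathbb P_i$ when started from the single block $\mathbb N$ of type $i$, such that a.s. all $|\Pi_{(n)}(t)|$ exist and are right-continuous in $t$, which is exchangeable as a process, and such that under $\mathbb P_{\bar\pi}$ the processes $(\overline\Pi(t)\cap\pi_n)_{t\ge0}$, $n\in\mathbb N$, are independent, the $n$-th having the law of $(\overline\Pi(|\pi_n|^\alpha t)\cap\pi_n)_{t\ge0}$ under $\mathbb P_{i_n}$.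 It is homogeneous if $\alpha=0$. The case where the untyped partition $\Pi$ is a.s. constant is excluded. The law of a homogeneous fragmentation is characterised by erosion coefficients $c_i\ge0$ and $\sigma$-finite dislocation measures $\nu_i$ on $\overline{\mathcal S}^\downarrow$ with $\int(1-s_1\mathbf 1_{\{i_1=i\}})\nu_i(d\bar{\mathbf s})<\infty$: with independent Poisson point processes $\overline\Delta^{(n,j)}$ ($n\in\mathbb N$, $j\in[K]$) of intensities $\kappa_{\nu_j}=\int\kappa_{\bar{\mathbf s}}\,\nu_j(d\bar{\mathbf s})$, at an atom time $t$ of $\overline\Delta^{(n,j)}$ such that the $n$-th block has type $j$ at time $t^-$, this block is replaced by its intersection with the atom; in addition each integer $n$ is sent into a singleton at rate $c_{i_{(n)}(t)}$. The associated $\alpha$-self-similar fragmentation $\overline\Pi^{(\alpha)}$ is defined by: the block of $\overline\Pi^{(\alpha)}(t)$ containing $n$ is the (typed) block of $\overline\Pi(\tau_n^{(\alpha)}(t))$ containing $n$, where $\tau_n^{(\alpha)}(t)=\inf\{u:\int_0^u|\Pi_{(n)}(r)|^{-\alpha}dr>t\}$ (a singleton if this is $\infty$). The fragmentation is irreducible if the Markov chain of types of the tagged fragment (the block containing $1$) is irreducible, i.e. the chain on $[K]$ with rates $\int\sum_n s_n\mathbf 1_{\{i_n=j\}}\,\nu_i(d\bar{\mathbf s})$ from $i$ to $j\ne i$. Trees. An $\mathbb R$-tree is a metric space in which any two points $x,y$ are joined by a unique isometric path $[[x,y]]$, and every continuous injective path from $x$ to $y$ has image $[[x,y]]$. For a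 tree with root $\rho$, $ht(x)=d(\rho,x)$ and $x\wedge y$ is the point where $[[\rho,x]]$ and $[[\rho,y]]$ separate. *)

(* Defs.v *)
From HB Require Import structures.
From mathcomp Require Import all_boot all_order all_algebra.
From mathcomp Require Import all_classical all_reals all_analysis.

Set Implicit Arguments.
Unset Strict Implicit.
Unset Printing Implicit Defensive.

Import Order.TTheory GRing.Theory Num.Theory.
Import numFieldTopology.Exports numFieldNormedType.Exports.

Local Open Scope classical_set_scope.
Local Open Scope ring_scope.

(** Conventions. The integers 1, 2, ... that are partitioned (and that index
    blocks, points Q_n and masses) are represented by nat, starting at 0, so
    that [n] is `I_n and the tagged fragment is the block containing 0.  The
    set [K] of genuine types is 'I_K; the set {0, ..., K} is 'I_K.+1, into
    which [K] is embedded by [gtype]. *)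

Section Types.
Variable K : nat.

Definition gtype (j : 'I_K) : 'I_K.+1 := lift ord0 j.

End Types.

(** ** Multi-type partitions *)

(** A typed partition of [A] is given by [blk m], the block containing [m]
    (empty for [m] outside of [A]), and [typ m], the type of that block.  The
    parameter [R] only serves to fix the scalars of the metric. *)
Record mpart (R : realType) (K : nat) (A : set nat) := MPart {
  blk : nat -> set nat ;
  typ : nat -> 'I_K.+1 ;
  blkxx : forall m, A m -> blk m m ;
  blk_supp : forall m k, blk m k -> A m ;
  blk_eq : forall m k, blk m k -> blk k = blk m ;
  typ_eq : forall m k, blk m k -> typ k = typ m ;
  typ0 : forall m, typ m = ord0 <-> blk m `<=` [set m] }.

Arguments blk {R K A}.
Arguments typ {R K A}.

Section Partitions.
Variables (R : realType) (K : nat).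
Local Notation mpart := (mpart R K).

Lemma mpart_ext A (p q : mpart A) :
  (forall m, blk p m = blk q m) -> (forall m, typ p m = typ q m) -> p = q.
Proof.
case: p q => [b t h1 h2 h3 h4 h5] [b' t' h1' h2' h3' h4' h5'] /= /funext eb.
move=> /funext et; subst b' t'.
by rewrite (Prop_irrelevance h1 h1') (Prop_irrelevance h2 h2')
  (Prop_irrelevance h3 h3') (Prop_irrelevance h4 h4') (Prop_irrelevance h5 h5').
Qed.

Record pre_mpart (A : set nat) (b : nat -> set nat) (t : nat -> 'I_K.+1) : Prop
    := PreMPart {
  pre_refl : forall m, A m -> b m m ;
  pre_supp : forall m k, b m k -> A m ;
  pre_eq : forall m k, b m k -> b k = b m ;
  pre_typ : forall m k, b m k -> t k = t m ;
  pre_typ0 : forall m, t m = ord0 -> b m `<=` [set m] }.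

(** Types are inherited from [t], except that singletons and empty sets get
    type 0. *)
Definition trim (b : nat -> set nat) (t : nat -> 'I_K.+1) (m : nat) : 'I_K.+1 :=
  if `[< b m `<=` [set m] >] then ord0 else t m.

Lemma trim_eq A b t (h : pre_mpart A b t) m k : b m k -> trim b t k = trim b t m.
Proof.
move=> mk; rewrite /trim (pre_eq h mk) (pre_typ h mk).
have [km|km] := pselect (b m `<=` [set m]).
  by have /= -> := km _ mk.
have [kk|kk] := pselect (b m `<=` [set k]); last by rewrite !asboolF.
have mm : b m m by exact: (pre_refl h (pre_supp h mk)).
by have /= e := kk _ mm; exfalso; apply: km; rewrite {2}e.
Qed.

Lemma trim0 A b t (h : pre_mpart A b t) m :
  trim b t m = ord0 <-> b m `<=` [set m].
Proof.
rewrite /trim; split; last by move=> ?; rewrite asboolT.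
by case: asboolP => // _ /(pre_typ0 h).
Qed.

Definition mpart_of A b t (h : pre_mpart A b t) : mpart A :=
  MPart R (pre_refl h) (pre_supp h) (pre_eq h) (trim_eq h) (trim0 h).

Lemma blkT A (p : mpart A) m k : blk p m k -> blk p m m.
Proof. by move=> mk; apply: blkxx; exact: blk_supp mk. Qed.

Lemma blk_sym A (p : mpart A) m k : blk p m k -> blk p k m.
Proof. by move=> mk; rewrite (blk_eq mk); exact: blkT mk. Qed.

Section restriction.
Variables (A B : set nat) (p : mpart A).

Let b m : set nat := [set k | [/\ B m, B k & blk p m k]].

Lemma restr_subproof : pre_mpart (A `&` B) b (typ p).
Proof.
split.
- by move=> m [Am Bm]; split=> //; exact: blkxx.
- by move=> m k [Bm _ /blk_supp].
- move=> m k [Bm Bk mk]; rewrite /b (blk_eq mk).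
  by apply/seteqP; split=> l [] *; split.
- by move=> m k [_ _ /typ_eq].
- by move=> m /typ0 h k [_ _ /h].
Qed.

(** [p] intersected with [B]. *)
Definition restr : mpart (A `&` B) := mpart_of restr_subproof.

End restriction.

Section whole.
Variable j : 'I_K.

Lemma one_block_subproof : pre_mpart setT (fun=> setT) (fun=> gtype j).
Proof. by split. Qed.

(** The partition with the single block N, of type [j]. *)
Definition one_block : mpart setT := mpart_of one_block_subproof.

End whole.

Section trivial.
Variable A : set nat.

Lemma singletons_subproof :
  pre_mpart A (fun m => [set k | A m /\ k = m]) (fun=> ord0).
Proof.
split=> //.
- by move=> m k [].
- by move=> m k [_ ->].
- by move=> m _ k [_ ->].
Qed.

Definition singletons : mpart A := mpart_of singletons_subproof.

End trivial.

Section permutation.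
Variables (s : nat -> nat) (bs : bijective s) (p : mpart setT).

Lemma perm_part_subproof :
  pre_mpart setT (fun m => s @^-1` blk p (s m)) (fun m => typ p (s m)).
Proof.
split=> //.
- by move=> m _; exact: blkxx.
- by move=> m k /blk_eq ->.
- by move=> m k /typ_eq.
- by move=> m /typ0 h k /h /(bij_inj bs).
Qed.

(** The partition whose blocks are the inverse images by [s] of those of [p]. *)
Definition perm_part : mpart setT := mpart_of perm_part_subproof.

End permutation.

Section fragmenting.
Variables (p : mpart setT) (m0 : nat) (Delta : mpart setT).

Let cut_blk m : set nat :=
  if `[< blk p m0 m >] then blk p m0 `&` blk Delta m else blk p m.
Let cut_typ m := if `[< blk p m0 m >] then typ Delta m else typ p m.

Lemma cut_subproof : pre_mpart setT cut_blk cut_typ.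
Proof.
split=> //; rewrite /cut_blk /cut_typ.
- by move=> m _; case: asboolP => // h; [split=> //|]; exact: blkxx.
- move=> m k; case: (asboolP (blk p m0 m)) => h.
    by move=> [h' mk]; rewrite asboolT // (blk_eq mk).
  move=> mk; rewrite asboolF ?(blk_eq mk) // => h'; apply: h.
  by rewrite -(blk_eq h') (blk_eq mk); exact: blkT mk.
- move=> m k; case: (asboolP (blk p m0 m)) => h.
    by move=> [h' mk]; rewrite asboolT // (typ_eq mk).
  move=> mk; rewrite asboolF ?(typ_eq mk) // => h'; apply: h.
  by rewrite -(blk_eq h') (blk_eq mk); exact: blkT mk.
- by move=> m; case: asboolP => _ /typ0 h k => [[_ /h]|/h].
Qed.

(** The block of [p] containing [m0] is replaced by its intersection with
    [Delta]. *)
Definition cut_block : mpart setT := mpart_of cut_subproof.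

Let iso_blk m : set nat :=
  if m == m0 then [set m0] else blk p m `\ m0.
Let iso_typ m := if m == m0 then ord0 else typ p m.

Lemma isolate_subproof : pre_mpart setT iso_blk iso_typ.
Proof.
split=> //; rewrite /iso_blk /iso_typ.
- move=> m _; case: eqVneq => [->//|/eqP mm0].
  by split=> //; exact: blkxx.
- move=> m k; case: (eqVneq m m0) => [_ /= ->|_ [mk /eqP/negPf km0]].
    by rewrite eqxx.
  by rewrite km0 (blk_eq mk).
- move=> m k; case: (eqVneq m m0) => [_ /= ->|_ [mk /eqP/negPf km0]].
    by rewrite eqxx.
  by rewrite km0 (typ_eq mk).
- move=> m; case: (eqVneq m m0) => [-> _ //|_ /typ0 h k].
  by move=> [mk _]; exact: h.
Qed.

(** The integer [m0] is sent into a singleton. *)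
Definition isolate : mpart setT := mpart_of isolate_subproof.

End fragmenting.

(** [m] is the least element of its block; [block_index p m] is then the rank
    (from 0) of this block when the blocks are listed in increasing order of
    their least elements. *)
Definition lead A (p : mpart A) (m : nat) : Prop :=
  A m /\ forall k, blk p m k -> (m <= k)%N.

Definition block_index A (p : mpart A) (m : nat) : nat :=
  count (fun k => `[< lead p k >]) (iota 0 m).

(** *** The metric *)

Definition agree A (n : nat) (p q : mpart A) : Prop :=
  restr `I_n p = restr `I_n q.

Definition agree_inv A (p q : mpart A) : set R :=
  [set n.+1%:R^-1 | n in [set n | agree n.+1 p q]].

(** inf {1/n : p and q agree on [n]}, that is 1/sup {n : p and q agree on [n]}
    with 1/oo = 0; any two partitions agree on [1]. *)
Definition pdist A (p q : mpart A) : R := inf (agree_inv p q).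

Lemma agree1 A (p q : mpart A) : agree 1 p q.
Proof.
have I1 m : `I_1 m -> m = 0%N by case: m.
apply: mpart_ext => m.
  apply/seteqP; split=> k [/I1 -> /I1 -> /blk_supp A0];
    by split=> //; exact: blkxx.
rewrite /= /trim !asboolT //.
  by move=> k [/I1 -> /I1 ->].
by move=> k [/I1 -> /I1 ->].
Qed.

Lemma agreeW A n k (p q : mpart A) : (k <= n)%N -> agree n p q -> agree k p q.
Proof.
move=> kn e.
have kI m : `I_k m -> `I_n m by move=> /= /leq_trans; exact.
have eb m l : `I_k m -> `I_k l -> blk p m l <-> blk q m l.
  move=> km kl; have : blk (restr `I_n p) m l <-> blk (restr `I_n q) m l.
    by rewrite e.
  by move=> [h1 h2]; split=> h;
    [have [] := h1 (And3 (kI _ km) (kI _ kl) h)|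
     have [] := h2 (And3 (kI _ km) (kI _ kl) h)].
have eB m : blk (restr `I_k p) m = blk (restr `I_k q) m.
  by apply/seteqP; split=> l [km kl /(eb _ _ km kl) h].
apply: mpart_ext => // m; have /= := eB m; rewrite /= /trim => ->.
case: asboolP => // /existsNP[l /not_implyP[[km kl qml] lm]].
have : typ (restr `I_n p) m = typ (restr `I_n q) m by rewrite e.
rewrite /= /trim !asboolF //.
- by move=> /(_ l) h; apply: lm; apply: h; split=> //; exact: kI.
- move=> /(_ l) h; apply: lm; apply: h; split=> //; try exact: kI.
  exact/(eb _ _ km kl).
Qed.

Lemma agree_all A (p q : mpart A) : (forall n, agree n.+1 p q) -> p = q.
Proof.
move=> e.
have eb m : blk p m = blk q m.
  apply/seteqP; split=> k mk.
    have : blk (restr `I_(maxn m k).+1 p) m k.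
      by split=> //=; rewrite ltnS ?leq_maxl ?leq_maxr.
    by rewrite e => -[].
  have : blk (restr `I_(maxn m k).+1 q) m k.
    by split=> //=; rewrite ltnS ?leq_maxl ?leq_maxr.
  by rewrite -e => -[].
apply: mpart_ext => // m.
have [h|/existsNP[k /not_implyP[mk km]]] := pselect (blk p m `<=` [set m]).
  have /typ0 -> := h.
  by move: h; rewrite eb => /typ0 ->.
have : typ (restr `I_(maxn m k).+1 p) m = typ (restr `I_(maxn m k).+1 q) m.
  by rewrite e.
rewrite /= /trim !asboolF //.
- move=> /(_ k) h; apply: km; apply: h; split=> //=;
    rewrite ?ltnS ?leq_maxl ?leq_maxr //; by rewrite -eb.
- by move=> /(_ k) h; apply: km; apply: h; split=> //=;
    rewrite ltnS ?leq_maxl ?leq_maxr.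
Qed.

Lemma agree_inv_lb A (p q : mpart A) : lbound (agree_inv p q) 0.
Proof. by move=> _ [n _ <-]; rewrite invr_ge0. Qed.

Lemma agree_inv_has_inf A (p q : mpart A) : has_inf (agree_inv p q).
Proof.
split; last by exists 0; exact: agree_inv_lb.
by exists 1%:R^-1, 0%N => //; exact: agree1.
Qed.

Lemma pdist_ge0 A (p q : mpart A) : 0 <= pdist p q.
Proof.
apply: lb_le_inf; [exact: (agree_inv_has_inf p q).1|exact: agree_inv_lb].
Qed.

Lemma pdistxx A (p : mpart A) : pdist p p = 0.
Proof.
apply/eqP; rewrite eq_le pdist_ge0 andbT; apply/ler_addgt0Pl => e e0.
rewrite addr0; have [n ne] := ltr_add_invr e0; rewrite add0r in ne.
apply: le_trans (ltW ne); apply: ge_inf; first by exists 0; exact: agree_inv_lb.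
by exists n.
Qed.

Lemma pdist_lt A n (p q : mpart A) : pdist p q < n.+1%:R^-1 -> agree n.+1 p q.
Proof.
move=> /(inf_lt (agree_inv_has_inf p q).1) [_ [k ak <-]].
by rewrite ltf_pV2 ?posrE// ltr_nat => /ltnW /agreeW; apply.
Qed.

Lemma pdist0_eq A (p q : mpart A) : pdist p q = 0 -> p = q.
Proof.
by move=> e; apply: agree_all => n; apply: pdist_lt; rewrite e invr_gt0.
Qed.

Lemma pdist_sym A (p q : mpart A) : pdist p q = pdist q p.
Proof.
by rewrite /pdist; congr inf; apply/seteqP; split=> _ [n /= /esym e <-]; exists n.
Qed.

Lemma pdist_triangle A (q p r : mpart A) : pdist p r <= pdist p q + pdist q r.
Proof.
apply/ler_addgt0Pl => e e0.
have e2 : 0 < e / 2 by rewrite divr_gt0.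
have [_ [n an <-] hn] := inf_adherent e2 (agree_inv_has_inf p q).
have [_ [k ak <-] hk] := inf_adherent e2 (agree_inv_has_inf q r).
rewrite [e]splitr addrACA [e / 2 + _]addrC [e / 2 + _]addrC.
apply: le_trans (lerD (ltW hn) (ltW hk)).
apply: (@le_trans _ _ (minn n k).+1%:R^-1).
  apply: ge_inf; first by exists 0; exact: agree_inv_lb.
  exists (minn n k) => //=.
  apply: (@etrans _ _ (restr `I_(minn n k).+1 q)).
    by apply: agreeW an; rewrite ltnS geq_minl.
  by apply: agreeW ak; rewrite ltnS geq_minr.
by case: (leqP n k) => _; rewrite ?lerDl ?lerDr invr_ge0.
Qed.

End Partitions.

HB.instance Definition _ (R : realType) (K : nat) (A : set nat) :=
  gen_eqMixin (mpart R K A).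
HB.instance Definition _ (R : realType) (K : nat) (A : set nat) :=
  gen_choiceMixin (mpart R K A).
HB.instance Definition _ (R : realType) (K : nat) (A : set nat) :=
  isMetric.Build R (mpart R K A) (@pdistxx R K A) (@pdist0_eq R K A)
    (@pdist_sym R K A) (@pdist_triangle R K A).
HB.instance Definition _ (R : realType) (K : nat) (A : set nat) :=
  isPointed.Build (mpart R K A) (singletons R K A).

(** Borel sigma-algebra of the metric. *)
HB.instance Definition _ (R : realType) (K : nat) (A : set nat) :=
  @isMeasurable.Build (sigma_display (@open (mpart R K A))) (mpart R K A)
    <<s (@open (mpart R K A)) >> (@sigma_algebra0 _ setT (@open (mpart R K A)))
    (@sigma_algebraC (mpart R K A) (@open (mpart R K A)))
    (@sigma_algebra_bigcup _ setT (@open (mpart R K A))).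

Section Frequencies.
Variable R : realType.

Definition freq_seq (B : set nat) (n : nat) : R :=
  (\sum_(k < n) \1_B (k : nat)) / n%:R.

(** Meaningful when [freq_seq B] converges. *)
Definition freq (B : set nat) : R := limn (freq_seq B).

End Frequencies.

(** ** Mass partitions *)

Record massp (R : realType) (K : nat) := MassP {
  mass : nat -> R ;
  mtyp : nat -> 'I_K.+1 ;
  mass_ge0 : forall n, 0 <= mass n ;
  mass_decr : forall n, mass n.+1 <= mass n ;
  mass_sum : (\sum_(0 <= n <oo) (mass n)%:E <= 1)%E ;
  mtyp0 : forall n, mtyp n = ord0 <-> mass n = 0 ;
  mass_lexi : forall n, mass n.+1 = mass n -> (mtyp n.+1 <= mtyp n)%N }.

Arguments mass {R K}.
Arguments mtyp {R K}.

Section MassPartitions.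
Variables (R : realType) (K : nat).

Lemma massp0_sum : (\sum_(0 <= n <oo) (0 : R)%:E <= 1)%E.
Proof. by rewrite eseries0// lee_fin. Qed.

Definition massp0 : massp R K := @MassP R K (fun=> 0) (fun=> ord0)
  (fun=> lexx 0) (fun=> lexx 0) massp0_sum
  (fun=> conj (fun=> erefl) (fun=> erefl)) (fun _ _ => leqnn _).

Definition massp_gen : set (set (massp R K)) :=
  [set E | exists n, exists2 B : set R, measurable B &
             E = (fun s => mass s n) @^-1` B]
  `|` [set E | exists n j, E = [set s | mtyp s n = j]].

End MassPartitions.

HB.instance Definition _ (R : realType) (K : nat) := gen_eqMixin (massp R K).
HB.instance Definition _ (R : realType) (K : nat) := gen_choiceMixin (massp R K).
HB.instance Definition _ (R : realType) (K : nat) :=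
  isPointed.Build (massp R K) (massp0 R K).
HB.instance Definition _ (R : realType) (K : nat) :=
  @isMeasurable.Build (sigma_display (@massp_gen R K)) (massp R K)
    <<s @massp_gen R K >> (@sigma_algebra0 _ setT (@massp_gen R K))
    (@sigma_algebraC (massp R K) (@massp_gen R K))
    (@sigma_algebra_bigcup _ setT (@massp_gen R K)).

(** ** Stochastic processes *)

Section Processes.
Variable R : realType.

(** The sigma-algebras [F x], [x] in [D], are mutually independent. *)
Definition mutually_independent (T : Type) (P : set T -> \bar R)
    (I : choiceType) (D : set I) (F : I -> set (set T)) : Prop :=
  forall (L : seq I) (E : I -> set T), uniq L ->
    (forall x, x \in L -> D x /\ F x (E x)) ->
    P (\bigcap_(x in [set` L]) E x) = (\prod_(x <- L) P (E x))%E.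

Section law.
Context d (T : measurableType d).

(** The sigma-algebra generated by the [Y t], [t] in [I]. *)
Definition history (O : Type) (Y : R -> O -> T) (I : set R) : set (set O) :=
  <<s [set E | exists t, I t /\ exists2 B, measurable B & E = Y t @^-1` B] >>.

(** Finite-dimensional cylinders. *)
Definition cylinder (O : Type) (Y : R -> O -> T) (n : nat) (t : nat -> R)
    (B : nat -> set T) : set O := \bigcap_(k < n) (Y (t k) @^-1` B k).

Definition same_law (O O' : Type) (P : set O -> \bar R) (P' : set O' -> \bar R)
    (Y : R -> O -> T) (Y' : R -> O' -> T) : Prop :=
  forall n (t : nat -> R) (B : nat -> set T),
    (forall k, 0 <= t k) -> (forall k, measurable (B k)) ->
    P (cylinder Y n t B) = P' (cylinder Y' n t B).

End law.

Definition cadlag (T : topologicalType) (y : R -> T) : Prop :=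
  (forall t : R, 0 <= t -> y s @[s --> t^'+] --> y t) /\
  (forall t : R, 0 < t -> exists l : T, y s @[s --> t^'-] --> l).

(** *** Poisson point processes *)

Section point_processes.
Context d (T : measurableType d) (O : Type).

(** The event that the random set of atoms [D] has exactly [k] atoms in [A]. *)
Definition atoms_event (D : O -> set T) (A : set T) (k : nat) : set O :=
  [set w | (D w `&` A #= `I_k)%card].

Definition sigma_atoms (D : O -> set T) : set (set O) :=
  <<s [set E | exists A k, measurable A /\ E = atoms_event D A k] >>.

(** The Poisson weights are written out because the library's [poisson_pmf] is
    1 when the parameter is 0.  [mu] is only meant for intensities without atoms, for which the points of
    the Poisson process are almost surely distinct. *)
Definition poisson_process (P : set O -> \bar R) (mO : set (set O))
    (mu : set T -> \bar R) (D : O -> set T) : Prop :=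
  [/\ forall A k, measurable A -> mO (atoms_event D A k),
      forall A k, measurable A -> (mu A < +oo)%E ->
        P (atoms_event D A k) =
        (fine (mu A) ^+ k / k`!%:R * expR (- fine (mu A)))%:E
    & forall n (A : nat -> set T) (k : nat -> nat),
        (forall l, measurable (A l)) -> (forall l, (mu (A l) < +oo)%E) ->
        trivIset `I_n A ->
        P (\bigcap_(l < n) atoms_event D (A l) (k l)) =
        (\prod_(l < n) P (atoms_event D (A l) (k l)))%E].

End point_processes.

End Processes.

(** ** Homogeneous fragmentations *)

Section Fragmentations.
Variables (R : realType) (K : nat).
Local Notation PN := (mpart R K setT).

Section definition.
Context d (Omega : measurableType d).
Variables (X : R -> Omega -> PN) (P : R.-pker PN ~> Omega).

Definition markov_process : Prop :=
  [/\ forall t : R, 0 <= t -> measurable_fun setT (X t),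
      forall p, {ae P p, forall w, X 0 w = p}
    & forall p s E n (t : nat -> R) (B : nat -> set PN),
        0 <= s -> history X `[0, s] E ->
        (forall k, 0 <= t k) -> (forall k, measurable (B k)) ->
        P p (E `&` cylinder X n (fun k => s + t k) B) =
        (\int[P p]_(w in E) P (X s w) (cylinder X n t B))%E].

(** The branching property for alpha = 0, where the time change by
    |pi_n|^alpha is the identity.  The nonempty blocks of [p] are indexed by
    their least elements.  A block of type 0 is a singleton, on which the
    process is necessarily constant.  The first clause says that the blocks of
    the process are obtained by fragmenting those of the initial state. *)
Definition branching : Prop := forall p : PN,
  [/\ {ae P p, forall w, forall t : R, 0 <= t ->
        forall m, blk (X t w) m `<=` blk p m},
      mutually_independent (P p) (lead p)
        (fun m => history (fun t w => restr (blk p m) (X t w)) `[0, +oo[)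
    & forall m j, lead p m -> typ p m = gtype j ->
        same_law (P p) (P (one_block R j))
          (fun t w => restr (blk p m) (X t w))
          (fun t w => restr (blk p m) (X t w))].

Definition exchangeable : Prop := forall (j : 'I_K) s (bs : bijective s),
  same_law (P (one_block R j)) (P (one_block R j))
    (fun t w => perm_part bs (X t w)) X.

Definition regular_frequencies : Prop := forall j : 'I_K,
  {ae P (one_block R j), forall w, forall m (t : R), 0 <= t ->
     cvgn (freq_seq R (blk (X t w) m)) /\
     freq R (blk (X s w) m) @[s --> t^'+] --> freq R (blk (X t w) m)}.

Definition constant_partition : Prop := forall j : 'I_K,
  {ae P (one_block R j), forall w, forall t : R, 0 <= t ->
     forall m, blk (X t w) m = blk (X 0 w) m}.

Record homogeneous_fragmentation : Prop := HomogeneousFragmentation {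
  frag_markov : markov_process ;
  frag_cadlag : forall p, {ae P p, forall w, cadlag (fun t => X t w)} ;
  frag_freq : regular_frequencies ;
  frag_exch : exchangeable ;
  frag_branching : branching ;
  frag_nonconstant : ~ constant_partition }.

End definition.

(** *** Dislocation measures and the Poissonian construction *)

(** [s] is the decreasing rearrangement of the frequencies and types of the
    blocks of [p]: the blocks with nonzero frequency are in bijection with the
    nonzero terms of [s]; the other terms of [s] are (0, 0). *)
Definition ranked_frequencies (p : PN) (s : massp R K) : Prop :=
  (forall m, cvgn (freq_seq R (blk p m))) /\
  exists g : nat -> nat,
    set_bij [set n | 0 < mass s n]
            [set m | lead p m /\ 0 < freq R (blk p m)] g /\
    forall n, 0 < mass s n ->
      freq R (blk p (g n)) = mass s n /\ typ p (g n) = mtyp s n.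

Definition paintbox (s : massp R K) (mu : set PN -> \bar R) : Prop :=
  (forall u (bu : bijective u) B, measurable B ->
     mu (perm_part bu @^-1` B) = mu B) /\
  exists2 N, measurable N & mu N = 0%E /\
    forall p, ~ N p -> ranked_frequencies p s.

Section poissonian.
Variables (c : 'I_K -> R) (nu : 'I_K -> {measure set (massp R K) -> \bar R}).
Variable kappa : R.-pker (massp R K) ~> PN.

Definition dislocation_measures : Prop := forall j,
  sigma_finite setT (nu j) /\
  (\int[nu j]_s (1 - mass s 0 * (mtyp s 0 == gtype j)%:R)%:E < +oo)%E.

(** dt (x) kappa_{nu_j}(dDelta) on [0, oo) x P_N. *)
Definition dislocation_intensity (j : 'I_K) (A : set (R * PN)) : \bar R :=
  (\int[@lebesgue_measure R]_(t in `[0%R, +oo[)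
     \int[nu j]_s kappa s (xsection A t))%E.

(** c_j dt on [0, oo). *)
Definition erosion_intensity (j : 'I_K) (A : set R) : \bar R :=
  ((c j)%:E * @lebesgue_measure R (A `&` `[0%R, +oo[%classic))%E.

(** The jumps of the path [y] started from the block N of type [i]: [D n j]
    are the atoms of Delta^(n, j), and [E n j] the times at which the integer
    [n] is eroded if its block has type [j].  Off these times, [y] is
    continuous. *)
Definition driven_by (i : 'I_K) (D : nat -> 'I_K -> set (R * PN))
    (E : nat -> 'I_K -> set R) (y : R -> PN) : Prop :=
  [/\ y 0 = one_block R i,
      cadlag y
    & forall (t : R) (p : PN), 0 < t -> y s @[s --> t^'-] --> p ->
      [/\ forall m j Delta, lead p m -> typ p m = gtype j ->
            D (block_index p m) j (t, Delta) -> y t = cut_block p m Delta,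
          forall n j, typ p n = gtype j -> E n j t -> y t = isolate p n
        & (forall m j Delta, lead p m -> typ p m = gtype j ->
             ~ D (block_index p m) j (t, Delta)) ->
          (forall n j, typ p n = gtype j -> ~ E n j t) -> y t = p]].

Section on_a_space.
Context d' (O : measurableType d').

Definition poisson_drivers (Q : probability O R)
    (D : nat -> 'I_K -> O -> set (R * PN)) (E : nat -> 'I_K -> O -> set R) :
    Prop :=
  [/\ forall n j, poisson_process Q measurable (dislocation_intensity j) (D n j),
      forall n j, poisson_process Q measurable (erosion_intensity j) (E n j)
    & mutually_independent Q setT
        (fun x : (nat * 'I_K) + (nat * 'I_K) =>
           match x with
           | inl (n, j) => sigma_atoms (D n j)
           | inr (n, j) => sigma_atoms (E n j)
           end)].

End on_a_space.

End poissonian.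

Section irreducibility.
Context d (Omega : measurableType d).
Variables (X : R -> Omega -> PN) (P : R.-pker PN ~> Omega).

(** [c] and [nu] are the erosion coefficients and dislocation measures of the
    fragmentation [X] with laws [P]. *)
Definition has_characteristics (c : 'I_K -> R)
    (nu : 'I_K -> {measure set (massp R K) -> \bar R}) : Prop :=
  [/\ forall j, 0 <= c j, dislocation_measures nu
    & exists kappa : R.-pker (massp R K) ~> PN,
      (forall s, paintbox s (kappa s)) /\
      forall i : 'I_K,
      exists (d' : measure_display) (O : measurableType d')
             (Q : probability O R) (D : nat -> 'I_K -> O -> set (R * PN))
             (E : nat -> 'I_K -> O -> set R) (Y : R -> O -> PN),
      [/\ poisson_drivers c nu kappa Q D E,
          forall t : R, 0 <= t -> measurable_fun setT (Y t),
          {ae Q, forall w,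
            driven_by i (fun n j => D n j w) (fun n j => E n j w) (Y^~ w)}
        & same_law (P (one_block R i)) Q X Y]].

(** Transition rates of the type of the tagged fragment. *)
Definition type_rate (nu : 'I_K -> {measure set (massp R K) -> \bar R})
    (i j : 'I_K) : \bar R :=
  (\int[nu i]_s \sum_(0 <= n <oo) (mass s n * (mtyp s n == gtype j)%:R)%:E)%E.

Definition irreducible_rates (q : 'I_K -> 'I_K -> \bar R) : Prop :=
  forall i j, connect (fun a b => (a != b) && (0 < q a b)%E) i j.

Definition irreducible_fragmentation : Prop :=
  exists c nu, has_characteristics c nu /\ irreducible_rates (type_rate nu).

End irreducibility.

End Fragmentations.

(** ** The associated self-similar fragmentation *)

Section SelfSimilar.
Variables (R : realType) (K : nat) (alpha : R) (y : R -> mpart R K setT).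

(** tau_n^(alpha)(t), possibly infinite. *)
Definition time_change (n : nat) (t : R) : \bar R :=
  ereal_inf [set u%:E | u in [set u : R | 0 <= u /\
    (t%:E < \int[@lebesgue_measure R]_(r in `[0%R, u])
              (freq R (blk (y r) n) `^ (- alpha))%:E)%E]].

(** The typed block containing [n] at time [t]. *)
Definition ss_block (n : nat) (t : R) : set nat * 'I_K.+1 :=
  if time_change n t == +oo%E then ([set n], ord0)
  else let u := fine (time_change n t) in (blk (y u) n, typ (y u) n).

Definition singleton_time (n : nat) : \bar R :=
  ereal_inf [set t%:E | t in [set t : R | 0 <= t /\
    (ss_block n t).1 = [set n]]].

Definition separation_time (n m : nat) : \bar R :=
  ereal_inf [set t%:E | t in [set t : R | 0 <= t /\
    ~ (ss_block m t).1 n]].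

End SelfSimilar.

(** ** Trees *)

Section Trees.
Variables (R : realType) (T : metricType R).

Definition isometric_path (x y : T) (phi : R -> T) : Prop :=
  [/\ phi 0 = x, phi (mdist x y) = y
    & {in `[0, mdist x y] &, forall s t, mdist (phi s) (phi t) = `|s - t|}].

(** The segment [[x, y]]. *)
Definition segment (x y : T) : set T :=
  [set z | exists2 phi, isometric_path x y phi &
             (phi @` `[0, mdist x y]) z].

Definition is_rtree : Prop :=
  (forall x y : T, (exists phi, isometric_path x y phi) /\
     forall phi psi, isometric_path x y phi -> isometric_path x y psi ->
       {in `[0, mdist x y], phi =1 psi}) /\
  (forall (x y : T) (q : R -> T), {within `[0, 1], continuous q} ->
     {in `[0, 1] &, injective q} -> q 0 = x -> q 1 = y ->
     q @` `[0, 1] = segment x y).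

Variable rho : T.

Definition height (x : T) : R := mdist rho x.

(** The point where [[rho, x]] and [[rho, y]] separate; it exists and is
    unique in an R-tree. *)
Definition branch_point (x y : T) : T :=
  xget rho [set z | segment rho z = segment rho x `&` segment rho y].

(** [(T, rho)] with the points [Q] is a compact tree encoding the
    alpha-self-similar fragmentation associated with the path [y]. *)
Definition encodes (K : nat) (alpha : R) (y : R -> mpart R K setT)
    (Q : nat -> T) : Prop :=
  [/\ is_rtree,
      compact [set: T],
      forall n, (height (Q n))%:E = singleton_time alpha y n,
      forall n m, n <> m ->
        (height (branch_point (Q n) (Q m)))%:E = separation_time alpha y n m
    & dense (\bigcup_n segment rho (Q n))].

End Trees.

Definition rooted_isometry (R : realType) (T T' : metricType R) (rho : T)
    (rho' : T') (Q : nat -> T) (Q' : nat -> T') (f : T -> T') : Prop :=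
  [/\ bijective f, forall x y, mdist (f x) (f y) = mdist x y,
      f rho = rho' & forall n, f (Q n) = Q' n].

Definition exists_unique_tree (R : realType) (K : nat) (alpha : R)
    (y : R -> mpart R K setT) : Prop :=
  (exists (T : metricType R) (rho : T) (Q : nat -> T),
     encodes rho alpha y Q) /\
  (forall (T T' : metricType R) (rho : T) (rho' : T')
          (Q : nat -> T) (Q' : nat -> T'),
     encodes rho alpha y Q -> encodes rho' alpha y Q' ->
     exists f : T -> T', rooted_isometry rho rho' Q Q' f).

(* Main.v *)
Require Import Defs.
From HB Require Import structures.
From mathcomp Require Import all_boot all_order all_algebra.
From mathcomp Require Import all_classical all_reals all_analysis measurable_realfun.
From mathcomp Require Import ring lra.

(** Write [a = - alpha].  The integer [n] dies at the time
    [D n n = \int_0^oo |Pi_(n)(u)|^a du] and splits from [m] at the time [D n m],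
    the same integral stopped when [n] and [m] are separated.  The matrix [D] is
    ultrametric, hence it determines an R-tree, whose points are encoded by the
    heights at which they branch off the leaves.  This tree is compact if and
    only if, up to any error, finitely many leaves suffice.  At each time only
    finitely many blocks are large, so it is enough that the masses of all
    blocks decay exponentially and uniformly.

    The second moment of the masses is bounded by the probability that two given
    integers are still together.  By the Markov and branching properties this
    probability decays exponentially as soon as it is smaller than 1 at some
    time for each initial type.  A type from which blocks are never broken could
    only lead to types of the same kind: otherwise, with positive probability,
    the first atom of the Poisson process breaking the block or changing its type
    leads to a block of another type.  By irreducibility no type would then ever
    be broken, which is excluded. *)

Set Implicit Arguments.
Unset Strict Implicit.
Unset Printing Implicit Defensive.

Import Order.TTheory GRing.Theory Num.Theory.
Import numFieldTopology.Exports numFieldNormedType.Exports.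

Local Open Scope classical_set_scope.
Local Open Scope ring_scope.

(** * The four-point condition *)

Section FourPoint.
Variables (R : realType) (T : metricType R).
Implicit Types x y z : T.

(** The randomness is confined to a few almost sure facts: the path starts from one block, blocks
    only shrink, frequencies exist, and at the times [k * t0] all masses are below [C * rho ^+ k].
    For a single path with these properties, existence, uniqueness and compactness of the tree are
    deterministic. The dislocation measures may be infinite, so a block need not have a first
    dislocation. Only the atoms that separate [0] from [1] or change the type of their block are
    counted: the integrability of [1 - s_1 1_{i_1 = i}] gives them a finite rate. Among these, the
    atoms that remain a single block of unbroken type and the other ones form independent Poisson
    processes. A path confined to unbroken types cannot meet an atom of the second kind before one
    of the first kind. So the absence of the first kind on a time interval forces the absence of the
    second, which independence allows only if the second kind has rate zero. *)

Definition four_point := forall a b c e : T,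
  mdist a b + mdist c e <= Num.max (mdist a c + mdist b e) (mdist a e + mdist b c).

Definition geodesic := forall x y : T, exists phi, isometric_path x y phi.

Lemma isometric_path_dist x y phi s : isometric_path x y phi ->
  s \in `[0, mdist x y] ->
  mdist x (phi s) = s /\ mdist (phi s) y = mdist x y - s.
Proof.
move=> [p0 p1 pi] sI; have := sI; rewrite in_itv /= => /andP[s0 s1].
have I0 : 0 \in `[0, mdist x y] by rewrite in_itv /= lexx mdist_ge0.
have I1 : mdist x y \in `[0, mdist x y] by rewrite in_itv /= lexx mdist_ge0.
split; [rewrite -{1}p0|rewrite -{1}p1]; rewrite pi //.
  by rewrite sub0r normrN ger0_norm.
by rewrite distrC ger0_norm // subr_ge0.
Qed.

Hypothesis fp : four_point.

(** The four-point inequality for [z], [z'], [x], [y] bounds [mdist z z' + mdist x y] by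
    [mdist x y], as both terms of the maximum equal it. *)
Lemma between_unique x y z z' : mdist x z + mdist z y = mdist x y ->
  mdist x z' + mdist z' y = mdist x y -> mdist x z = mdist x z' -> z = z'.
Proof.
move=> h h' e; apply: mdist_positivity; apply/eqP; rewrite eq_le mdist_ge0 andbT.
have := fp z z' x y; rewrite le_max (metric_sym z x) (metric_sym z' x).
by case/orP; lra.
Qed.

Lemma isometric_path_unique x y phi psi : isometric_path x y phi ->
  isometric_path x y psi -> {in `[0, mdist x y], phi =1 psi}.
Proof.
move=> h h' s sI; have [a b] := isometric_path_dist h sI.
have [a' b'] := isometric_path_dist h' sI.
by apply: (@between_unique x y) => //; lra.
Qed.

Lemma segmentP x y z : geodesic ->
  segment x y z <-> mdist x z + mdist z y = mdist x y.
Proof.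
move=> g; split.
  by move=> [phi h [s sI <-]]; have [-> ->] := isometric_path_dist h sI; lra.
move=> e; have [phi h] := g x y.
have sI : mdist x z \in `[0, mdist x y].
  by rewrite in_itv /= mdist_ge0 -e lerDl mdist_ge0.
exists phi => //; exists (mdist x z) => //.
have [a b] := isometric_path_dist h sI.
by apply: (@between_unique x y) => //; lra.
Qed.

(* The sign of [mdist x z + mdist w z - mdist x w], a Gromov product at [z],
   tells on which side of [z] the point [w] is; two points on different sides
   are separated by [z]. *)
Let side z x w : R :=
  if 0 < mdist x z + mdist w z - mdist x w then mdist w z else - mdist w z.

Let side_lip z x w w' : `|side z x w - side z x w'| <= mdist w w'.
Proof.
have t1 := metric_triangle w w' z; have t2 := metric_triangle w' w z.
have t3 := mdist_ge0 w z; have t4 := mdist_ge0 w' z.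
have := fp w w' x z; have := fp w x w' z; have := fp w' x w z.
have := metric_sym w w'; have := metric_sym w x; have := metric_sym w z.
have := metric_sym w' x; have := metric_sym w' z; have := metric_sym x z.
rewrite !le_max => s1 s2 s3 s4 s5 s6 f1 f2 f3; move: f1 f2 f3.
move: (metric_triangle x w z) (metric_triangle x w' z).
rewrite /side ler_norml; case: ltP => h; case: ltP => h' t5 t6;
  move=> /orP f1 /orP f2 /orP f3; apply/andP.
- by split; lra.
- by move: f1 f2 f3 => [f1|f1] [f2|f2] [f3|f3]; split; lra.
- by move: f1 f2 f3 => [f1|f1] [f2|f2] [f3|f3]; split; lra.
- by split; lra.
Qed.

(** Intermediate value theorem for [side z (q a)] along the path: it is nonnegative at [q a],
    nonpositive at [q b], and vanishes only at [z]. *)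
Lemma continuous_path_between (q : R -> T) (a b : R) z : a <= b ->
  {within `[a, b], continuous q} ->
  mdist (q a) z + mdist z (q b) = mdist (q a) (q b) ->
  exists2 t, t \in `[a, b] & q t = z.
Proof.
move=> ab cq e; have e' := metric_sym z (q b).
have [t tI ht] : exists2 t, t \in `[a, b] & side z (q a) (q t) = 0.
  apply: IVT => //.
    move=> t; apply/(@cvgrPdist_le _ R^o) => eps e0.
    have := cq t.
    move=> /metricType_numDomainType.cvgrPdist_le /(_ _ e0).
    by apply: filterS => s; apply: le_trans; exact: side_lip.
  have t0 := mdist_ge0 (q a) z; have t1 := mdist_ge0 (q b) z.
  have t2 := metric_triangle (q a) z (q b).
  have -> : side z (q a) (q a) = mdist (q a) z.
    rewrite /side mdistxx; case: ltP => //; lra.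
  have -> : side z (q a) (q b) = - mdist (q b) z.
    rewrite /side; case: ltP => //; lra.
  by rewrite ge_min le_max oppr_le0 t1 t0 orbT.
exists t => //; apply: mdist_positivity.
by move: ht; rewrite /side; case: ifP => _ //; lra.
Qed.

(** A path that left the segment would have to go through the projection of the outlying point both
    before and after it, against injectivity. *)
Lemma geodesic_four_point_rtree : geodesic -> is_rtree T.
Proof.
move=> g; split=> [x y|x y q cq iq q0 q1].
  by split=> // phi psi; exact: isometric_path_unique.
have sub a b : 0 <= a -> b <= 1 -> {within `[a, b], continuous q}.
  move=> a0 b1; apply: continuous_subspaceW cq => t /=.
  by rewrite !in_itv /= => /andP[h h']; rewrite (le_trans a0) //= (le_trans h').
apply/seteqP; split=> [_ [t tI <-]|z /(segmentP _ _ _ g) zb].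
  apply/(segmentP _ _ _ g).
  have /= := tI; rewrite in_itv /= => /andP[t0 t1].
  (* [c] is the projection of [q t] on the segment *)
  have [phi hp] := g x y.
  (* The Gromov product of [y] and [q t] at [x]: the distance from [x] at which the two geodesics
     part. *)
  pose r := (mdist x y + mdist x (q t) - mdist (q t) y) / 2.
  have rE : r * 2 = mdist x y + mdist x (q t) - mdist (q t) y.
    by rewrite /r divfK.
  have d1 := metric_triangle x (q t) y; have d2 := metric_triangle x y (q t).
  have d3 := metric_triangle (q t) x y.
  rewrite (metric_sym y) in d2; rewrite (metric_sym (q t) x) in d3.
  have rI : r \in `[0, mdist x y].
    by rewrite in_itv /= /r; apply/andP; split; lra.
  have [r1 r2] := isometric_path_dist hp rI.
  set c := phi r in r1 r2.
  have d4 := metric_triangle x c (q t); have d5 := metric_triangle (q t) c y.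
  have ec := metric_sym c (q t).
  have := fp (q t) c x y; rewrite (metric_sym (q t) x) (metric_sym c x) le_max => f.
  have e1 : mdist x c + mdist c (q t) = mdist x (q t).
    by case/orP: f => f; move: rE; lra.
  have e2 : mdist (q t) c + mdist c y = mdist (q t) y.
    by move: rE; lra.
  have [s sI qs] : exists2 s, s \in `[0, t] & q s = c.
    by apply: continuous_path_between => //; [exact: sub|rewrite q0].
  have [s' sI' qs'] : exists2 s, s \in `[t, 1] & q s = c.
    by apply: continuous_path_between => //; [exact: sub|rewrite q1].
  move: sI sI'; rewrite !in_itv /= => /andP[s0 st] /andP[ts s1].
  have ss : s = s'.
    apply: iq; last by rewrite qs qs'.
      by rewrite in_itv /= s0 (le_trans st).
    by rewrite in_itv /= s1 (le_trans t0).
  have -> : q t = c by rewrite -qs; congr q; lra.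
  by rewrite r1 r2; lra.
have [|||t tI <-] := @continuous_path_between q 0 1 z; rewrite ?q0 ?q1 //.
Qed.

End FourPoint.

(** * Branch points in rooted R-trees *)

Section RootedRTree.
Variables (R : realType) (T : metricType R) (rho : T).
Hypothesis rT : is_rtree T.
Implicit Types x y z w : T.

Local Notation ht := (height rho).

Lemma height_ge0 x : 0 <= ht x. Proof. exact: mdist_ge0. Qed.

Lemma isometric_path_prefix x phi r : isometric_path rho x phi ->
  r \in `[0, ht x] -> isometric_path rho (phi r) phi.
Proof.
move=> h rI; have [hr _] := isometric_path_dist h rI.
have [p0 _ pI] := h; split=> //; first by rewrite hr.
move=> s t sI tI; apply: pI; move: rI sI tI; rewrite hr !in_itv /= => /andP[_ h1].
  by move=> /andP[-> /le_trans] /= -> .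
by move=> _ /andP[-> /le_trans] /= ->.
Qed.

Lemma segment_height x phi w : isometric_path rho x phi -> segment rho x w ->
  ht w \in `[0, ht x] /\ phi (ht w) = w.
Proof.
move=> h [psi h' [s sI <-]]; have [e _] := isometric_path_dist h' sI.
by rewrite /height e; split=> //; exact: (rT.1 rho x).2 h h' _ sI.
Qed.

Lemma segment_path x phi r : isometric_path rho x phi -> r \in `[0, ht x] ->
  segment rho x (phi r).
Proof. by move=> h rI; exists phi => //; exists r. Qed.

Lemma segment_end x : segment rho x x.
Proof.
have [[phi h] _] := rT.1 rho x; exists phi => //; exists (mdist rho x).
  by rewrite /= in_itv /= lexx mdist_ge0.
by have [] := h.
Qed.

Lemma segment_dist x w : segment rho x w -> mdist w x = ht x - ht w.
Proof.
by move=> [phi h [s sI <-]]; have [a b] := isometric_path_dist h sI;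
  rewrite /height b a.
Qed.

Lemma segment_height_le x w : segment rho x w -> ht w <= ht x.
Proof. by move=> /segment_dist; move: (mdist_ge0 w x); lra. Qed.

Lemma segment_le x w w' : segment rho x w -> segment rho x w' ->
  ht w <= ht w' -> segment rho w' w.
Proof.
have [[phi h] _] := rT.1 rho x.
move=> /(segment_height h) [_ e] /(segment_height h) [I' e'] ww'.
have := isometric_path_prefix h I'; rewrite e' => h'.
by rewrite -e; apply: segment_path => //; rewrite in_itv /= height_ge0.
Qed.

Lemma segment_trans x w w' : segment rho x w -> segment rho w w' ->
  segment rho x w'.
Proof.
have [[phi h] _] := rT.1 rho x.
move=> /(segment_height h) [I e]; have := isometric_path_prefix h I.
rewrite e => h' /(segment_height h') [I' e'].
rewrite -e'; apply: segment_path => //; move: I I'; rewrite !in_itv /=.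
by move=> /andP[_ h1] /andP[-> /le_trans] /= ->.
Qed.

(** The isometric paths to [x] and [y] agree up to a largest height [h], attained because both are
    1-Lipschitz. Going down from [x] to that point and up to [y] is an injective continuous path,
    hence covers the segment from [x] to [y] by the second axiom of R-trees; so the point lies
    between [x] and [y], which gives the distance. *)
Lemma branch_point_exists x y : exists z,
  segment rho z = segment rho x `&` segment rho y /\
  mdist x y = ht x + ht y - 2 * ht z.
Proof.
have [[phi hp] _] := rT.1 rho x; have [[psi hq] _] := rT.1 rho y.
have [p0 p1 pI] := hp; have [q0 q1 qI] := hq.
pose A := [set r | [/\ r \in `[0, ht x], r \in `[0, ht y] & phi r = psi r]].
have A0 : A 0 by split; rewrite ?in_itv /= ?lexx ?height_ge0 ?p0.
have Aub r : A r -> r <= ht x /\ r <= ht y.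
  by move=> []; rewrite !in_itv /= => /andP[_ ?] /andP[_ ?].
have hA : has_sup A.
  by split; [exists 0|exists (ht x) => r /Aub []].
set h := sup A.
have h0 : 0 <= h by apply: sup_upper_bound.
have hx : h <= ht x by apply: sup_le_ub; [exists 0|move=> r /Aub []].
have hy : h <= ht y by apply: sup_le_ub; [exists 0|move=> r /Aub []].
have Ix : h \in `[0, ht x] by rewrite in_itv /= h0 hx.
have Iy : h \in `[0, ht y] by rewrite in_itv /= h0 hy.
have e : phi h = psi h.
  apply: mdist_positivity; apply/eqP; rewrite eq_le mdist_ge0 andbT.
  apply/ler_addgt0Pl => eps e0; rewrite addr0.
  have e2 : 0 < eps / 2 by rewrite divr_gt0.
  have [r Ar hr] := sup_adherent e2 hA.
  have rh : r <= h by exact: sup_upper_bound.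
  have [rx ry er] := Ar.
  apply: le_trans (metric_triangle _ (phi r) _) _.
  rewrite pI // {1}er qI // ger0_norm ?subr_ge0 // ler0_norm ?subr_le0 //.
  by rewrite -/h in hr; lra.
have [hz _] := isometric_path_dist hp Ix.
have sx : segment rho x (phi h) by exact: segment_path.
have sy : segment rho y (phi h) by rewrite e; exact: segment_path.
exists (phi h); split.
  apply/seteqP; split=> [w sw|w [wx wy]].
    by split; [exact: segment_trans sw|exact: segment_trans sw].
  apply: segment_le (wx) (sx) _; rewrite {2}/height hz.
  have [Iwx ewx] := segment_height hp wx; have [Iwy ewy] := segment_height hq wy.
  by apply: sup_upper_bound => //; split=> //; rewrite ewx ewy.
rewrite {3}/height hz.
have dzx := segment_dist sx; have dzy := segment_dist sy.
rewrite {2}/height hz in dzx; rewrite {2}/height hz in dzy.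
have [ex|nx] := eqVneq h (ht x).
  have ez : phi h = x by rewrite ex.
  by rewrite ez in dzy; lra.
have [ey|ny] := eqVneq h (ht y).
  have ez : phi h = y by rewrite e ey.
  by rewrite ez metric_sym in dzx; lra.
have {nx}hx' : h < ht x by rewrite lt_neqAle nx.
have {ny}hy' : h < ht y by rewrite lt_neqAle ny.
pose L := ht x + ht y - 2 * h.
have L0 : 0 < L by rewrite /L; lra.
pose q t := if t * L <= ht x - h then phi (ht x - t * L)
            else psi (2 * h - ht x + t * L).
have tL t : t \in `[0, 1] -> 0 <= t * L <= L.
  rewrite in_itv /= => /andP[t0 t1].
  by rewrite mulr_ge0 ?(ltW L0) //= ler_piMl ?(ltW L0).
have Ip t : t \in `[0, 1] -> t * L <= ht x - h -> ht x - t * L \in `[0, ht x].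
  by move=> /tL /andP[? ?] ?; rewrite in_itv /=; apply/andP; split; lra.
have Iq t : t \in `[0, 1] -> ht x - h < t * L ->
    2 * h - ht x + t * L \in `[0, ht y].
  by move=> /tL /andP[? /[dup] ?]; rewrite /L => ? ?; rewrite in_itv /=;
    apply/andP; split; lra.
have qlip s t : s \in `[0, 1] -> t \in `[0, 1] -> s <= t ->
    mdist (q s) (q t) <= (t - s) * L.
  move=> sI tI st; rewrite mulrBl /q.
  have {}st : s * L <= t * L by rewrite ler_wpM2r // ltW.
  case: (leP (s * L)) => hs; case: (leP (t * L)) => ht'.
  - rewrite pI ?Ip // ger0_norm; lra.
  - apply: le_trans (metric_triangle _ (phi h) _) _.
    rewrite pI ?Ip // {1}e qI ?Iq // ger0_norm ?ler0_norm; lra.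
  - lra.
  - rewrite qI ?Iq // ler0_norm; lra.
have : q @` `[0, 1] = segment x y.
  apply: (rT.2 x y q).
  - apply/subspace_continuousP => t /= tI.
    apply/metricType_numDomainType.cvgrPdist_le => eps e0.
    rewrite near_withinE.
    near=> s => sI.
    have : `|t - s| * L <= eps.
      rewrite -ler_pdivlMr //; near: s.
      apply: (@cvgr_dist_le _ R^o); [exact: cvg_id|by rewrite divr_gt0].
    apply: le_trans.
    have [st|st] := leP s t.
      by rewrite metric_sym ger0_norm ?subr_ge0 // qlip.
    by rewrite ler0_norm ?subr_le0 ?(ltW st) // opprB qlip // ltW.
  (* The second half stays strictly above height [h], so a coincidence of the two halves would be a
     common point of the paths above [h]. *)
  - move=> s t sI tI; rewrite /q.
    have inj : s * L = t * L -> s = t by apply: mulIf; rewrite gt_eqF.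
    case: (leP (s * L)) => hs; case: (leP (t * L)) => ht' E.
    + apply: inj; have [] := isometric_path_dist hp (Ip _ sI hs).
      by have [] := isometric_path_dist hp (Ip _ tI ht'); rewrite E; lra.
    + have [a _] := isometric_path_dist hp (Ip _ sI hs).
      have [b _] := isometric_path_dist hq (Iq _ tI ht').
      rewrite E b in a.
      suff : ht x - s * L <= h by lra.
      apply: sup_upper_bound => //; split; [exact: Ip|by rewrite -a; exact: Iq|].
      by rewrite E a.
    + have [a _] := isometric_path_dist hq (Iq _ sI hs).
      have [b _] := isometric_path_dist hp (Ip _ tI ht').
      rewrite E b in a.
      suff : ht x - t * L <= h by lra.
      apply: sup_upper_bound => //; split; [exact: Ip|by rewrite a; exact: Iq|].
      by rewrite -E a.
    + apply: inj; have [] := isometric_path_dist hq (Iq _ sI hs).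
      by have [] := isometric_path_dist hq (Iq _ tI ht'); rewrite E; lra.
  - by rewrite /q mul0r subr0 subr_ge0 (ltW hx').
  - rewrite /q mul1r ifF; last by apply/negbTE; rewrite -ltNge /L; lra.
    by rewrite (_ : 2 * h - _ + _ = ht y) // /L; lra.
move=> E; have : segment x y (phi h).
  rewrite -E; exists ((ht x - h) / L).
    rewrite /= in_itv /=; apply/andP; split.
      by apply: divr_ge0; lra.
    by rewrite ler_pdivrMr // mul1r /L; lra.
  by rewrite /q divfK ?gt_eqF // lexx; congr phi; lra.
move=> [f hf [s sI fs]]; have [] := isometric_path_dist hf sI.
rewrite fs; have := metric_sym x (phi h); lra.
Unshelve. all: by end_near. Qed.

Definition gromov x y := (ht x + ht y - mdist x y) / 2.

Lemma gromovP x y : exists z,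
  segment rho z = segment rho x `&` segment rho y /\ gromov x y = ht z.
Proof.
have [z [zs zd]] := branch_point_exists x y; exists z; split=> //.
by rewrite /gromov zd; lra.
Qed.

(** Whatever point [xget] selects has the same segment from the root, and a segment determines the
    height of its end. *)
Lemma height_branch_point x y : ht (branch_point rho x y) = gromov x y.
Proof.
have [z [zs ->]] := gromovP x y.
rewrite /branch_point; case: xgetP => [w _ /= ws|/(_ z) //].
apply/eqP; rewrite eq_le; apply/andP; split; apply: segment_height_le.
  by rewrite zs -ws; exact: segment_end.
by rewrite ws -zs; exact: segment_end.
Qed.

Lemma gromov_sym x y : gromov x y = gromov y x.
Proof. by rewrite /gromov metric_sym [ht x + _]addrC. Qed.

Lemma gromovxx x : gromov x x = ht x.
Proof. by rewrite /gromov mdistxx; lra. Qed.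

Lemma gromov_ge0 x y : 0 <= gromov x y.
Proof. by have [z [_ ->]] := gromovP x y; exact: height_ge0. Qed.

Lemma gromov_le x y : gromov x y <= ht x.
Proof.
have [z [zs ->]] := gromovP x y; apply: segment_height_le.
by have := segment_end z; rewrite zs => -[].
Qed.

Lemma gromov_segment x w : segment rho x w -> gromov w x = ht w.
Proof. by move=> /segment_dist e; rewrite /gromov e; lra. Qed.

(** Both branch points lie on the segment to [y], hence are comparable; the lower one is then on the
    segments to [x] and to [z]. *)
Lemma gromov_ultra x y z : Num.min (gromov x y) (gromov y z) <= gromov x z.
Proof.
have [u [us ->]] := gromovP x y; have [v [vs ->]] := gromovP y z.
have [w [ws ->]] := gromovP x z.
have := segment_end u; rewrite us => -[ux uy].
have := segment_end v; rewrite vs => -[vy vz].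
have [uv|vu] := leP (ht u) (ht v); apply: segment_height_le; rewrite ws; split=> //.
  by apply: segment_trans (vz) _; exact: (segment_le uy vy).
by apply: segment_trans (ux) _; apply: (segment_le vy uy); exact: ltW.
Qed.

Lemma gromov_lip x y z : `|gromov x z - gromov y z| <= mdist x y.
Proof.
rewrite /gromov /height ler_norml; have := metric_sym x y.
have := metric_triangle rho x y; have := metric_triangle rho y x.
have := metric_triangle x y z; have := metric_triangle y x z.
by move=> *; apply/andP; split; lra.
Qed.

Lemma height_lip x y : `|ht x - ht y| <= mdist x y.
Proof.
rewrite /height ler_norml; have := metric_sym x y.
have := metric_triangle rho x y; have := metric_triangle rho y x.
by move=> *; apply/andP; split; lra.
Qed.

End RootedRTree.

(** * The tree of an ultrametric matrix *)

Section TreeMatrix.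
Variable R : realType.

(* [D n m] is meant to be the height of the branch point of the leaves [n] and
   [m], and [D n n] the height of [n]. *)
Record tree_matrix (D : nat -> nat -> R) : Prop := TreeMatrix {
  tmx_ge0 : forall n m, 0 <= D n m ;
  tmx_sym : forall n m, D n m = D m n ;
  tmx_le : forall n m, D n m <= D n n ;
  tmx_ultra : forall n m l, Num.min (D n m) (D m l) <= D n l ;
  tmx_precompact : forall e, 0 < e -> exists N, forall n,
    exists2 m, (m < N)%N & D n n - D n m <= e }.

(* A point [x] of the tree is represented by the function mapping [m] to the
   height of the branch point of [x] and the leaf [m]. *)
Definition tree_fun (D : nat -> nat -> R) (g : nat -> R) : Prop :=
  [/\ forall m, 0 <= g m, forall m, g m <= D m m,
      forall m l, Num.min (g m) (D m l) <= g l
    & forall m l, Num.min (g m) (g l) <= D m l].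

(** Height of the branch point of [f] and [g]: the part common to them and to the leaf [m] reaches
    height [Num.min (f m) (g m)], and suitable leaves come arbitrarily close. In particular
    [meet_height f f] is the height of [f]. *)
Definition meet_height (f g : nat -> R) : R :=
  sup [set Num.min (f m) (g m) | m in setT].

Definition fdist (f g : nat -> R) : R :=
  meet_height f f + meet_height g g - 2 * meet_height f g.

(** The ancestor of [g] at height [r], or [g] itself if it is lower; the maximum with 0 keeps it a
    [tree_fun] for every real [r]. *)
Definition trunc_fun (g : nat -> R) (r : R) : nat -> R :=
  fun m => Num.min (g m) (Num.max r 0).

Variables (D : nat -> nat -> R) (hD : tree_matrix D).
Local Notation tfun := (tree_fun D).
Local Notation mh := meet_height.

Lemma tree_matrix_bounded : exists C, forall n, D n n <= C.
Proof.
have [N hN] := tmx_precompact hD ltr01.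
exists (1 + \sum_(m < N) D m m) => n; have [m mN h] := hN n.
have : D n m <= \sum_(m < N) D m m.
  rewrite (tmx_sym hD); apply: le_trans (tmx_le hD _ _) _.
  rewrite (bigD1 (Ordinal mN)) //= lerDl sumr_ge0 // => *; exact: (tmx_ge0 hD).
lra.
Qed.

Let tree_has_sup f g : tfun f -> tfun g ->
  has_sup [set Num.min (f m) (g m) | m in setT].
Proof.
move=> [_ fD _ _] _; have [C hC] := tree_matrix_bounded.
split; first by exists (Num.min (f 0%N) (g 0%N)), 0%N.
by exists C => _ [m _ <-]; rewrite ge_min (le_trans (fD m)).
Qed.

Lemma meet_height_ub f g m : tfun f -> tfun g ->
  Num.min (f m) (g m) <= mh f g.
Proof. by move=> tf tg; apply: sup_upper_bound; [exact: tree_has_sup|exists m]. Qed.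

Lemma meet_height_le f g C : (forall m, Num.min (f m) (g m) <= C) -> mh f g <= C.
Proof.
move=> h; apply: sup_le_ub; first by exists (Num.min (f 0%N) (g 0%N)), 0%N.
by move=> _ [m _ <-].
Qed.

Lemma meet_height_adherent f g e : tfun f -> tfun g -> 0 < e ->
  exists m, mh f g - e < f m /\ mh f g - e < g m.
Proof.
move=> tf tg e0; have [_ [m _ <-]] := sup_adherent e0 (tree_has_sup tf tg).
by rewrite lt_min => /andP[]; exists m.
Qed.

Lemma meet_heightC f g : mh f g = mh g f.
Proof.
by rewrite /meet_height; congr sup; apply/seteqP; split=> _ [m _ <-]; exists m;
  rewrite // minC.
Qed.

Lemma meet_height_ge0 f g : tfun f -> tfun g -> 0 <= mh f g.
Proof.
move=> tf tg; apply: le_trans (meet_height_ub 0 tf tg).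
by case: tf tg => f0 _ _ _ [g0 _ _ _]; rewrite le_min f0 g0.
Qed.

Lemma meet_heightxx_ub f m : tfun f -> f m <= mh f f.
Proof. by move=> tf; have := meet_height_ub m tf tf; rewrite minxx. Qed.

Lemma meet_height_diag f g : tfun f -> tfun g -> mh f g <= mh f f.
Proof.
move=> tf tg; apply: meet_height_le => m; rewrite ge_min.
by rewrite (meet_heightxx_ub m tf).
Qed.

(** Leaves [m] and [l] almost optimal for the two pairs are both high along [g], so [D m l] is
    large, and [h] is then high along [m] as well. *)
Lemma meet_height_ultra f g h : tfun f -> tfun g -> tfun h ->
  Num.min (mh f g) (mh g h) <= mh f h.
Proof.
move=> tf tg th; apply/ler_addgt0Pl => e e0.
have [m [fm gm]] := meet_height_adherent tf tg e0.
have [l [gl hl]] := meet_height_adherent tg th e0.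
have [_ _ _ gD] := tg; have [_ _ hh _] := th.
have := gD m l; have := hh l m; have := meet_height_ub m tf th.
rewrite (tmx_sym hD l m) !ge_min => /orP h1 /orP h2 /orP h3; apply/orP.
by move: h1 h2 h3 => [h1|h1] [h2|h2] [h3|h3]; have [a|a] := leP (mh f g) (mh g h);
  [left|right|left|right|left|right|left|right|
   left|right|left|right|left|right|left|right]; lra.
Qed.

Lemma meet_height_min f g m : tfun f -> tfun g ->
  Num.min (mh f g) (f m) <= g m.
Proof.
move=> tf tg; apply/ler_addgt0Pl => e e0.
have [n [fn gn]] := meet_height_adherent tf tg e0.
have [_ _ _ fD] := tf; have [_ _ hg _] := tg.
have := fD n m; have := hg n m; rewrite !ge_min => /orP h1 /orP h2; apply/orP.
by move: h1 h2 => [h1|h1] [h2|h2]; have [a|a] := leP (mh f g) (f m);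
  [left|right|left|right|left|right|left|right]; lra.
Qed.

Lemma fdistxx f : fdist f f = 0. Proof. by rewrite /fdist; lra. Qed.

Lemma fdistC f g : fdist f g = fdist g f.
Proof. by rewrite /fdist (meet_heightC f g) [X in X - _]addrC. Qed.

Lemma fdist_eq0 f g : tfun f -> tfun g -> fdist f g = 0 -> f = g.
Proof.
move=> tf tg; rewrite /fdist => e.
have a := meet_height_diag tf tg; have := meet_height_diag tg tf.
rewrite meet_heightC => b.
apply/funext => m; apply/eqP; rewrite eq_le.
have := meet_height_min m tf tg; have := meet_height_min m tg tf.
rewrite (meet_heightC g f); have := meet_heightxx_ub m tf.
have := meet_heightxx_ub m tg; rewrite !ge_min => h1 h2 /orP h3 /orP h4.
by apply/andP; split; [case: h4|case: h3] => h; lra.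
Qed.

Lemma fdist_triangle f g h : tfun f -> tfun g -> tfun h ->
  fdist f h <= fdist f g + fdist g h.
Proof.
move=> tf tg th; rewrite /fdist.
have a := meet_height_diag tg tf; rewrite (meet_heightC g f) in a.
have b := meet_height_diag tg th.
have := meet_height_ultra tf tg th; rewrite ge_min => /orP[]; lra.
Qed.

Lemma fdist_four_point a b c e :
  tfun a -> tfun b -> tfun c -> tfun e ->
  fdist a b + fdist c e <= Num.max (fdist a c + fdist b e) (fdist a e + fdist b c).
Proof.
move=> ta tb tc te; rewrite /fdist le_max; apply/orP.
have := meet_height_ultra ta tc tb; have := meet_height_ultra ta te tb.
have := meet_height_ultra tc ta te; have := meet_height_ultra tc tb te.
rewrite !ge_min (meet_heightC c b) (meet_heightC e b) (meet_heightC c a).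
move=> /orP h1 /orP h2 /orP h3 /orP h4.
have [h|h] := leP (mh a c + mh b e) (mh a e + mh b c); [left|right];
by move: h1 h2 h3 h4 => [h1|h1] [h2|h2] [h3|h3] [h4|h4]; lra.
Qed.

Lemma tree_fun_trunc g r : tfun g -> tfun (trunc_fun g r).
Proof.
move=> [g0 gD gl g2]; have r0 : 0 <= Num.max r 0 by rewrite le_max lexx orbT.
rewrite /trunc_fun; split=> [m|m|m l|m l]; move: (Num.max r 0) r0 => {}r r0.
- by rewrite le_min g0 r0.
- by rewrite ge_min gD.
- by rewrite minAC le_min; apply/andP; split; rewrite ge_min ?gl ?lexx ?orbT.
- by rewrite minACA ge_min g2.
Qed.

Lemma meet_height_trunc f g r s : tfun f -> tfun g -> 0 <= r -> 0 <= s ->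
  mh (trunc_fun f r) (trunc_fun g s) = Num.min (mh f g) (Num.min r s).
Proof.
move=> tf tg r0 s0; rewrite /trunc_fun !max_l //.
have tf' := tree_fun_trunc r tf; have tg' := tree_fun_trunc s tg.
rewrite /trunc_fun !max_l // in tf' tg'.
apply/eqP; rewrite eq_le; apply/andP; split.
  apply: meet_height_le => m; rewrite minACA le_min; apply/andP; split.
    by rewrite ge_min (meet_height_ub m tf tg).
  by rewrite ge_min lexx orbT.
apply/ler_addgt0Pl => e e0; have [m [fm gm]] := meet_height_adherent tf tg e0.
have := meet_height_ub m tf' tg'.
have := lexx (Num.min (mh f g) (Num.min r s)).
rewrite /= !le_min => /and3P[h1 h2 h3]; rewrite !ge_min -!orbA.
by case/or4P => h; lra.
Qed.

End TreeMatrix.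

(** The type is indexed by [hD] so that the metric instance, whose axioms rest on it, can be
    attached. *)
Definition model_tree (R : realType) (D : nat -> nat -> R)
  (hD : tree_matrix D) : Type := {g : nat -> R | tree_fun D g}.

HB.instance Definition _ (R : realType) (D : nat -> nat -> R)
  (hD : tree_matrix D) := gen_eqMixin (model_tree hD).
HB.instance Definition _ (R : realType) (D : nat -> nat -> R)
  (hD : tree_matrix D) := gen_choiceMixin (model_tree hD).

Section ModelTreeMetric.
Variables (R : realType) (D : nat -> nat -> R) (hD : tree_matrix D).
Local Notation M := (model_tree hD).

Lemma model_inj (x y : M) : sval x = sval y -> x = y.
Proof. by case: x y => [f p] [g q] /= e; apply: eq_exist. Qed.

Definition model_dist (x y : M) : R := fdist (sval x) (sval y).

Lemma model_distxx x : model_dist x x = 0.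
Proof. exact: fdistxx. Qed.

Lemma model_dist_eq0 x y : model_dist x y = 0 -> x = y.
Proof.
move=> e; apply: model_inj; exact: (fdist_eq0 hD (svalP x) (svalP y)).
Qed.

Lemma model_distC x y : model_dist x y = model_dist y x.
Proof. exact: fdistC. Qed.

Lemma model_dist_triangle y x z : model_dist x z <= model_dist x y + model_dist y z.
Proof. exact: (fdist_triangle hD (svalP _) (svalP _) (svalP _)). Qed.

End ModelTreeMetric.

HB.instance Definition _ (R : realType) (D : nat -> nat -> R)
    (hD : tree_matrix D) :=
  isMetric.Build R (model_tree hD) (@model_distxx R D hD)
    (@model_dist_eq0 R D hD) (@model_distC R D hD) (@model_dist_triangle R D hD).

(** * The model is a compact R-tree with the prescribed branching heights *)

Section ModelTreeTheory.
Variables (R : realType) (D : nat -> nat -> R) (hD : tree_matrix D).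
Local Notation M := (model_tree hD).
Local Notation mh := meet_height.
Implicit Types x y z : M.

Lemma mdist_modelE x y : mdist x y = fdist (sval x) (sval y).
Proof. by []. Qed.

Lemma root_subproof : tree_fun D (fun=> 0).
Proof.
split=> // *; rewrite ?(tmx_ge0 hD) // ?ge_min ?lexx //.
by rewrite (tmx_ge0 hD).
Qed.

Definition model_root : M := exist _ _ root_subproof.

Lemma leaf_subproof n : tree_fun D (D n).
Proof.
split=> *; rewrite ?(tmx_ge0 hD) ?(tmx_ultra hD) //.
  by rewrite (tmx_sym hD) (tmx_le hD).
by rewrite (tmx_sym hD) (tmx_ultra hD).
Qed.

Definition leaf n : M := exist _ _ (leaf_subproof n).

Definition model_trunc x r : M := exist _ _ (tree_fun_trunc r (svalP x)).

Definition meet_ht x y := mh (sval x) (sval y).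

Lemma meet_htC x y : meet_ht x y = meet_ht y x. Proof. exact: meet_heightC. Qed.

Lemma meet_ht_le x y : meet_ht x y <= meet_ht x x.
Proof. exact: (meet_height_diag hD (svalP _) (svalP _)). Qed.

Lemma meet_ht_ge0 x y : 0 <= meet_ht x y.
Proof. exact: (meet_height_ge0 hD (svalP _) (svalP _)). Qed.

Lemma meet_ht_trunc x y r s : 0 <= r -> 0 <= s ->
  meet_ht (model_trunc x r) (model_trunc y s) =
    Num.min (meet_ht x y) (Num.min r s).
Proof. exact: (meet_height_trunc hD (svalP _) (svalP _)). Qed.

Lemma meet_ht_truncl x y r : 0 <= r ->
  meet_ht (model_trunc x r) y = Num.min (meet_ht x y) r.
Proof.
move=> r0; have C0 : 0 <= Num.max r (meet_ht y y) by rewrite le_max r0.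
suff {1}-> : y = model_trunc y (Num.max r (meet_ht y y)).
  rewrite meet_ht_trunc // (min_l (x := r)) // le_max lexx //.
apply: model_inj; apply/funext => m /=; rewrite /trunc_fun min_l //.
have := meet_heightxx_ub hD m (svalP y); rewrite -/(meet_ht y y) => h.
by rewrite !le_max h !orbT.
Qed.

Lemma meet_ht_leaf x n : meet_ht x (leaf n) = sval x n.
Proof.
apply/eqP; rewrite eq_le; have [_ xD xl _] := svalP x; apply/andP; split.
  by apply: meet_height_le => m /=; rewrite (tmx_sym hD); exact: xl.
have := meet_height_ub hD n (svalP x) (leaf_subproof n); rewrite min_l //.
Qed.

Lemma meet_ht_root x : meet_ht model_root x = 0.
Proof.
apply/eqP; rewrite eq_le meet_ht_ge0 andbT; apply: meet_height_le => m /=.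
by rewrite ge_min lexx.
Qed.

Lemma height_model x : height model_root x = meet_ht x x.
Proof.
have := meet_ht_root model_root; have := meet_ht_root x.
by rewrite /height mdist_modelE /fdist /meet_ht; lra.
Qed.

Lemma model_four_point : four_point M.
Proof.
move=> a b c e.
exact: (fdist_four_point hD (svalP _) (svalP _) (svalP _) (svalP _)).
Qed.

Lemma mdistE x y : mdist x y = meet_ht x x + meet_ht y y - 2 * meet_ht x y.
Proof. by []. Qed.

Lemma model_geodesic : geodesic M.
Proof.
move=> x y; have c0 := meet_ht_ge0 x y; have cx := meet_ht_le x y.
have cy := meet_ht_le y x; rewrite meet_htC in cy.
(* Down from [x] to the height of the branch point, then up to [y]. *)
pose phi s := if s <= meet_ht x x - meet_ht x y then model_trunc x (meet_ht x x - s)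
              else model_trunc y (2 * meet_ht x y - meet_ht x x + s).
exists phi; split.
- rewrite /phi subr_ge0 cx subr0; apply: mdist_positivity.
  rewrite mdistE meet_ht_trunc ?meet_ht_truncl ?meet_ht_ge0 // !minxx; lra.
- rewrite /phi mdistE; case: ifPn => [h|_]; last first.
    have -> : 2 * meet_ht x y - meet_ht x x +
      (meet_ht x x + meet_ht y y - 2 * meet_ht x y) = meet_ht y y by lra.
    apply: mdist_positivity.
    rewrite mdistE meet_ht_trunc ?meet_ht_truncl ?meet_ht_ge0 // !minxx; lra.
  have e : meet_ht y y = meet_ht x y by lra.
  apply: mdist_positivity; rewrite mdistE.
  have -> : meet_ht x x - (meet_ht x x + meet_ht y y - 2 * meet_ht x y) =
    meet_ht x y by lra.
  by rewrite meet_ht_trunc ?meet_ht_truncl // !minxx min_r //; lra.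
- move=> s t; rewrite !in_itv /= mdistE => /andP[s0 s1] /andP[t0 t1].
  wlog st : s t s0 s1 t0 t1 / s <= t => [W|].
    by have [|/ltW] := leP s t => ?; [|rewrite metric_sym distrC]; exact: W.
  rewrite ler0_norm ?subr_le0 // opprB mdistE /phi.
  case: (leP s (meet_ht x x - meet_ht x y)) => hs;
    case: (leP t (meet_ht x x - meet_ht x y)) => ht;
    rewrite !meet_ht_trunc; try lra; rewrite !minxx.
  + by rewrite !min_r ?le_min ?ge_min; lra.
  + rewrite (min_r (x := meet_ht x x)) ?(min_r (x := meet_ht y y)); try lra.
    by rewrite min_l ?le_min; lra.
  + by rewrite !(min_r (x := meet_ht y y)) ?(min_l (x := _ + s)) ?ge_min; lra.
Qed.

Lemma model_is_rtree : is_rtree M.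
Proof. exact: geodesic_four_point_rtree model_four_point model_geodesic. Qed.

Lemma height_leaf n : height model_root (leaf n) = D n n.
Proof. by rewrite height_model meet_ht_leaf. Qed.

Lemma gromov_model x y : gromov model_root x y = meet_ht x y.
Proof. by rewrite /gromov !height_model mdistE; lra. Qed.

Lemma height_branch_leaf n m :
  height model_root (branch_point model_root (leaf n) (leaf m)) = D n m.
Proof.
by rewrite (height_branch_point _ model_is_rtree) gromov_model meet_ht_leaf.
Qed.

(** [x] and the leaf [n] share their way from the root up to height [sval x n], which for some [n]
    is almost the height of [x]. *)
Lemma model_approx x e : 0 < e ->
  exists2 n, meet_ht x x - e < sval x n &
    mdist x (model_trunc (leaf n) (sval x n)) < e.
Proof.
move=> e0; have [n [xn _]] := meet_height_adherent hD (svalP x) (svalP x) e0.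
exists n => //; have [x0 xD _ _] := svalP x.
rewrite mdistE meet_ht_trunc // meet_htC meet_ht_truncl // [meet_ht (leaf n) x]meet_htC.
rewrite !meet_ht_leaf !minxx.
rewrite min_r //; rewrite -/(meet_ht x x) in xn; lra.
Qed.

Lemma model_dense : dense (\bigcup_n segment model_root (leaf n)).
Proof.
move=> U [x Ux] oU.
have := open_nbhs_nbhs (conj oU Ux).
rewrite -metricType_numDomainType.filter_from_mdist_nbhs => -[e e0 he].
have [n _ hn] := model_approx x e0.
exists (model_trunc (leaf n) (sval x n)); split; first exact: he.
have [x0 xD _ _] := svalP x.
exists n => //; apply/(segmentP model_four_point _ _ _ model_geodesic).
have := height_model (leaf n).
have := height_model (model_trunc (leaf n) (sval x n)); rewrite /height => -> ->.
rewrite mdistE meet_ht_trunc // meet_ht_truncl // !meet_ht_leaf.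
by rewrite minxx /= min_r //; lra.
Qed.

(** By precompactness one of the first [N] coordinates is within [2 * e] of the height of a given
    point. Hence the meet of [x] and [y] is above the height of [x] minus [3 * e], the height of [y]
    is below that of [x] plus [3 * e], and the distance is less than [3 * e + 2 * (3 * e)]. *)
Lemma model_finite_coordinates e : 0 < e -> exists N, forall x y,
  (forall m, (m < N)%N -> `|sval x m - sval y m| < e) -> mdist x y < 9 * e.
Proof.
move=> e0; have [N hN] := tmx_precompact hD e0; exists N.
have near x : exists2 m, (m < N)%N & meet_ht x x - 2 * e < sval x m.
  have [n xn _] := model_approx x e0.
  have [m mN h] := hN n; exists m => //.
  have [_ xD xl _] := svalP x; have := xl n m; have := xD n.
  by rewrite ge_min => h1 /orP[]; lra.
move=> x y hxy; rewrite mdistE.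
have [m mN hm] := near x; have [l lN hl] := near y.
have := hxy _ mN; have := hxy _ lN; rewrite !ltr_norml => /andP[a1 a2] /andP[a3 a4].
have := meet_height_ub hD m (svalP x) (svalP y); rewrite -/(meet_ht x y) ge_min.
have := meet_heightxx_ub hD l (svalP x); rewrite -/(meet_ht x x) => a5.
by case/orP; lra.
Qed.

Import ArrowAsProduct.

(** The coordinates map the model into the product of the intervals from 0 to [D m m], compact by
    Tychonoff. A cluster point there satisfies the same closed inequalities, hence is a point of the
    model, and closeness of finitely many coordinates is closeness in the metric. *)
Lemma model_compact : compact [set: M].
Proof.
move=> F PF _.
pose T (_ : nat) := R : topologicalType.
pose A (m : nat) : set (T m) := [set` `[0, D m m]].
have cA : compact [set f : forall m, T m | forall m, A m (f m)].
  by apply: tychonoff => m; exact: segment_compact.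
pose G : set_system (forall m, T m) := fmap (fun x : M => sval x : forall m, T m) F.
have PG : ProperFilter G by exact: fmap_proper_filter.
have [|g [_ cg]] := cA G _.
  rewrite /G /fmap /=; apply: filterE => x m /=.
  by have [x0 xD _ _] := svalP x; rewrite /A /= in_itv /= x0 xD.
have coord N e : 0 < e ->
    nbhs g [set f | forall m, (m < N)%N -> `|g m - f m| < e].
  move=> e0; elim: N => [|N IH]; first by apply: filterE.
  have : nbhs g [set f | `|g N - f N| < e].
    exact: (@proj_continuous nat T N g (ball (g N : R) e) (nbhsx_ballx (g N : R) e e0)).
  move: IH; apply: filterS2 => f h1 h2 m; rewrite ltnS leq_eqVlt => /predU1P[->//|].
  exact: h1.
have clus N e (B : set M) : 0 < e -> F B ->
    exists2 x, B x & forall m, (m < N)%N -> `|g m - sval x m| < e.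
  move=> e0 FB; have : G ((fun x : M => sval x : forall m, T m) @` B).
    by rewrite /G /fmap /=; apply: filterS FB => x Bx; exists x.
  by move=> /cg /(_ (coord N e e0)) [_ [[x Bx <-] h]]; exists x.
have tg : tree_fun D g.
  have cl m l e : 0 < e -> exists x : M, `|g m - sval x m| < e /\ `|g l - sval x l| < e.
    move=> e0; have [x _ h] := clus (maxn m l).+1 e setT e0 filterT.
    by exists x; split; apply: h; rewrite ltnS ?leq_maxl ?leq_maxr.
  split=> [m|m|m l|m l]; apply/ler_addgt0Pl => e e0.
  - have [x [h _]] := cl m m e e0; have [x0 _ _ _] := svalP x.
    by move: h (x0 m); rewrite ltr_norml => /andP[]; lra.
  - have [x [h _]] := cl m m e e0; have [_ xD _ _] := svalP x.
    by move: h (xD m); rewrite ltr_norml => /andP[]; lra.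
  - have e2 : 0 < e / 2 by rewrite divr_gt0.
    have [x [h h']] := cl m l _ e2; have [_ _ xl _] := svalP x.
    move: h h' (xl m l); rewrite !ltr_norml !ge_min => /andP[? ?] /andP[? ?].
    by case/orP => h; apply/orP; [left|right]; lra.
  - have e2 : 0 < e / 2 by rewrite divr_gt0.
    have [x [h h']] := cl m l _ e2; have [_ _ _ xl] := svalP x.
    move: h h' (xl m l); rewrite !ltr_norml !ge_min => /andP[? ?] /andP[? ?].
    by case/orP => h; apply/orP; [left|right]; lra.
pose x0 : M := exist _ _ tg; exists x0; split=> // B U FB.
rewrite -metricType_numDomainType.filter_from_mdist_nbhs => -[e e0 he].
have e9 : 0 < e / 9 by rewrite divr_gt0.
have [N hN] := model_finite_coordinates e9.
have [x Bx h] := clus N _ B e9 FB; exists x; split=> //; apply: he => /=.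
by have := hN x0 x h; lra.
Qed.

End ModelTreeTheory.

(** * Uniqueness of the tree *)

Section TreeUniqueness.
Variables (R : realType) (D : nat -> nat -> R) (hD : tree_matrix D).
Variables (T : metricType R) (rho : T) (Q : nat -> T).
Hypothesis rT : is_rtree T.
Hypothesis cT : compact [set: T].
Hypothesis gQ : forall n m, gromov rho (Q n) (Q m) = D n m.
Hypothesis dQ : dense (\bigcup_n segment rho (Q n)).
Local Notation M := (model_tree hD).
Local Notation ht := (height rho).
Local Notation gr := (gromov rho).

Let heightQ n : ht (Q n) = D n n. Proof. by rewrite -gQ gromovxx. Qed.

Lemma gromov_tree_fun x : tree_fun D (fun n => gr x (Q n)).
Proof.
split=> [m|m|m l|m l].
- exact: gromov_ge0.
- by rewrite gromov_sym -heightQ; exact: gromov_le.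
- by rewrite -gQ; exact: gromov_ultra.
- by rewrite -gQ (gromov_sym _ x); exact: gromov_ultra.
Qed.

Definition to_model (x : T) : M := exist _ _ (gromov_tree_fun x).

Lemma leaf_near x e : 0 < e -> exists n, ht x - e < gr x (Q n).
Proof.
move=> e0; have e2 : 0 < e / 2 by rewrite divr_gt0.
have [||y [xy [n _ yn]]] := dQ (O := (ball x (e / 2))°).
- by exists x; apply: nbhs_singleton; apply: nbhs_interior; exact: nbhsx_ballx.
- exact: open_interior.
have {xy} : ball x (e / 2) y by exact: interior_subset xy.
rewrite ballEmdist /= => xy; exists n.
have := gromov_lip rho x y (Q n); have := height_lip rho x y.
rewrite (gromov_segment yn) !ler_norml => /andP[? ?] /andP[? ?]; lra.
Qed.

Lemma meet_ht_to_model x y : meet_ht (to_model x) (to_model y) = gr x y.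
Proof.
apply/eqP; rewrite eq_le; apply/andP; split.
  by apply: meet_height_le => m /=; rewrite (gromov_sym _ y); exact: gromov_ultra.
apply/ler_addgt0Pl => e e0; have [n hn] := leaf_near x e0.
have := meet_height_ub hD n (gromov_tree_fun x) (gromov_tree_fun y).
rewrite -/(meet_ht (to_model x) (to_model y)) ge_min.
have := gromov_le rho rT x y; have := gromov_ultra rho rT y x (Q n).
by rewrite ge_min (gromov_sym _ y) => /orP[] ? ? /orP[] ?; lra.
Qed.

Lemma to_model_dist x y : mdist (to_model x) (to_model y) = mdist x y.
Proof. by rewrite mdistE !meet_ht_to_model !gromovxx /gromov; lra. Qed.

Lemma to_model_root : to_model rho = model_root hD.
Proof.
apply: model_inj; apply/funext => m /=.
apply/eqP; rewrite eq_le gromov_ge0 // andbT.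
by apply: le_trans (gromov_le _ rT _ _) _; rewrite /height mdistxx.
Qed.

Lemma to_model_leaf n : to_model (Q n) = leaf hD n.
Proof. by apply: model_inj; apply/funext => m /=; rewrite gQ. Qed.

(** The image is compact, hence closed, and it contains the truncated leaves, which are dense in the
    model. *)
Lemma to_model_surj y : exists x, to_model x = y.
Proof.
suff : (to_model @` [set: T]) y by move=> [x _ <-]; exists x.
have cI : closed (to_model @` [set: T]).
  apply: compact_closed; first exact: metric_hausdorff.
  apply: continuous_compact cT; apply: continuous_subspaceT => x.
  apply/metricType_numDomainType.cvgrPdist_lt => e e0.
  near=> z; rewrite to_model_dist; near: z.
  exact: (metricType_numDomainType.cvgr_dist_lt (@cvg_id _ (nbhs x)) e0).
apply: cI => B; rewrite -metricType_numDomainType.filter_from_mdist_nbhs.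
move=> [e e0 he]; have [n _ hn] := model_approx y e0.
exists (model_trunc (leaf hD n) (sval y n)); split; last exact: he.
have [y0 yD _ _] := svalP y.
have [[phi hp] _] := rT.1 rho (Q n).
have rI : sval y n \in `[0, ht (Q n)] by rewrite in_itv /= y0 heightQ yD.
exists (phi (sval y n)) => //.
have sw := segment_path hp rI; have [hw _] := isometric_path_dist hp rI.
apply: mdist_positivity; rewrite mdistE meet_ht_to_model gromovxx.
rewrite meet_ht_trunc // [meet_ht (to_model _) _]meet_htC meet_ht_truncl //.
rewrite -to_model_leaf.
rewrite !meet_ht_to_model gromovxx heightQ minxx gromov_sym gromov_segment //.
by rewrite {1 2}/height hw minxx min_r //; lra.
Unshelve. all: by end_near. Qed.

Lemma to_model_isometry : rooted_isometry rho (model_root hD) Q (leaf hD) to_model.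
Proof.
split; [|exact: to_model_dist|exact: to_model_root|exact: to_model_leaf].
have [g hg] := choice to_model_surj.
exists g => [x|//]; apply: mdist_positivity.
by rewrite -to_model_dist hg mdistxx.
Qed.

End TreeUniqueness.

Lemma rooted_isometry_comp_inv (R : realType) (T T' U : metricType R)
    (rho : T) (rho' : T') (o : U) (Q : nat -> T) (Q' : nat -> T') (L : nat -> U)
    (f : T -> U) (f' : T' -> U) :
  rooted_isometry rho o Q L f -> rooted_isometry rho' o Q' L f' ->
  exists h : T -> T', rooted_isometry rho rho' Q Q' h.
Proof.
move=> [bf df f0 fQ] [[g fK gK] df' f0' fQ']; exists (g \o f).
split=> [|x y|/=|n /=].
- by apply: bij_comp => //; exists f'.
- by rewrite -df' /= !gK df.
- by rewrite f0 -f0' fK.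
- by rewrite fQ -fQ' fK.
Qed.

Lemma exists_unique_tree_of_matrix (R : realType) (K : nat) (alpha : R)
    (y : R -> mpart R K setT) (D : nat -> nat -> R) (hD : tree_matrix D) :
  (forall n, singleton_time alpha y n = (D n n)%:E) ->
  (forall n m, n <> m -> separation_time alpha y n m = (D n m)%:E) ->
  exists_unique_tree alpha y.
Proof.
move=> e1 e2; split.
  exists (model_tree hD), (model_root hD), (leaf hD); split.
  - exact: model_is_rtree.
  - exact: model_compact.
  - by move=> n; rewrite height_leaf e1.
  - by move=> n m nm; rewrite height_branch_leaf e2.
  - exact: model_dense.
have iso (T : metricType R) (rho : T) (Q : nat -> T) : encodes rho alpha y Q ->
    exists f : T -> model_tree hD, rooted_isometry rho (model_root hD) Q (leaf hD) f.
  move=> [rT cT h1 h2 dQ].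
  have gQ n m : gromov rho (Q n) (Q m) = D n m.
    have [<-|nm] := pselect (n = m).
      by rewrite gromovxx; apply: EFin_inj; rewrite h1 e1.
    by rewrite -height_branch_point //; apply: EFin_inj; rewrite h2 // e2.
  by exists (to_model hD rT gQ); exact: to_model_isometry.
move=> T T' rho rho' Q Q' /iso [f hf] /iso [f' hf'].
exact: rooted_isometry_comp_inv hf hf'.
Qed.

(** * Trees encoded by fragmentation paths *)

Section FrequencyTheory.
Variable R : realType.
Implicit Types B C : set nat.

Lemma freq_seq_ge0 B n : 0 <= freq_seq R B n.
Proof. by rewrite divr_ge0 // sumr_ge0 // => k _; rewrite indicE ler0n. Qed.

Lemma freq_seq_le B C n : B `<=` C -> freq_seq R B n <= freq_seq R C n.
Proof.
move=> BC; rewrite ler_wpM2r ?invr_ge0 // ler_sum // => k _.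
rewrite !indicE ler_nat; case: (boolP (nat_of_ord k \in B)) => // kB.
by rewrite mem_set //; apply: BC; rewrite inE in kB.
Qed.

Lemma freq_seq_le1 B n : freq_seq R B n <= 1.
Proof.
case: n => [|n]; first by rewrite /freq_seq big_ord0 mul0r.
rewrite ler_pdivrMr // mul1r -[n.+1 in leRHS]card_ord -sumr_const ler_sum // => k _.
Qed.

Lemma freq_ge0 B : cvgn (freq_seq R B) -> 0 <= freq R B.
Proof. by move=> c; apply: limr_ge => //; apply: nearW => n; exact: freq_seq_ge0. Qed.

Lemma freq_le1 B : cvgn (freq_seq R B) -> freq R B <= 1.
Proof. by move=> c; apply: limr_le => //; apply: nearW => n; exact: freq_seq_le1. Qed.

Lemma freq_le B C : cvgn (freq_seq R B) -> cvgn (freq_seq R C) -> B `<=` C ->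
  freq R B <= freq R C.
Proof.
by move=> cB cC BC; apply: ler_lim => //; apply: nearW => n; exact: freq_seq_le.
Qed.

Lemma freq_set1 m : freq R [set m] = 0.
Proof.
apply: cvg_lim; first exact: Rhausdorff.
rewrite -cvg_shiftS.
apply: (@squeeze_cvgr _ _ _ _ (cst 0) (harmonic : nat -> R)); last 2 first.
- exact: cvg_cst.
- exact: cvg_harmonic.
apply: nearW => n /=; rewrite freq_seq_ge0 /= /harmonic /freq_seq ler_piMl //.
have [mn|mn] := ltnP m n.+1.
  rewrite (bigD1 (Ordinal mn)) //= big1 ?addr0 => [|k km].
    by rewrite indicE lern1 leq_b1.
  rewrite indicE memNset // => /= e; move/eqP: km; apply; exact: val_inj.
rewrite big1 // => k _; rewrite indicE memNset // => /= e.
by have := ltn_ord k; rewrite e ltnNge mn.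
Qed.

Section blocks.
Variables (K : nat) (p : mpart R K setT).
Hypothesis cvg_p : forall m, cvgn (freq_seq R (blk p m)).

Lemma sum_indic_blk_le1 (s : seq nat) k :
  pairwise (fun i j => ~~ `[< blk p i j >]) s ->
  \sum_(i <- s) \1_(blk p i) k <= 1 :> R.
Proof.
elim: s => [_|a s IH /= /andP[/allP as_ /IH h]]; first by rewrite big_nil.
rewrite big_cons indicE; case: (boolP (k \in blk p a)) => [ka|_]; last by rewrite add0r.
rewrite big_seq big1 ?addr0 // => j js; rewrite indicE memNset // => jk.
move: ka; rewrite inE => ak; have /negP := as_ _ js; apply; apply/asboolP.
by rewrite -(blk_eq ak) (blk_eq jk); exact: blkxx.
Qed.

(** Disjoint blocks of frequency at least [eta] number at most [1 / eta]; [N] exceeds a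
    representative of each. *)
Lemma finite_large_blocks eta : 0 < eta ->
  exists N, forall n, eta <= freq R (blk p n) -> exists2 m, (m < N)%N & blk p n m.
Proof.
move=> eta0; apply: contrapT => /forallNP noN.
have big k : exists s : seq nat, [/\ size s = k,
    pairwise (fun i j => ~~ `[< blk p i j >]) s
    & forall i, i \in s -> eta <= freq R (blk p i)].
  elim: k => [|k [s [sk ps es]]]; first by exists [::].
  have /existsNP[n /not_implyP[en hn]] := noN (\max_(i <- s) i).+1.
  exists (n :: s); split=> /=; first by rewrite sk.
    rewrite ps andbT; apply/allP => i si; apply/negP => /asboolP ni; apply: hn.
    by exists i => //; rewrite ltnS; exact: leq_bigmax_seq.
  by move=> i; rewrite inE => /predU1P[->|/es].
(* Half of [eta] leaves room to replace the limits by [freq_seq] at one large integer, where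
   disjointness bounds the sum by 1. *)
have [k hk] : exists k : nat, 1 < k%:R * (eta / 2).
  exists (Num.truncn (eta / 2)^-1).+1.
  by rewrite -ltr_pdivrMr ?divr_gt0 // mul1r truncnS_gt.
have [s [sk ps es]] := big k.
have : \forall n \near \oo,
    (size s)%:R * (eta / 2) <= \sum_(i <- s) freq_seq R (blk p i) n.
  move: es {ps sk}; elim: s => [_|a s IH es].
    by apply: nearW => n; rewrite big_nil mul0r.
  have e2 : eta / 2 < freq R (blk p a).
    by apply: lt_le_trans (es a (mem_head _ _)); lra.
  have h1 : \forall n \near \oo, eta / 2 < freq_seq R (blk p a) n.
    by apply: (cvgr_gt (freq R (blk p a))) => //; exact: cvg_p.
  have h2 := IH (fun i si => es i (mem_behead (s := a :: s) si)).
  near=> n; rewrite big_cons /= -natr1 mulrDl mul1r addrC lerD //.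
    by apply: ltW; near: n.
  by near: n.
move=> [n0 _ /(_ n0.+1 (leqnSn _))] /=.
suff : \sum_(i <- s) freq_seq R (blk p i) n0.+1 <= 1 by rewrite sk; lra.
rewrite /freq_seq -mulr_suml exchange_big /= ler_pdivrMr // mul1r.
rewrite -[n0.+1 in leRHS]card_ord -sumr_const ler_sum // => i _.
exact: sum_indic_blk_le1.
Unshelve. all: by end_near. Qed.

End blocks.

End FrequencyTheory.

(** * Primitives of nonincreasing functions with values in [0, 1], and their inverses *)

Section MonotoneIntegral.
Variable R : realType.
Variable f : R -> R.
Hypothesis f0 : forall r, 0 <= r -> 0 <= f r.
Hypothesis f1 : forall r, 0 <= r -> f r <= 1.
Hypothesis fdecr : forall r s, 0 <= r -> r <= s -> f s <= f r.

Local Notation mu := (@lebesgue_measure R).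

Definition primitive (u : R) : R := fine (\int[mu]_(r in `[0%R, u]) (f r)%:E)%E.

Let mf (A : set R) : measurable A -> A `<=` `[0, +oo[ ->
  measurable_fun A (fun r => (f r)%:E).
Proof.
move=> mA sA; apply/measurable_EFinP.
(* Extended by its upper bound 1 to negative times, [f] is nonincreasing on the whole line, hence
   measurable. *)
pose g (r : R) : R := if r < 0 then 1 else f r.
apply: (eq_measurable_fun g).
  move=> r /set_mem /sA /=; rewrite in_itv /= andbT => r0.
  by rewrite /g ltNge r0.
apply: nonincreasing_measurable => // r s rs; rewrite /g.
case: (ltP s 0) => s0; first by rewrite (le_lt_trans rs s0).
by case: (ltP r 0) => r0; [exact: f1|exact: fdecr].
Qed.

Let intE u v : 0 <= u -> u <= v ->
  (\int[mu]_(r in `[0%R, v]) (f r)%:E = \int[mu]_(r in `[0%R, u]) (f r)%:E +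
   \int[mu]_(r in `]u, v]) (f r)%:E)%E.
Proof.
move=> u0 uv; have E : `[0, v]%classic = `[0, u]%classic `|` `]u, v]%classic :> set R.
  by apply: itv_bndbnd_setU; rewrite bnd_simp.
rewrite E ge0_integral_setU //.
- rewrite -E; apply: mf => // r /=; by rewrite !in_itv /= => /andP[->].
- by move=> r; rewrite -E /= in_itv /= => /andP[/f0]; rewrite lee_fin.
- apply/disj_setPS => r /= [] ; rewrite !in_itv /= => /andP[_ ru] /andP[ur _].
  by move: (le_lt_trans ru ur); rewrite ltxx.
Qed.

Let inc_bound u v : 0 <= u -> u <= v ->
  (0 <= \int[mu]_(r in `]u, v]) (f r)%:E <= ((v - u) * f u)%:E)%E.
Proof.
move=> u0 uv; apply/andP; split.
  apply: integral_ge0 => r /=; rewrite in_itv /= => /andP[ur _].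
  by rewrite lee_fin f0 // (le_trans u0 (ltW ur)).
apply: (@le_trans _ _ (\int[mu]_(r in `]u, v]) (cst (f u)%:E r))%E).
  apply: ge0_le_integral => //=.
  - move=> r /=; rewrite in_itv /= => /andP[ur _].
    by rewrite lee_fin f0 // (le_trans u0 (ltW ur)).
  - apply: mf => // r /=; rewrite !in_itv /= andbT => /andP[ur _].
    exact: le_trans u0 (ltW ur).
  - move=> r /=; rewrite in_itv /= => /andP[ur _].
    by rewrite lee_fin fdecr // ltW.
rewrite integral_cst //= lebesgue_measure_itv /= lte_fin.
move: uv; rewrite le_eqVlt => /predU1P[->|uv].
  by rewrite ltxx mule0 subrr mul0r.
by rewrite uv -EFinD -EFinM mulrC.
Qed.

Lemma integral_primitive u : 0 <= u ->
  (\int[mu]_(r in `[0%R, u]) (f r)%:E = (primitive u)%:E)%E.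
Proof.
move=> u0; rewrite /primitive fineK // (intE (lexx 0) u0).
rewrite set_itv1 integral_set1 add0e.
have /andP[h0 h1] := inc_bound (lexx 0) u0.
by rewrite ge0_fin_numE // (le_lt_trans h1) // ltry.
Qed.

Lemma primitive0 : primitive 0 = 0.
Proof. by rewrite /primitive set_itv1 integral_set1. Qed.

Lemma primitive_incr u v : 0 <= u -> u <= v ->
  0 <= primitive v - primitive u <= (v - u) * f u.
Proof.
move=> u0 uv; have v0 := le_trans u0 uv.
have := inc_bound u0 uv; have := intE u0 uv.
rewrite !integral_primitive // => E.
have fin : (\int[mu]_(r in `]u, v]) (f r)%:E)%E \is a fin_num.
  have : (primitive v)%:E \is a fin_num by [].
  by rewrite E fin_numD => /andP[].
move: E; rewrite -(fineK fin) -EFinD => -[->]; rewrite !lee_fin.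
by rewrite (addrC (primitive u)) addrK.
Qed.

Lemma primitive_le u v : 0 <= u -> u <= v -> primitive u <= primitive v.
Proof. by move=> u0 uv; have /andP[] := primitive_incr u0 uv; rewrite subr_ge0. Qed.

Lemma primitive_lip u v : 0 <= u -> u <= v -> primitive v <= primitive u + (v - u).
Proof.
move=> u0 uv; have /andP[_] := primitive_incr u0 uv.
have : (v - u) * f u <= v - u by rewrite ler_piMr ?subr_ge0 // f1.
lra.
Qed.

(** The primitive is 1-Lipschitz, so it cannot jump over [t] at the infimum. *)
Lemma primitive_inverse t u : 0 <= t -> 0 <= u -> t < primitive u ->
  exists tau, [/\ ereal_inf [set v%:E | v in [set v | 0 <= v /\ t < primitive v]]
    = tau%:E, 0 <= tau <= u & primitive tau = t].
Proof.
move=> t0 u0 tu; set S := [set v | _].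
have Su : S u by split.
have lS : lbound S 0 by move=> v [].
have hS : has_inf S by split; [exists u|exists 0].
exists (inf S).
have i0 : 0 <= inf S by apply: lb_le_inf => //; exists u.
split.
- by rewrite ereal_inf_EFin //; [exists 0|exists u].
- by rewrite i0 /=; apply: ge_inf => //; exists 0.
apply/eqP; rewrite eq_le; apply/andP; split; rewrite leNgt; apply/negP => h.
- have p0 : 0 < inf S.
    rewrite lt_neqAle i0 andbT; apply/eqP => e.
    by move: h; rewrite -e primitive0 ltNge t0.
  (* By the Lipschitz bound, going back by half the excess over [t] stays in [S]; the cap keeps the
     time nonnegative. *)
  pose e := Num.min (inf S) ((primitive (inf S) - t) / 2).
  have e0 : 0 < e by rewrite lt_min p0 divr_gt0 // subr_gt0.
  have eS : e <= inf S by rewrite ge_min lexx.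
  have e2 : e <= (primitive (inf S) - t) / 2 by rewrite ge_min lexx orbT.
  suff : inf S <= inf S - e by lra.
  apply: ge_inf; first by exists 0.
  split; first by rewrite subr_ge0.
  have := @primitive_lip (inf S - e) (inf S); rewrite subr_ge0 => /(_ eS); lra.
- suff : inf S + (t - primitive (inf S)) <= inf S by lra.
  apply: lb_le_inf; first by exists u.
  move=> v Sv; have Iv : inf S <= v by apply: ge_inf => //; exists 0.
  have := primitive_lip i0 Iv; have [_] := Sv; lra.
Qed.

End MonotoneIntegral.

Lemma eq_primitive (R : realType) (f g : R -> R) u :
  (forall r, 0 <= r -> r <= u -> f r = g r) -> primitive f u = primitive g u.
Proof.
move=> fg; rewrite /primitive; apply: f_equal; apply: eq_integral => r.
by rewrite inE /= in_itv /= => /andP[r0 ru]; rewrite fg.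
Qed.

(** * The tree matrix of a path with decaying masses *)

Section PathTree.
Variables (R : realType) (K : nat) (alpha : R) (y : R -> mpart R K setT).
Hypothesis alpha0 : alpha < 0.
Hypothesis y0 : forall m, blk (y 0) m = setT.
Hypothesis ydecr : forall s t m, 0 <= s -> s <= t -> blk (y t) m `<=` blk (y s) m.
Hypothesis yfreq : forall t m, 0 <= t -> cvgn (freq_seq R (blk (y t) m)).

Let f n r := freq R (blk (y r) n) `^ (- alpha).

Let a0 : 0 < - alpha. Proof. by rewrite oppr_gt0. Qed.

Let f0 n r : 0 <= r -> 0 <= f n r. Proof. by move=> _; exact: powR_ge0. Qed.

Let f1 n r : 0 <= r -> f n r <= 1.
Proof.
move=> r0; have -> : (1 : R) = 1 `^ (- alpha) by rewrite powR1.
apply: ge0_ler_powR.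
- exact: ltW.
- by rewrite nnegrE freq_ge0 //; exact: yfreq.
- by rewrite nnegrE.
- by apply: freq_le1; exact: yfreq.
Qed.

Let fdecr n r s : 0 <= r -> r <= s -> f n s <= f n r.
Proof.
move=> r0 rs; have s0 := le_trans r0 rs; apply: ge0_ler_powR.
- exact: ltW.
- by rewrite nnegrE freq_ge0 //; exact: yfreq.
- by rewrite nnegrE freq_ge0 //; exact: yfreq.
- by apply: freq_le; [exact: yfreq|exact: yfreq|exact: ydecr].
Qed.

Let F n := primitive (f n).

(* The time in the self-similar scale at which the blocks of [n] and [m] split;
   for [n = m], the time at which [n] becomes a singleton. *)
Definition split_time n m : R :=
  sup [set F n u | u in [set u | 0 <= u /\ blk (y u) n m]].

Let Feq n m u : 0 <= u -> blk (y u) n m -> F n u = F m u.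
Proof.
move=> u0 nm; apply: eq_primitive => r r0 ru.
have nmr : blk (y r) n m by exact: ydecr nm.
by rewrite /f (blk_eq nmr).
Qed.

Hypothesis decay : exists t0 rho C, [/\ 0 < t0, 0 < rho < 1, 0 <= C &
  forall k m, freq R (blk (y (k%:R * t0)) m) <= C * rho ^+ k].

Let Fdecay : exists t0 r B, [/\ 0 < t0, 0 < r < 1, 0 <= B &
  forall n j v, j%:R * t0 <= v -> F n v <= F n (j%:R * t0) + B * r ^+ j].
Proof.
have [t0 [rho [C [t00 /andP[rho0 rho1] C0 hC]]]] := decay.
pose r := rho `^ (- alpha); pose A := C `^ (- alpha).
have r0 : 0 < r by exact: powR_gt0.
have r1 : r < 1.
  have -> : (1 : R) = 1 `^ (- alpha) by rewrite powR1.
  by apply: gt0_ltr_powR; rewrite ?nnegrE // ltW.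
have A0 : 0 <= A by exact: powR_ge0.
have kt k : 0 <= k%:R * t0 by rewrite mulr_ge0 // ltW.
have fk n k : f n (k%:R * t0) <= A * r ^+ k.
  have -> : A * r ^+ k = (C * rho ^+ k) `^ (- alpha).
    rewrite powRM ?exprn_ge0 ?(ltW rho0) // -(powR_mulrn k (ltW rho0)).
    by rewrite -powRrM (mulrC k%:R) powRrM powR_mulrn ?powR_ge0.
  apply: ge0_ler_powR; rewrite ?nnegrE ?(ltW a0) //.
  - by apply: freq_ge0; exact: yfreq.
  - by rewrite mulr_ge0 ?exprn_ge0 ?(ltW rho0).
(* The sum of the geometric series of the [t0 * A * r ^+ k], which bound the increments of [F n]
   between consecutive times [k%:R * t0]. *)
pose B := t0 * A / (1 - r).
have r1' : 1 - r != 0 by rewrite gt_eqF // subr_gt0.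
exists t0, r, B; split=> //.
- by rewrite r0 r1.
- by rewrite divr_ge0 ?mulr_ge0 // ?subr_ge0 ltW.
have step n j k :
    F n ((j + k)%:R * t0) <= F n (j%:R * t0) + B * (r ^+ j - r ^+ (j + k)).
  elim: k => [|k IH]; first by rewrite addn0 subrr mulr0 addr0.
  have le_k : (j + k)%:R * t0 <= (j + k.+1)%:R * t0.
    by rewrite ler_pM2r // ler_nat addnS.
  have := primitive_incr (@f0 n) (@f1 n) (@fdecr n) (kt _) le_k.
  rewrite -mulrBl -natrB ?addnS // subSnn mul1r -!/(F n _) => /andP[_ h].
  have := fk n (j + k)%N; rewrite -(ler_pM2l t00) => h'.
  have : t0 * (A * r ^+ (j + k)) = B * (r ^+ (j + k) - r ^+ (j + k).+1).
    by rewrite exprS /B; field.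
  move: h; rewrite !mulrBr; move: IH; rewrite !mulrBr; lra.
move=> n j v jv; pose k := (Num.truncn (v / t0)).+1.
have v0 : 0 <= v by exact: le_trans (kt j) jv.
have vk : v <= (j + k)%:R * t0.
  rewrite -ler_pdivrMr // ltW // (lt_le_trans (truncnS_gt _)) //.
  by rewrite ler_nat leq_addl.
have := primitive_le (@f0 n) (@f1 n) (@fdecr n) v0 vk; rewrite -!/(F n _).
have := step n j k; have : 0 <= B * r ^+ (j + k).
  by rewrite mulr_ge0 ?exprn_ge0 ?(ltW r0) // divr_ge0 ?mulr_ge0 // ?subr_ge0 ltW.
by rewrite mulrBr; lra.
Qed.

Let Fbounded : exists C, forall n u, 0 <= u -> F n u <= C.
Proof.
have [t0 [r [B [_ _ _ h]]]] := Fdecay; exists B => n u u0.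
have := h n 0%N u; rewrite mul0r expr0 mulr1 => /(_ u0).
by rewrite {2}/F (primitive0 (f n)) add0r.
Qed.

Let Ftail e : 0 < e -> exists2 u, 0 <= u &
  forall n v, u <= v -> F n v <= F n u + e.
Proof.
move=> e0; have [t0 [r [B [t00 /andP[r0 r1] B0 h]]]] := Fdecay.
have : \forall j \near \oo, r ^+ j < e / (B + 1).
  apply: (cvgr_lt (0 : R)); last by rewrite divr_gt0 // ltr_wpDl.
  by apply: cvg_expr; rewrite ger0_norm // ltW.
move=> [j _ /(_ j (leqnn j)) /= hj]; exists (j%:R * t0).
  by rewrite mulr_ge0 // ltW.
move=> n v /(h n); move/le_trans; apply; rewrite lerD2l.
apply: (@le_trans _ _ ((B + 1) * r ^+ j)).
  by rewrite ler_wpM2r ?exprn_ge0 ?lerDl // ltW.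
by rewrite -ler_pdivlMl ?ltr_wpDl // mulrC ltW.
Qed.

Let split_has_sup n m : has_sup [set F n u | u in [set u | 0 <= u /\ blk (y u) n m]].
Proof.
split; first by exists (F n 0), 0 => //; split=> //; rewrite y0.
by have [C hC] := Fbounded; exists C => _ [u [u0 _] <-]; exact: hC.
Qed.

Let split_ub n m u : 0 <= u -> blk (y u) n m -> F n u <= split_time n m.
Proof.
by move=> u0 nm; apply: sup_upper_bound; [exact: split_has_sup|exists u].
Qed.

Let split_lub n m c : (forall u, 0 <= u -> blk (y u) n m -> F n u <= c) ->
  split_time n m <= c.
Proof.
move=> h; apply: sup_le_ub; first exact: (split_has_sup n m).1.
by move=> _ [u [u0 nm] <-]; exact: h.
Qed.

Let split_adh n m e : 0 < e -> exists u,
  [/\ 0 <= u, blk (y u) n m & split_time n m - e < F n u].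
Proof.
move=> e0; have [_ [u [u0 nm] <-] h] := sup_adherent e0 (split_has_sup n m).
by exists u.
Qed.

Let split_diag n u : 0 <= u -> F n u <= split_time n n.
Proof. by move=> u0; apply: split_ub => //; exact: blkxx. Qed.

Let time_changeE n t : time_change alpha y n t =
  ereal_inf [set v%:E | v in [set v | 0 <= v /\ t < F n v]].
Proof.
rewrite /time_change; congr ereal_inf; apply/seteqP; split=> _ [u [u0 h] <-];
  exists u => //; split=> //; move: h.
  by rewrite (integral_primitive (@f0 n) (@f1 n) (@fdecr n)) // lte_fin.
by rewrite (integral_primitive (@f0 n) (@f1 n) (@fdecr n)) // lte_fin.
Qed.

Let time_change_fin n t u : 0 <= t -> 0 <= u -> t < F n u ->
  exists tau, [/\ ss_block alpha y n t = (blk (y tau) n, typ (y tau) n),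
    0 <= tau <= u & F n tau = t].
Proof.
move=> t0 u0 tu.
have [tau [h tu' Ft]] :=
  primitive_inverse (@f0 n) (@f1 n) (@fdecr n) t0 u0 tu.
by exists tau; split=> //; rewrite /ss_block time_changeE h.
Qed.

Let time_change_oo n t : (forall u, 0 <= u -> F n u <= t) ->
  ss_block alpha y n t = ([set n], ord0).
Proof.
move=> h; rewrite /ss_block time_changeE (_ : [set v | _] = set0).
  by rewrite image_set0 ereal_inf0 eqxx.
by apply/seteqP; split=> // v [v0]; rewrite ltNge h.
Qed.

(** Once the block of [n] is a singleton its frequency is 0 and [F n] stops growing, so no later
    value is left for the time change to reach. *)
Lemma singleton_timeE n : singleton_time alpha y n = (split_time n n)%:E.
Proof.
have D0 : 0 <= split_time n n.
  apply: le_trans (split_diag n (lexx 0)); rewrite /F.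
  by rewrite (primitive0 (f n)).
apply/eqP; rewrite eq_le; apply/andP; split.
  apply: ereal_inf_lbound; exists (split_time n n) => //; split=> //.
  by rewrite time_change_oo // => u u0; exact: split_diag.
apply: le_ereal_inf_tmp => _ [t [t0 ht] <-]; rewrite lee_fin.
apply: split_lub => u u0 _; rewrite leNgt; apply/negP => tu.
have [tau [E /andP[tau0 tauu] Ft]] := time_change_fin t0 u0 tu.
move: ht; rewrite E /= => bs.
have := primitive_incr (@f0 n) (@f1 n) (@fdecr n) tau0 tauu.
have -> : f n tau = 0 by rewrite /f bs freq_set1 powR0 // gt_eqF.
rewrite mulr0 -!/(F n _) => /andP[_].
by rewrite Ft; lra.
Qed.

Lemma split_timeC n m : split_time n m = split_time m n.
Proof.
by apply/eqP; rewrite eq_le; apply/andP; split; apply: split_lub => u u0 nm;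
  rewrite (Feq u0 nm); apply: split_ub => //; exact: blk_sym.
Qed.

Lemma separation_timeE n m : n <> m ->
  separation_time alpha y n m = (split_time n m)%:E.
Proof.
move=> nm; rewrite split_timeC; apply/eqP; rewrite eq_le; apply/andP; split.
  apply/lee_addgt0Pr => e e0.
  have D0 : 0 <= split_time m n.
    apply: le_trans (split_ub (lexx 0) _); last by rewrite y0.
    by rewrite /F (primitive0 (f m)).
  (* At the time [split_time m n] itself the two integers need not be apart yet; at any later time
     they are. *)
  rewrite -EFinD; apply: ereal_inf_lbound; exists (split_time m n + e) => //.
  have t0 : 0 <= split_time m n + e by rewrite addr_ge0 // ltW.
  split=> //.
  have [h|/existsNP[u /not_implyP[u0 /negP]]] :=
      pselect (forall u, 0 <= u -> F m u <= split_time m n + e).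
    by rewrite time_change_oo.
  rewrite -ltNge => h.
  have [tau [-> /andP[tau0 _] Ft]] := time_change_fin t0 u0 h.
  by move=> /= /(split_ub tau0); rewrite Ft; lra.
apply: le_ereal_inf_tmp => _ [t [t0 ht] <-]; rewrite lee_fin.
apply: split_lub => u u0 mn; rewrite leNgt; apply/negP => tu.
have [tau [E /andP[tau0 tauu] Ft]] := time_change_fin t0 u0 tu.
by move: ht; rewrite E /=; apply; exact: ydecr mn.
Qed.

(* Follow [n] along the grid [j * delta]: the last grid time at which the block
   of [n] is large leaves finitely many candidates, after it little height is
   gained. *)
Let grid_net delta eta j : 0 < delta -> 0 < eta -> exists N, forall n,
  exists2 m, (m < N)%N &
    F n (j%:R * delta) <= split_time n m + delta + j%:R * (delta * eta).
Proof.
move=> d0 e0; elim: j => [|j [N IH]].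
  exists 1%N => n; exists 0%N => //; rewrite !mul0r addr0.
  apply: (@le_trans _ _ (split_time n 0)); last by rewrite lerDl ltW.
  by apply: split_ub => //; rewrite y0.
set u := j%:R * delta; have u0 : 0 <= u by rewrite mulr_ge0 // ltW.
have eS : j.+1%:R * delta = u + delta by rewrite -natr1 mulrDl mul1r.
have d' : u <= j.+1%:R * delta by rewrite eS lerDl ltW.
(* The mass below which [F n] grows at speed at most [eta]. *)
have eta' : 0 < eta `^ (- alpha)^-1 by exact: powR_gt0.
have [N' hN'] := finite_large_blocks (fun m => @yfreq _ m u0) eta'.
exists (maxn N N') => n.
have := primitive_incr (@f0 n) (@f1 n) (@fdecr n) u0 d'.
rewrite -!/(F n _) => /andP[_]; rewrite {2}eS addrAC subrr add0r => h.
have [large|small] := leP (eta `^ (- alpha)^-1) (freq R (blk (y u) n)).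
  have [m mN nm] := hN' _ large; exists m; first by rewrite leq_max mN orbT.
  have := split_ub u0 nm; have := f1 n u0.
  have : delta * f n u <= delta by rewrite ler_piMr ?f1 // ltW.
  have : 0 <= j.+1%:R * (delta * eta) by rewrite !mulr_ge0 // ltW.
  lra.
have [m mN nm] := IH n; exists m; first by rewrite leq_max mN.
have : f n u <= eta.
  rewrite -[leRHS](_ : (eta `^ (- alpha)^-1) `^ (- alpha) = eta).
    apply: ge0_ler_powR; rewrite ?nnegrE ?powR_ge0 //; try exact: ltW.
    by apply: freq_ge0; exact: yfreq.
  by rewrite -powRrM mulVf ?powRr1 ?gt_eqF // ltW.
rewrite -(ler_pM2l d0) => h'.
have -> : j.+1%:R * (delta * eta) = j%:R * (delta * eta) + delta * eta.
  by rewrite -natr1 mulrDl mul1r.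
move: nm h; rewrite -/u; lra.
Qed.

Lemma path_tree_matrix : tree_matrix split_time.
Proof.
split.
- move=> n m; apply: le_trans (split_ub (lexx 0) _); last by rewrite y0.
  by rewrite /F (primitive0 (f n)).
- exact: split_timeC.
- by move=> n m; apply: split_lub => u u0 _; exact: split_diag.
- move=> n m l; apply/ler_addgt0Pl => e e0.
  have [u [u0 nm hu]] := split_adh n m e0.
  have [v [v0 ml hv]] := split_adh m l e0.
  rewrite ge_min; apply/orP; have [uv|/ltW vu] := leP u v.
    left; have nl : blk (y u) n l by rewrite -(blk_eq nm); exact: ydecr ml.
    by rewrite -lerBlDl; exact: le_trans (ltW hu) (split_ub u0 nl).
  right; have nm' : blk (y v) n m by exact: ydecr nm.
  have nl : blk (y v) n l by rewrite -(blk_eq nm').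
  rewrite -lerBlDl; apply: le_trans (ltW hv) _.
  by rewrite -(Feq v0 nm'); exact: split_ub.
- move=> e e0; have e4 : 0 < e / 4 by rewrite divr_gt0.
  have [u u0 hu] := Ftail e4.
  pose j := (Num.truncn (u / (e / 4))).+1.
  have uj : u <= j%:R * (e / 4).
    by rewrite -ler_pdivrMr // ltW // truncnS_gt.
  (* With this speed the [j] small steps of length [e / 4] cost at most [e / 4] in all; the step
     after the last large block and the tail cost [e / 4] each. *)
  have eta0 : 0 < (j%:R : R)^-1 by rewrite invr_gt0.
  have [N hN] := grid_net j e4 eta0.
  exists N => n; have [m mN h] := hN n; exists m => //.
  suff : split_time n n <= F n (j%:R * (e / 4)) + e / 4.
    have e4E : j%:R * (e / 4 * j%:R^-1) = e / 4.
      by rewrite mulrCA mulfV ?mulr1 ?pnatr_eq0.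
    by move: h; rewrite e4E; lra.
  apply: split_lub => v v0 _.
  have hj : F n u <= F n (j%:R * (e / 4)).
    exact: (primitive_le (@f0 n) (@f1 n) (@fdecr n)).
  have [uv|/ltW vu] := leP u v; first by have := hu n v uv; lra.
  have := primitive_le (@f0 n) (@f1 n) (@fdecr n) v0 vu; rewrite -!/(F n _); lra.
Qed.

Lemma path_exists_unique_tree : exists_unique_tree alpha y.
Proof.
apply: (exists_unique_tree_of_matrix path_tree_matrix).
  exact: singleton_timeE.
exact: separation_timeE.
Qed.

End PathTree.

(** * Second moments of the masses *)

Section PairAveraging.
Context (R : realType) d (T : measurableType d) (mu : {measure set T -> \bar R}).
Hypothesis mu1 : mu setT = 1%E.
Variables (U : nat -> nat -> set T) (c v : R).
Hypothesis mU : forall a b, measurable (U a b).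
Hypothesis Uc : forall a b, a <> b -> (mu (U a b) <= c%:E)%E.
Hypothesis c0 : 0 <= c.
Hypothesis v0 : 0 < v.

Definition pair_count (n : nat) (w : T) : R :=
  \sum_(p : 'I_n.+1 * 'I_n.+1) \1_(U p.1 p.2) w.

Let A n := [set w | v * n.+1%:R ^+ 2 <= pair_count n w].

(** Eventually at least a fraction [v] of the pairs of integers satisfies [U]. With [U a b] the
    event that [a] and [b] are together, a block of squared frequency above [v] forces this, while
    its measure is controlled by pairs alone. *)
Definition many_pairs : set T := \bigcup_N \bigcap_(n in [set n | (N <= n)%N]) A n.

Let mcount n : measurable_fun setT (pair_count n).
Proof. by apply: measurable_sum => p; exact: measurable_indic. Qed.

Let mA n : measurable (A n).
Proof.
by rewrite -[A n]setTI; apply: measurable_fun_le => //; exact: mcount.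
Qed.

Lemma measurable_many_pairs : measurable many_pairs.
Proof.
apply: bigcupT_measurable => N; apply: bigcap_measurable => [|k _]; last exact: mA.
by exists N => /=.
Qed.

(** The term [n.+1%:R] pays for the diagonal pairs, each of which counts for at most 1. *)
Let integral_count n : (\int[mu]_w (pair_count n w)%:E <=
  (n.+1%:R ^+ 2 * c + n.+1%:R)%:E)%E.
Proof.
have -> : (\int[mu]_w (pair_count n w)%:E =
    \sum_(p : 'I_n.+1 * 'I_n.+1) mu (U p.1 p.2))%E.
  under eq_integral do rewrite /pair_count -sumEFin.
  rewrite ge0_integral_sum //.
  - by apply: eq_bigr => p _; rewrite integral_indic // setIT.
  - by move=> p; apply/measurable_EFinP; exact: measurable_indic.
have -> : n.+1%:R ^+ 2 * c + n.+1%:R =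
    \sum_(p : 'I_n.+1 * 'I_n.+1) (c + (p.1 == p.2)%:R) :> R.
  rewrite big_split /= sumr_const card_prod card_ord -(mulr_natl c) natrM expr2.
  congr (_ + _); rewrite -(pair_bigA _ (fun a b => (a == b)%:R)) /=.
  rewrite -[LHS]mulr1 mulr_natl -[n.+1 in LHS]card_ord -sumr_const.
  apply: eq_bigr => a _; rewrite (bigD1 a) //= eqxx big1 ?addr0 // => b.
  by rewrite eq_sym => /negPf ->.
rewrite -sumEFin lee_sum // => -[a b] _ /=; have [ab|/eqP ab] := eqVneq a b.
  apply: (@le_trans _ _ 1%E); last by rewrite lee_fin lerDr.
  by rewrite -mu1 le_measure ?inE.
by rewrite addr0; apply: Uc => e; apply: ab; exact: val_inj.
Qed.

Let measure_A n : (mu (A n) <= ((c + n.+1%:R^-1) / v)%:E)%E.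
Proof.
have n0 : 0 < v * n.+1%:R ^+ 2 :> R by rewrite mulr_gt0 // exprn_gt0.
have : ((v * n.+1%:R ^+ 2)%:E * mu (A n) <= (n.+1%:R ^+ 2 * c + n.+1%:R)%:E)%E.
  apply: le_trans (integral_count n); rewrite -integral_cst //.
  apply: (@le_trans _ _ (\int[mu]_(w in A n) (pair_count n w)%:E)%E).
    apply: ge0_le_integral => //.
    - by move=> w _; rewrite /cst lee_fin ltW.
    - apply/measurable_EFinP; exact: measurable_funTS.
  apply: ge0_subset_integral => //; first exact/measurable_EFinP.
  by move=> w _; rewrite lee_fin sumr_ge0 // => p _; rewrite indicE ler0n.
rewrite -lee_pdivlMl // => /le_trans; apply; rewrite -EFinM lee_fin.
rewrite le_eqVlt; apply/orP; left; apply/eqP; field.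
by rewrite nat1r pnatr_eq0 gt_eqF.
Qed.

Lemma measure_many_pairs : (mu many_pairs <= (c / v)%:E)%E.
Proof.
pose B N := \bigcap_(n in [set n | (N <= n)%N]) A n.
have mB N : measurable (B N).
  by apply: bigcap_measurable => [|k _]; [exists N => /=|exact: mA].
have ndB : nondecreasing_seq B.
  move=> N M NM; apply/subsetPset => w Bw n /= Mn; apply: Bw => /=.
  exact: leq_trans NM Mn.
have := nondecreasing_cvg_mu (mu := mu) mB measurable_many_pairs ndB.
move=> /cvg_lim <- //; apply: lime_le.
  apply: ereal_nondecreasing_is_cvgn => N M NM; apply: le_measure; rewrite ?inE //.
  exact/subsetPset/ndB.
apply: nearW => N /=; apply/lee_addgt0Pr => e e0.
(* Large enough for the diagonal contribution [n.+1%:R^-1 / v] to be at most [e]. *)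
pose n := maxn N (Num.truncn (e * v)^-1).
apply: (@le_trans _ _ (mu (A n))).
  apply: le_measure; rewrite ?inE // => w; apply => /=; exact: leq_maxl.
apply: le_trans (measure_A n) _; rewrite -EFinD lee_fin mulrDl lerD2l.
rewrite ler_pdivrMr // -[leRHS]invrK lef_pV2 ?posrE ?invr_gt0 ?mulr_gt0 //.
apply: (@le_trans _ _ (Num.truncn (e * v)^-1).+1%:R).
  by rewrite ltW // truncnS_gt.
by rewrite ler_nat ltnS leq_maxr.
Qed.

Lemma freq_many_pairs (w : T) (B : set nat) :
  (forall a b, B a -> B b -> U a b w) ->
  cvgn (freq_seq R B) -> v < freq R B ^+ 2 -> many_pairs w.
Proof.
move=> BU cB vB.
have : \forall n \near \oo, v < freq_seq R B n ^+ 2.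
  apply: (cvgr_gt (freq R B ^+ 2)) => //.
  by rewrite expr2; under eq_fun do rewrite expr2; apply: cvgM; exact: cB.
move=> [N _ hN]; exists N => // n /= Nn; rewrite /A /=.
have := hN n.+1 (leqW Nn); rewrite /= /freq_seq expr_div_n.
rewrite ltr_pdivlMr ?exprn_gt0 // => /ltW /le_trans; apply.
rewrite expr2 mulr_suml /pair_count.
rewrite -(pair_bigA _ (fun a b : 'I_n.+1 => \1_(U a b) w)) /= ler_sum // => a _.
rewrite mulr_sumr ler_sum // => b _; rewrite !indicE.
case: (boolP (nat_of_ord a \in B)) => aB; last by rewrite mul0r.
case: (boolP (nat_of_ord b \in B)) => bB; last by rewrite mulr0.
rewrite mulr1 mem_set //; apply: BU; first by rewrite inE in aB.
by rewrite inE in bB.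
Qed.

End PairAveraging.

(** * Measurable sets of partitions *)

Section PartitionTopology.
Variables (R : realType) (K : nat) (A : set nat).
Local Notation PA := (mpart R K A).
Implicit Types p q : PA.

Definition together (k l : nat) : set PA := [set p | blk p k l].

Definition typed_together (k l : nat) (a : 'I_K.+1) : set PA :=
  [set p | blk p k l /\ typ p k = a].

Lemma agree_blk n p q k l : agree n p q -> (k < n)%N -> (l < n)%N ->
  blk p k l -> blk q k l.
Proof.
move=> e kn ln pkl; have : blk (restr `I_n p) k l by split.
by rewrite e => -[].
Qed.

(** Restriction gives singletons type 0, so the type of a block is visible only if the restricted
    block keeps a second element [l]. *)
Lemma agree_typ n p q k l : agree n p q -> (k < n)%N -> (l < n)%N -> k <> l ->
  blk p k l -> typ p k = typ q k.
Proof.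
move=> e kn ln kl pkl; have : typ (restr `I_n p) k = typ (restr `I_n q) k by rewrite e.
have qkl := agree_blk e kn ln pkl; rewrite /= /trim !asboolF //.
- by move=> /(_ l) h; apply/kl/esym/h.
- by move=> /(_ l) h; apply/kl/esym/h.
Qed.

Lemma agree_sym n p q : agree n p q -> agree n q p.
Proof. exact: esym. Qed.

Lemma near_agree p n : \forall q \near p, agree n p q.
Proof.
have e0 : 0 < n.+1%:R^-1 :> R by rewrite invr_gt0.
have : nbhs p (ball p (n.+1%:R^-1)) by exact: nbhsx_ballx.
apply: filterS => q; rewrite ballEmdist => h.
by apply: agreeW (leqnSn n) _; exact: pdist_lt.
Qed.

Lemma open_of_agree (S : set PA) :
  (forall p, S p -> exists n, forall q, agree n p q -> S q) -> open S.
Proof.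
move=> h; rewrite openE => p /h [n hn]; rewrite /interior.
by apply: filterS (near_agree p n) => q; exact: hn.
Qed.

Lemma open_together k l : open (together k l).
Proof.
apply: open_of_agree => p pkl; exists (maxn k l).+1 => q e.
by apply: agree_blk e _ _ pkl; rewrite ltnS ?leq_maxl ?leq_maxr.
Qed.

Lemma open_typed_together k l a : k <> l -> open (typed_together k l a).
Proof.
move=> kl; apply: open_of_agree => p [pkl pa]; exists (maxn k l).+1 => q e.
have kM : (k < (maxn k l).+1)%N by rewrite ltnS leq_maxl.
have lM : (l < (maxn k l).+1)%N by rewrite ltnS leq_maxr.
by split; [exact: agree_blk e kM lM pkl|rewrite -(agree_typ e kM lM kl pkl)].
Qed.

Lemma measurable_open (S : set PA) : open S -> measurable S.
Proof. exact: sub_sigma_algebra. Qed.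

Lemma measurable_together k l : measurable (together k l).
Proof. by apply: measurable_open; exact: open_together. Qed.

Lemma measurable_typed_together k l a : k <> l -> measurable (typed_together k l a).
Proof. by move=> ?; apply: measurable_open; exact: open_typed_together. Qed.

End PartitionTopology.

Arguments together {R K A}.
Arguments typed_together {R K A}.

#[global] Hint Extern 0 (measurable (together _ _)) =>
  exact: measurable_together : core.

Section CadlagPaths.
Variables (R : realType) (K : nat) (y : R -> mpart R K setT).
Hypothesis cy : cadlag y.

Lemma cadlag_right t n : 0 <= t -> exists2 d, 0 < d &
  forall s, t < s < t + d -> agree n (y t) (y s).
Proof.
move=> t0; have := cy.1 t t0 _ (near_agree (y t) n).
move=> [d /= d0 h]; exists d => // s /andP[ts sd]; apply: h => //=.
by rewrite ltr_distlC; apply/andP; split; lra.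
Qed.

Lemma cadlag_left t n p : y s @[s --> t^'-] --> p -> exists2 d, 0 < d &
  forall s, t - d < s < t -> agree n p (y s).
Proof.
move=> /(_ _ (near_agree p n)) [d /= d0 h]; exists d => // s /andP[ts sd].
by apply: h => //=; rewrite ltr_distlC; apply/andP; split; lra.
Qed.

End CadlagPaths.

Section PartitionFacts.
Variables (R : realType) (K : nat).
Local Notation PN := (mpart R K setT).
Implicit Types p q : PN.

Lemma typ_gtype p k l : k <> l -> blk p k l -> exists j : 'I_K, typ p k = gtype j.
Proof.
move=> kl pkl; case: (unliftP ord0 (typ p k)) => [j ->|h]; first by exists j.
by have := (typ0 p k).1 h _ pkl => /esym.
Qed.

Lemma typ_one_block (j : 'I_K) k : typ (one_block R j) k = gtype j.
Proof.
rewrite /= /trim asboolF // => /(_ k.+1 I) /= e.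
exact: (n_Sn k (esym e)).
Qed.

Lemma gtype_inj : injective (@gtype K).
Proof. exact: lift_inj. Qed.

Lemma one_block_ext p (j : 'I_K) :
  (forall k l, blk p k l) -> typ p 0 = gtype j -> p = one_block R j.
Proof.
move=> h e; apply: mpart_ext => m; first by apply/seteqP; split.
by rewrite typ_one_block -e; exact: typ_eq.
Qed.

Lemma lead_one_block (j : 'I_K) m : lead (one_block R j) m <-> m = 0%N.
Proof.
split=> [[_ /(_ 0%N I)]|->]; first by rewrite leqn0 => /eqP.
by split.
Qed.

Lemma lead0 p : lead p 0. Proof. by split. Qed.

Definition swap (a b n : nat) : nat := if n == a then b else if n == b then a else n.

Lemma swapK a b : involutive (swap a b).
Proof.
move=> n; rewrite /swap; case: (eqVneq n a) => [->|na].
  by case: (eqVneq b a) => [//|]; rewrite eqxx.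
case: (eqVneq n b) => [->|nb]; first by rewrite eqxx.
by rewrite (negPf na) (negPf nb).
Qed.

Lemma exists_bijection01 (k l : nat) : k <> l ->
  exists s : nat -> nat, [/\ bijective s, s 0%N = k & s 1%N = l].
Proof.
move=> /eqP kl; exists (swap (swap 0 k 1) l \o swap 0 k); split.
- by apply: bij_comp; apply: inv_bij; exact: swapK.
- have e : swap 0 k 0 = k by rewrite /swap eqxx.
  have c : swap 0 k 1 != k.
    by rewrite /swap /=; case: (eqVneq 1%N k) => [<-//|].
  by rewrite /= e {1}/swap eq_sym (negPf c) (negPf kl).
- by rewrite /= {1}/swap eqxx.
Qed.

End PartitionFacts.

(** * Decay of the masses in homogeneous fragmentations *)

Lemma ae_forall_countable (R : realType) d (O : measurableType d)
    (mu : {measure set O -> \bar R}) (I : countType) (Q : I -> O -> Prop) :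
  (forall x, {ae mu, forall w, Q x w}) -> {ae mu, forall w, forall x, Q x w}.
Proof.
move=> h.
have hn n : {ae mu, forall w, if unpickle n is Some x then Q x w else True}.
  by case: unpickle => [x|]; [exact: h|exact: nearW].
by apply: filterS (ae_foralln hn) => w hw x; have := hw (pickle x); rewrite pickleK.
Qed.

Lemma ae_of_measure0 (R : realType) d (O : measurableType d)
    (mu : {measure set O -> \bar R}) (N : set O) (Q : O -> Prop) :
  measurable N -> mu N = 0%E -> (forall w, ~ N w -> Q w) -> {ae mu, forall w, Q w}.
Proof.
by move=> mN N0 h; exists N; split=> // w /= nQ; apply: contrapT => /h.
Qed.

Lemma same_law1 (R : realType) d (T : measurableType d) (O O' : Type)
    (P : set O -> \bar R) (P' : set O' -> \bar R) (Y : R -> O -> T) (Y' : R -> O' -> T)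
    t B : same_law P P' Y Y' -> 0 <= t -> measurable B ->
  P (Y t @^-1` B) = P' (Y' t @^-1` B).
Proof.
move=> h t0 mB; have := h 1%N (fun=> t) (fun=> B) (fun=> t0) (fun=> mB).
have c (O1 : Type) (Z : R -> O1 -> T) :
    cylinder Z 1 (fun=> t) (fun=> B) = Z t @^-1` B.
  by apply/seteqP; split=> [w /(_ 0%N erefl)|w h' k _].
by rewrite !c.
Qed.

Section HomogeneousFragmentation.
Variables (R : realType) (K : nat).
Local Notation PN := (mpart R K setT).
Context d (Omega : measurableType d).
Variables (X : R -> Omega -> PN) (P : R.-pker PN ~> Omega).
Hypothesis hX : homogeneous_fragmentation X P.

Let hM : markov_process X P. Proof. by case: hX. Qed.

Let kernel1 p : P p setT = 1%E. Proof. exact: prob_kernel. Qed.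

Lemma measurable_event t (B : set PN) : 0 <= t -> measurable B ->
  measurable (X t @^-1` B).
Proof.
by move=> t0 mB; have [/(_ t t0) h _ _] := hM; rewrite -[_ @^-1` _]setTI; exact: h.
Qed.

Lemma cylinder1 t (B : set PN) : cylinder X 1 (fun=> t) (fun=> B) = X t @^-1` B.
Proof. by apply/seteqP; split=> [w /(_ 0%N erefl)|w h' k _]. Qed.

Lemma markov1 p s t (C B : set PN) : 0 <= s -> 0 <= t -> measurable C ->
  measurable B ->
  (P p ((X s @^-1` C) `&` (X (s + t) @^-1` B)) =
   \int[P p]_(w in X s @^-1` C) P (X s w) (X t @^-1` B))%E.
Proof.
move=> s0 t0 mC mB; have [_ _ /(_ p s (X s @^-1` C) 1%N (fun=> t) (fun=> B))] := hM.
rewrite (cylinder1 t B) (cylinder1 (s + t) B); apply => //.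
apply: sub_sigma_algebra; exists s; split; first by rewrite /= in_itv /= s0 lexx.
by exists C.
Qed.

Lemma measurable_kernel_event t (B : set PN) : 0 <= t -> measurable B ->
  measurable_fun setT (fun p => P p (X t @^-1` B)).
Proof. by move=> t0 mB; apply: measurable_kernel; exact: measurable_event. Qed.

Lemma measurable_kernel_path s t (C B : set PN) : 0 <= s -> 0 <= t ->
  measurable C -> measurable B ->
  measurable_fun (X s @^-1` C) (fun w => P (X s w) (X t @^-1` B)).
Proof.
move=> s0 t0 mC mB; apply: measurable_funTS.
apply: (measurableT_comp (measurable_kernel_event t0 mB)).
by have [/(_ s s0)] := hM.
Qed.

Lemma apart_stays p t k l : 0 <= t -> ~ blk p k l ->
  P p (X t @^-1` together k l) = 0%E.
Proof.
move=> t0 pkl; have [h _ _] := frag_branching hX p.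
apply: measure_negligible; first exact: measurable_event.
by apply: negligibleS h => w /= wkl; apply/existsNP; exists t => /(_ t0 k l wkl).
Qed.

Lemma apart_stays2 p s t k l : 0 <= s -> 0 <= t ->
  P p ((X s @^-1` ~` together k l) `&` (X (s + t) @^-1` together k l)) = 0%E.
Proof.
move=> s0 t0; rewrite markov1 //; last by apply: measurableC.
by rewrite (eq_integral (cst 0%E)) ?integral0 // => w /set_mem /= h; exact: apart_stays.
Qed.

(** The Markov property shows that two integers apart at one rational time are almost surely apart
    at any later one. Right-continuity extends this to all real times, a restriction to finitely
    many integers being constant just after each time. *)
Lemma blocks_decrease p : {ae P p, forall w, forall s t m, 0 <= s -> s <= t ->
  blk (X t w) m `<=` blk (X s w) m}.
Proof.
pose Q (x : rat * rat * nat * nat) w := let: (a, b, k, l) := x in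
  0 <= a -> 0 <= b -> blk (X (ratr a + ratr b) w) k l -> blk (X (ratr a) w) k l.
have hQ : {ae P p, forall w, forall x, Q x w}.
  apply: ae_forall_countable => -[[[a b] k] l]; rewrite /Q.
  have [a0|a0] := leP 0 a; last by apply: nearW => w.
  have [b0|b0] := leP 0 b; last by apply: nearW => w.
  have ra : 0 <= ratr a :> R by rewrite ler0q.
  have rb : 0 <= ratr b :> R by rewrite ler0q.
  apply: ae_of_measure0 (apart_stays2 p k l ra rb) _.
    by apply: measurableI; apply: measurable_event => //;
      [exact: measurableC|exact: addr_ge0].
  by move=> w /= h _ _ wkl; apply: contrapT => nkl; apply: h.
apply: filterS2 (frag_cadlag hX p) hQ => w cw hw s t m s0 st k tmk.
have t0 := le_trans s0 st.
have [->//|nst] := eqVneq s t; have {nst}st : s < t by rewrite lt_neqAle nst.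
apply: contrapT => nsk.
pose n := (maxn m k).+1.
have mn : (m < n)%N by rewrite ltnS leq_maxl.
have kn : (k < n)%N by rewrite ltnS leq_maxr.
have [e e0 he] := cadlag_right cw n s0.
have [e' e'0 he'] := cadlag_right cw n t0.
have [a /andP[sa ah]] : exists a, s < ratr a < Num.min t (s + e).
  by apply: rat_in_itvoo; rewrite lt_min st ltrDl.
have [b /andP[tb bh]] : exists b, t < ratr b < t + e'.
  by apply: rat_in_itvoo; rewrite ltrDl.
move: ah; rewrite lt_min => /andP[at_ ae].
have := hw (a, b - a, m, k); rewrite /Q /=.
have a0 : 0 <= a by rewrite -(ler0q R) (le_trans s0 (ltW sa)).
have ba : 0 <= b - a by rewrite subr_ge0 -(ler_rat R) ltW // (lt_trans at_ tb).
rewrite rmorphB /= [ratr a + _]addrC subrK => /(_ a0 ba) H; apply: nsk.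
have agb : agree n (X t w) (X (ratr b) w) by apply: he'; rewrite tb bh.
have aga : agree n (X s w) (X (ratr a) w) by apply: he; rewrite sa ae.
apply: (agree_blk (agree_sym aga) mn kn); apply: H.
exact: (agree_blk agb mn kn tmk).
Qed.

Lemma starts_at p : {ae P p, forall w, X 0 w = p}.
Proof. by have [_ h _] := hM. Qed.

Variable j0 : 'I_K.

Definition same_block_prob (j : 'I_K) (t : R) : R :=
  fine (P (one_block R j) (X t @^-1` together 0 1)).

Local Notation q := same_block_prob.

Lemma kernel_fin p E : measurable E -> P p E \is a fin_num.
Proof.
move=> mE; rewrite ge0_fin_numE //; apply: (@le_lt_trans _ _ 1%E); last exact: ltry.
by rewrite -(kernel1 p) le_measure ?inE.
Qed.

Lemma same_block_probE j t : 0 <= t ->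
  P (one_block R j) (X t @^-1` together 0 1) = (q j t)%:E.
Proof. by move=> t0; rewrite fineK // kernel_fin //; exact: measurable_event. Qed.

Lemma same_block_prob_ge0 j t : 0 <= q j t.
Proof. exact: fine_ge0. Qed.

Lemma same_block_prob_le1 j t : 0 <= t -> q j t <= 1.
Proof.
move=> t0; rewrite -lee_fin -same_block_probE // -(kernel1 (one_block R j)).
by rewrite le_measure ?inE //; exact: measurable_event.
Qed.

Lemma same_block_prob_pair j t k l : 0 <= t -> k <> l ->
  P (one_block R j) (X t @^-1` together k l) = (q j t)%:E.
Proof.
move=> t0 kl; have [s [bs s0 s1]] := exists_bijection01 kl.
rewrite -same_block_probE //.
rewrite -(same_law1 (frag_exch hX j bs) t0 (measurable_together 0 1)).
by congr (P _ _); apply/seteqP; split=> w; rewrite /= /together /= s0 s1.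
Qed.

Lemma same_block_prob_block p t j k l : 0 <= t -> k <> l -> lead p k ->
  blk p k l -> typ p k = gtype j ->
  P p (X t @^-1` together k l) = (q j t)%:E.
Proof.
move=> t0 kl lk pkl pj; rewrite -(same_block_prob_pair _ t0 kl).
have [_ _ /(_ k j lk pj) h] := frag_branching hX p.
have := same_law1 h t0 (measurable_together k l).
have E : (fun w => restr (blk p k) (X t w)) @^-1` together k l = X t @^-1` together k l.
  apply/seteqP; split=> w; rewrite /= /together /=; first by case.
  by split=> //; exact: blkT pkl.
by rewrite E.
Qed.

Lemma same_block_prob_typed p s t i : 0 <= s -> 0 <= t ->
  P p ((X s @^-1` typed_together 0 1 (gtype i)) `&` (X (s + t) @^-1` together 0 1)) =
  ((q i t)%:E * P p (X s @^-1` typed_together 0 1 (gtype i)))%E.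
Proof.
move=> s0 t0; have mC := measurable_typed_together (A := setT) (gtype i) (n_Sn 0).
rewrite markov1 // -integral_cst; last exact: measurable_event.
apply: eq_integral => w /set_mem /= [w01 wi].
exact: same_block_prob_block (lead0 _) w01 wi.
Qed.

(** By the Markov property at [s]: integers already apart stay apart, and those together in a block
    of type [i] remain so with probability [q i t]. *)
Lemma same_block_prob_add j s t theta : 0 <= s -> 0 <= t ->
  (forall i, q i t <= theta) -> q j (s + t) <= q j s * theta.
Proof.
move=> s0 t0 hth; have st0 := addr_ge0 s0 t0.
have th0 : 0 <= theta by apply: le_trans (hth j0); exact: same_block_prob_ge0.
have mS := measurable_event s0 (measurable_together (A := setT) 0 1).
have mT := measurable_event st0 (measurable_together (A := setT) 0 1).
rewrite -lee_fin -same_block_probE //.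
set p := one_block R j.
have -> : P p (X (s + t) @^-1` together 0 1) =
    (P p ((X s @^-1` together 0 1) `&` (X (s + t) @^-1` together 0 1)) +
     P p ((X s @^-1` ~` together 0 1) `&` (X (s + t) @^-1` together 0 1)))%E.
  rewrite -measureU //; first by rewrite -preimage_setC -setIUl setUv setTI.
  - exact: measurableI.
  - by apply: measurableI => //; rewrite -preimage_setC; exact: measurableC.
  - by rewrite -preimage_setC setIACA setICr set0I.
rewrite apart_stays2 // adde0 markov1 //.
apply: (@le_trans _ _ (\int[P p]_(w in X s @^-1` together 0 1) theta%:E)%E).
  apply: ge0_le_integral => //.
  - exact: measurable_kernel_path.
  - move=> w /= h; have [i ei] := typ_gtype (n_Sn 0) h.
    by rewrite (same_block_prob_block t0 (n_Sn 0) (lead0 _) h ei) lee_fin.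
by rewrite integral_cst // same_block_probE // -EFinM mulrC.
Qed.

Lemma same_block_prob_exp j t theta k : 0 <= t -> (forall i, q i t <= theta) ->
  q j (k%:R * t) <= theta ^+ k.
Proof.
move=> t0 hth; elim: k => [|k IH].
  by rewrite mul0r expr0; exact: same_block_prob_le1.
have th0 : 0 <= theta by apply: le_trans (hth j0); exact: same_block_prob_ge0.
rewrite -natr1 mulrDl mul1r exprSr.
apply: le_trans (same_block_prob_add j _ t0 hth) _; first by rewrite mulr_ge0.
exact: ler_wpM2r.
Qed.

Lemma same_block_prob_decr j s t : 0 <= s -> s <= t -> q j t <= q j s.
Proof.
move=> s0 st; have d0 : 0 <= t - s by rewrite subr_ge0.
have := same_block_prob_add j s0 d0 (fun i => same_block_prob_le1 i d0).
by rewrite addrC subrK mulr1.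
Qed.

End HomogeneousFragmentation.

(** * Borel-Cantelli for the masses at the times [k * t0] *)

Section Decay.
Variables (R : realType) (K : nat).
Local Notation PN := (mpart R K setT).
Context d (Omega : measurableType d).
Variables (X : R -> Omega -> PN) (P : R.-pker PN ~> Omega).
Hypothesis hX : homogeneous_fragmentation X P.
Variables (t0 theta : R) (j : 'I_K).
Hypothesis t00 : 0 < t0.
Hypothesis th0 : 0 < theta.
Hypothesis th1 : theta < 1.
Hypothesis hth : forall i, same_block_prob X P i t0 <= theta.

(** A given pair is together at time [k%:R * t0] with probability at most [theta ^+ k]; the
    threshold [rho ^+ k] for the fraction of pairs leaves the summable bound
    [theta ^+ k / rho ^+ k = rho ^+ k]. *)
Let rho := Num.sqrt theta.
Let rho0 : 0 < rho. Proof. by rewrite sqrtr_gt0. Qed.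
Let rho1 : rho < 1. Proof. by rewrite -sqrtr1 ltr_sqrt. Qed.
Let rho2 : rho * rho = theta. Proof. by rewrite -expr2 sqr_sqrtr // ltW. Qed.

Let kt k : 0 <= k%:R * t0. Proof. by rewrite mulr_ge0 // ltW. Qed.

Let U k a b : set Omega := X (k%:R * t0) @^-1` together a b.
Let G k := many_pairs (U k) (rho ^+ k).

Let mU k a b : measurable (U k a b).
Proof. exact: (measurable_event hX (kt k)). Qed.

Let mG k : measurable (G k).
Proof. exact: measurable_many_pairs. Qed.

Let G_le k : (P (one_block R j) (G k) <= (rho ^+ k)%:E)%E.
Proof.
have rk : 0 < rho ^+ k by rewrite exprn_gt0.
have -> : rho ^+ k = theta ^+ k / rho ^+ k.
  by rewrite -rho2 exprMn mulfK // gt_eqF.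
apply: measure_many_pairs => //.
- exact: prob_kernel.
- move=> a b ab; rewrite (same_block_prob_pair hX j (kt k) ab) lee_fin.
  exact: same_block_prob_exp (ltW t00) hth.
- by rewrite exprn_ge0 // ltW.
Qed.

Let summable_G : (\sum_(k <oo) P (one_block R j) (G k) < +oo)%E.
Proof.
have geom n : \sum_(0 <= k < n) rho ^+ k <= (1 - rho)^-1.
  rewrite -[leRHS]mul1r ler_pdivlMr ?subr_gt0 // big_mkord mulrC.
  by rewrite -opprB mulNr -subrX1 opprB gerBl exprn_ge0 // ltW.
apply: (@le_lt_trans _ _ ((1 - rho)^-1)%:E); last exact: ltry.
apply: lime_le; first exact: is_cvg_nneseries.
apply: nearW => n; apply: le_trans (_ : _ <= (\sum_(0 <= k < n) rho ^+ k)%:E)%E _.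
  by rewrite -sumEFin; apply: lee_sum => k _; exact: G_le.
by rewrite lee_fin.
Qed.

Lemma frequencies_decay : {ae P (one_block R j), forall w,
  exists rho C, [/\ 0 < rho < 1, 0 <= C &
    forall k m, freq R (blk (X (k%:R * t0) w) m) <= C * rho ^+ k]}.
Proof.
have L0 := lim_sup_set_cvg0 mG summable_G.
have mL : measurable (lim_sup_set G).
  by apply: bigcapT_measurable => n; apply: bigcup_measurable => k _.
have hL : {ae P (one_block R j), forall w, ~ lim_sup_set G w}.
  by apply: ae_of_measure0 mL L0 _.
apply: filterS2 (frag_freq hX j) hL => w hw nL.
have [k0 hk0] : exists k0, forall k, (k0 <= k)%N -> ~ G k w.
  apply: contrapT => /forallNP h; apply: nL => n _.
  have /existsNP[k /not_implyP[nk /contrapT Gk]] := h n.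
  by exists k.
have fr k m : cvgn (freq_seq R (blk (X (k%:R * t0) w) m)).
  by have [] := hw m _ (kt k).
(* The fraction of pairs bounds the square of a mass, hence a second square root. The factor
   [sigma ^- k0] covers the finitely many earlier times, where masses are at most 1. *)
pose sigma := Num.sqrt rho.
have s0 : 0 < sigma by rewrite sqrtr_gt0.
have s1 : sigma < 1 by rewrite -sqrtr1 ltr_sqrt.
exists sigma, (sigma ^- k0); split; first by rewrite s0 s1.
  by rewrite invr_ge0 exprn_ge0 // ltW.
move=> k m; have f0 := freq_ge0 (fr k m).
have [kk|kk] := leqP k0 k.
  apply: (@le_trans _ _ (sigma ^+ k)); last first.
    rewrite ler_peMl ?exprn_ge0 ?(ltW s0) // invf_ge1 ?exprn_gt0 //.
    by rewrite exprn_ile1 // ltW.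
  rewrite leNgt; apply/negP => h; apply: (hk0 k kk).
  apply: (freq_many_pairs _ (fr k m)).
    by move=> a b wa wb; rewrite /U /together /= (blk_eq wa).
  have -> : rho ^+ k = (sigma ^+ k) ^+ 2.
    by rewrite -exprM mulnC exprM sqr_sqrtr // ltW.
  by rewrite ltr_sqr ?nnegrE ?exprn_ge0 // ltW.
apply: le_trans (freq_le1 (fr k m)) _.
rewrite mulrC ler_pdivlMr ?exprn_gt0 // mul1r.
by rewrite ler_wiXn2l ?(ltW s0) ?(ltW s1) // ltnW.
Qed.

End Decay.

(** * Irreducibility excludes unbroken types *)

Lemma total1_setC (R : realType) d (O : measurableType d)
    (mu : {measure set O -> \bar R}) (A : set O) : mu setT = 1%E -> measurable A ->
  mu (~` A) = (1 - mu A)%E.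
Proof.
move=> mu1 mA; rewrite -setTD measureD //.
  by rewrite setTI; congr (_ - _)%E; exact: mu1.
by apply: (@le_lt_trans _ _ 1%E); [rewrite -mu1|exact: ltry].
Qed.

(** * Partitions with a single block whose type is in a given set *)

Section OneBlockPartitions.
Variables (R : realType) (K : nat) (J : 'I_K -> Prop).
Local Notation PN := (mpart R K setT).
Implicit Types p : PN.

Definition one_blocks : set PN := [set p | exists2 j, J j & p = one_block R j].

Lemma one_blocksP p : one_blocks p <->
  (forall k l, blk p k l) /\ exists2 j, J j & typ p 0 = gtype j.
Proof.
split=> [[j Jj ->]|[h [j Jj e]]].
  by split=> //; exists j => //; exact: typ_one_block.
by exists j => //; exact: one_block_ext.
Qed.

Lemma measurable_one_blocks : measurable one_blocks.
Proof.
have -> : one_blocks = (\bigcap_k \bigcap_l together k l) `&`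
    \bigcup_(j in [set j | J j]) typed_together 0 1 (gtype j).
  apply/seteqP; split=> p.
    move=> /one_blocksP[h [j Jj e]]; split; first by move=> k _ l _; exact: h.
    by exists j => //; split => //; exact: h.
  move=> [h [j Jj [_ e]]]; apply/one_blocksP; split; last by exists j.
  by move=> k l; exact: h.
apply: measurableI.
  apply: bigcapT_measurable => k; apply: bigcapT_measurable => l.
  exact: measurable_together.
apply: fin_bigcup_measurable => // j _; exact: measurable_typed_together.
Qed.

(** Closedness is what lets a right-continuous path inherit the property from rational times. *)
Lemma one_blocks_closed p : (forall n, exists2 q, one_blocks q & agree n p q) ->
  one_blocks p.
Proof.
move=> h; apply/one_blocksP.
have hb k l : blk p k l.
  have [q /one_blocksP[hq _] e] := h (maxn k l).+1.
  by apply: (agree_blk (agree_sym e)) (hq k l); rewrite ltnS ?leq_maxl ?leq_maxr.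
split=> //; have [q /one_blocksP[hq [j Jj ej]] e] := h 2.
by exists j => //; rewrite -ej; apply: (agree_typ e _ _ (n_Sn 0)).
Qed.

Lemma cadlag_one_blocks (y : R -> PN) : cadlag y ->
  (forall r : rat, 0 <= r -> one_blocks (y (ratr r))) ->
  forall t, 0 <= t -> one_blocks (y t).
Proof.
move=> cy h t t0; apply: one_blocks_closed => n.
have [e e0 he] := cadlag_right cy n t0.
have [r rt] : exists r, t < ratr r < t + e by apply: rat_in_itvoo; rewrite ltrDl.
exists (y (ratr r)); last exact: he.
by apply: h; rewrite -(ler0q R) ltW //; case/andP: rt => /(le_lt_trans t0).
Qed.

Lemma ae_one_blocks d (O : measurableType d) (mu : {measure set O -> \bar R})
    (Y : R -> O -> PN) : mu setT = 1%E ->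
  (forall t, 0 <= t -> measurable_fun setT (Y t)) ->
  {ae mu, forall w, cadlag (Y^~ w)} ->
  (forall t, 0 <= t -> mu (Y t @^-1` one_blocks) = 1%E) ->
  {ae mu, forall w, forall t, 0 <= t -> one_blocks (Y t w)}.
Proof.
move=> mu1 mY cY h.
have hr : {ae mu, forall w, forall r : rat, 0 <= r -> one_blocks (Y (ratr r) w)}.
  apply: ae_forall_countable => r; have [r0|r0] := leP 0 r; last exact: nearW.
  have r0' : 0 <= ratr r :> R by rewrite ler0q.
  have mE : measurable (Y (ratr r) @^-1` one_blocks).
    by rewrite -[_ @^-1` _]setTI; apply: mY => //; exact: measurable_one_blocks.
  apply: (@ae_of_measure0 _ _ _ _ (~` (Y (ratr r) @^-1` one_blocks))).
  - exact: measurableC.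
  - by rewrite total1_setC // h // subee.
  - by move=> w /contrapT.
by apply: filterS2 cY hr => w; exact: cadlag_one_blocks.
Qed.

End OneBlockPartitions.

(** * Exchangeable partitions with prescribed frequencies and types *)

Section Paintbox.
Variables (R : realType) (K : nat) (s : massp R K).
Local Notation PN := (mpart R K setT).
Variable mu : {measure set PN -> \bar R}.
Hypothesis mu1 : mu setT = 1%E.
Hypothesis hmu : paintbox s mu.

Lemma paintbox_typed k l a : k <> l ->
  mu (typed_together k l a) = mu (typed_together 0 1 a).
Proof.
move=> kl; have [u [bu u0 u1]] := exists_bijection01 kl.
rewrite -(hmu.1 u bu _ (measurable_typed_together a (n_Sn 0))).
congr (mu _); apply/seteqP; split=> p; rewrite /typed_together /= u0 u1 /trim u0.
  move=> [pkl <-]; split=> //; rewrite asboolF // => /(_ 1%N).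
  by rewrite /= u1 => /(_ pkl).
by move=> [pkl]; rewrite asboolF // => /(_ 1%N); rewrite /= u1 => /(_ pkl).
Qed.

(** [paintbox] gives no sampling description, so pairs are averaged: the largest block contains
    asymptotically a fraction [mass s 0 ^+ 2] of them. If the probability [c] were smaller, then for
    [v] halfway between the two [many_pairs] would have measure 1 and yet at most [c / v < 1]. *)
Lemma paintbox_typed_ge a : mtyp s 0 = gtype a ->
  ((mass s 0 ^+ 2)%:E <= mu (typed_together 0 1 (gtype a)))%E.
Proof.
move=> sa; have s0 : 0 < mass s 0.
  rewrite lt_neqAle mass_ge0 andbT; apply/eqP => /esym /(mtyp0 s 0).2.
  by rewrite sa.
have m01 := measurable_typed_together (R := R) (A := setT) (gtype a) (n_Sn 0).
have le1 : (mu (typed_together 0 1 (gtype a)) <= 1)%E.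
  by rewrite -mu1 le_measure ?inE.
have fin : mu (typed_together 0 1 (gtype a)) \is a fin_num.
  by rewrite ge0_fin_numE // (le_lt_trans le1) // ltry.
set c := fine (mu (typed_together 0 1 (gtype a))).
rewrite -(fineK fin) -/c lee_fin.
have c0 : 0 <= c by exact: fine_ge0.
pose U k l : set PN := if k == l then setT else typed_together k l (gtype a).
have mU k l : measurable (U k l).
  rewrite /U; case: eqVneq => [//|/eqP kl]; exact: measurable_typed_together.
have Uc k l : k <> l -> (mu (U k l) <= c%:E)%E.
  by move=> kl; rewrite /U; case: eqVneq => [//|_]; rewrite paintbox_typed // fineK.
rewrite leNgt; apply/negP => cs.
pose v := (c + mass s 0 ^+ 2) / 2.
have v0 : 0 < v by rewrite /v; have := exprn_gt0 2 s0; lra.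
have := measure_many_pairs mu1 mU Uc c0 v0.
rewrite leNgt => /negP; apply.
have [N mN [N0 hN]] := hmu.2.
have -> : mu (many_pairs U v) = 1%E.
  apply/eqP; rewrite eq_le -{1}mu1 le_measure ?inE //=; last first.
    exact: measurable_many_pairs.
  have -> : 1%E = mu (~` N).
    by rewrite total1_setC // N0 sube0.
  rewrite le_measure ?inE //; [exact: measurableC|exact: measurable_many_pairs|].
  move=> p /hN [cvp [g [[gf _ _] hg]]].
  have [fg tg] := hg 0%N s0.
  apply: (freq_many_pairs _ (cvp (g 0%N))); last by rewrite fg /v; lra.
  move=> k l pk pl; rewrite /U; case: eqVneq => // _; split=> /=.
    by rewrite (blk_eq pk).
  by rewrite (typ_eq pk) tg.
by rewrite lte_fin ltr_pdivrMr // mul1r /v; lra.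
Qed.

(** A block of type [b] outside [J] almost surely exists, so [one_blocks J] is null. If the set were
    null too, [0] and [1] would almost surely share a block of type [a]; by exchangeability so would
    all [k] and [k.+1], and no block could have type [b]. *)
Lemma paintbox_splits (J : 'I_K -> Prop) a b n : b <> a -> ~ J b ->
  0 < mass s n -> mtyp s n = gtype b ->
  mu (~` typed_together 0 1 (gtype a) `\` one_blocks J) <> 0%E.
Proof.
move=> ba Jb sn sb h0; have [N mN [N0 hN]] := hmu.2.
have m01 := measurable_typed_together (R := R) (A := setT) (gtype a) (n_Sn 0).
have mJ := measurable_one_blocks (R := R) J.
have J0 : mu (one_blocks J) = 0%E.
  apply/eqP; rewrite eq_le measure_ge0 andbT -N0 le_measure ?inE // => p [j Jj pj].
  apply: contrapT => /hN [_ [g [_ /(_ n sn) [_]]]].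
  by rewrite pj typ_one_block sb => /gtype_inj jb; apply: Jb; rewrite -jb.
have C0 : mu (~` typed_together 0 1 (gtype a)) = 0%E.
  apply/eqP; rewrite eq_le measure_ge0 andbT.
  apply: (@le_trans _ _ (mu ((~` typed_together 0 1 (gtype a) `\` one_blocks J)
      `|` one_blocks J))).
    apply: le_measure; rewrite ?inE.
    - exact: measurableC.
    - by apply: measurableU => //; apply: measurableD => //; exact: measurableC.
    - by move=> p; have [] := pselect (one_blocks J p); [right|left].
  apply: le_trans (measureU2 _ _ _) _ => //; last first.
    by rewrite [X in (X + _)%E]h0 [X in (_ + X)%E]J0 adde0.
  by apply: measurableD => //; exact: measurableC.
have T1 : mu (typed_together 0 1 (gtype a)) = 1%E.
  rewrite -mu1 -(setvU (typed_together 0 1 (gtype a))) measureU //.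
  - by rewrite [X in (X + _)%E]C0 add0e.
  - exact: measurableC.
  - exact: setICl.
have Ckl k l : k <> l -> mu (~` typed_together k l (gtype a)) = 0%E.
  move=> kl; have mkl := measurable_typed_together (R := R) (A := setT) (gtype a) kl.
  by rewrite total1_setC // (paintbox_typed _ kl) T1 subee.
have neg : mu.-negligible (N `|` \bigcup_k ~` typed_together k k.+1 (gtype a)).
  apply: negligibleU; first by exists N; split => //.
  apply: negligible_bigcup => k; exists (~` typed_together k k.+1 (gtype a)).
  split=> //; last exact: Ckl (n_Sn k).
  by apply: measurableC; exact: measurable_typed_together (n_Sn k).
have [p hp] : exists p, ~ (N `|` \bigcup_k ~` typed_together k k.+1 (gtype a)) p.
  apply: contrapT => /forallNP h.
  have : mu setT = 0%E.
    apply: measure_negligible => //; apply: negligibleS neg => p _.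
    exact: contrapT (h p).
  by rewrite mu1 => /eqP; rewrite onee_eq0.
have Np : ~ N p by move=> ?; apply: hp; left.
have tp k : typ p k = gtype a.
  apply: contrapT => tk; apply: hp; right; exists k => // -[_ h]; exact: tk.
have [_ [g [_ /(_ n sn) [_]]]] := hN p Np.
by rewrite tp sb => /gtype_inj ab; exact/ba/esym.
Qed.

End Paintbox.

(** * Driven paths that never leave the single-block states *)

Section DrivenPath.
Variables (R : realType) (K : nat) (J : 'I_K -> Prop) (i : 'I_K).
Local Notation PN := (mpart R K setT).
Variables (D : nat -> 'I_K -> set (R * PN)) (E : nat -> 'I_K -> set R).
Variable y : R -> PN.
Hypothesis yD : driven_by i D E y.
Hypothesis yJ : forall t, 0 <= t -> one_blocks J (y t).

(** A single-block partition outside [splits] is [one_block R i], so an atom there does not move the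
    path from its initial state. *)
Let splits : set PN := ~` typed_together 0 1 (gtype i).

Let cy : cadlag y. Proof. by case: yD. Qed.

Lemma cut_one_block (j : 'I_K) Delta : cut_block (one_block R j) 0 Delta = Delta.
Proof.
have eb m : blk (cut_block (one_block R j) 0 Delta) m = blk Delta m.
  by rewrite /= asboolT //; apply/seteqP; split=> // k [].
apply: mpart_ext => // m; have /= := eb m; rewrite /trim => ->.
by case: asboolP => [/typ0 -> //|_]; rewrite asboolT.
Qed.

Lemma isolate_not_one_block (p : PN) n : ~ one_blocks J (isolate p n).
Proof.
move=> /one_blocksP[/(_ n n.+1) + _]; rewrite /= eqxx /= => e.
exact: (n_Sn n (esym e)).
Qed.

Let stuck (t : R) : 0 < t -> (forall s, 0 <= s -> s < t -> y s = one_block R i) ->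
  y s @[s --> t^'-] --> one_block R i.
Proof.
move=> t0 h; apply: cvg_near_cst; near=> s; apply: h; near: s.
  by apply: nbhs_left_ge.
exact: nbhs_left_lt.
Unshelve. all: by end_near. Qed.

(* As long as no atom of type [i] makes it leave its initial state, the path
   does not see the other drivers. *)
Lemma driven_path_constant :
  (forall t Delta, 0 < t -> t <= 1 -> D 0 i (t, Delta) -> splits Delta ->
     ~ one_blocks J Delta) ->
  forall t, 0 <= t -> t <= 1 -> y t = one_block R i.
Proof.
move=> noat; apply: contrapT => /existsNP[t1 /not_implyP[t10 /not_implyP[t11 nt1]]].
pose S := [set t | 0 <= t /\ y t <> one_block R i].
have St1 : S t1 by [].
have lS : has_lbound S by exists 0 => t [].
pose t := inf S.
have t0 : 0 <= t by apply: lb_le_inf; [exists t1|move=> ? []].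
have tt1 : t <= t1 by exact: ge_inf.
have before s : 0 <= s -> s < t -> y s = one_block R i.
  move=> s0; apply: contraPP => ns; apply/negP; rewrite -leNgt.
  by apply: ge_inf.
(* Otherwise right-continuity would preserve the type just after [t], and the path would stay in the
   initial state beyond the infimum of [S]. *)
have yt : y t <> one_block R i.
  move=> e; have [d d0 hd] := cadlag_right cy 2 t0.
  suff : t + d <= t by lra.
  apply: lb_le_inf; first by exists t1.
  move=> s [s0 ns]; rewrite leNgt; apply/negP => sd; apply: ns.
  have [st|ts] := ltP s t; first exact: before.
  have [->//|ts'] := eqVneq s t.
  have {}ts : t < s by rewrite lt_neqAle eq_sym ts'.
  have ag : agree 2 (y t) (y s) by apply: hd; rewrite ts sd.
  have /one_blocksP[yall _] := yJ s0.
  apply: one_block_ext => //; rewrite -(typ_one_block R i 0) -e.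
  apply: esym; apply: (agree_typ ag _ _ (n_Sn 0)) => //.
  by rewrite e.
have {}t0 : 0 < t.
  by rewrite lt_neqAle t0 andbT; apply/eqP => e; apply: yt;
    rewrite -e; case: yD.
have [_ _ /(_ t _ t0 (stuck t0 before)) [jump erode still]] := yD.
(* No driver can act at [t]: an atom in [splits] would lead outside [one_blocks J], another atom
   would leave the initial state unchanged, and an erosion would create a singleton. *)
apply: (yt); apply: still.
  move=> m j Delta /lead_one_block -> ; rewrite typ_one_block => /gtype_inj <- {j} at_.
  have at0 : D 0 i (t, Delta) by [].
  have := jump 0%N i Delta (lead0 _) (typ_one_block R i 0) at0.
  rewrite cut_one_block => e.
  have J_ : one_blocks J Delta by rewrite -e; apply: yJ; exact: ltW.
  have [sp|] := pselect (splits Delta).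
    exact: (noat _ _ t0 (le_trans tt1 t11) at0 sp J_).
  move=> /contrapT [_ ti].
  have /one_blocksP[al _] := J_.
  by apply: yt; rewrite e; exact: one_block_ext.
move=> n j; rewrite typ_one_block => /gtype_inj <- Et.
have := erode n i (typ_one_block R i n) Et => e.
have := yJ (ltW t0); rewrite e; exact: isolate_not_one_block.
Qed.

(** Just before an atom the path is still in its initial state, so it jumps to [Delta] itself. *)
Lemma driven_path_no_split :
  (forall t Delta, 0 < t -> t <= 1 -> D 0 i (t, Delta) -> splits Delta ->
     ~ one_blocks J Delta) ->
  forall t Delta, 0 < t -> t <= 1 -> D 0 i (t, Delta) -> one_blocks J Delta.
Proof.
move=> noat t Delta t0 t1 at_.
have before s : 0 <= s -> s < t -> y s = one_block R i.
  by move=> s0 st; apply: driven_path_constant => //; apply: le_trans (ltW st) t1.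
have [_ _ /(_ t _ t0 (stuck t0 before)) [jump _ _]] := yD.
have := jump 0%N i Delta (lead0 _) (typ_one_block R i 0) at_.
by rewrite cut_one_block => <-; apply: yJ; exact: ltW.
Qed.

End DrivenPath.

(** * Rates of the dislocations that separate [0] from [1] or change their type *)

Section Intensities.
Variables (R : realType) (K : nat).
Local Notation PN := (mpart R K setT).
Local Notation MP := (massp R K).
Variable nu : 'I_K -> {measure set MP -> \bar R}.
Variable kappa : R.-pker MP ~> PN.
Hypothesis hk : forall s, paintbox s (kappa s).
Variable a : 'I_K.
Hypothesis nu_fin :
  (\int[nu a]_s (1 - mass s 0 * (mtyp s 0 == gtype a)%:R)%:E < +oo)%E.

Lemma measurable_mass n : measurable_fun setT (fun s : MP => mass s n).
Proof.
move=> _ B mB; rewrite setTI; apply: sub_sigma_algebra.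
by left; exists n, B.
Qed.

Lemma measurable_mtyp n j : measurable_fun setT (fun s : MP => (mtyp s n == j)%:R : R).
Proof.
have -> : (fun s : MP => (mtyp s n == j)%:R : R) = \1_[set s | mtyp s n = j].
  apply/funext => s; rewrite indicE; congr (nat_of_bool _)%:R.
  by apply/eqP/idP => [h|]; [rewrite inE|rewrite inE].
apply: measurable_indic; apply: sub_sigma_algebra; right; by exists n, j.
Qed.

Definition rate (A : set PN) : \bar R := (\int[nu a]_s kappa s A)%E.

Lemma dislocation_intensity_strip A : (rate A < +oo)%E -> measurable A ->
  dislocation_intensity nu kappa a (`]0%R, 1%R] `*` A) = rate A.
Proof.
move=> fA mA; rewrite /dislocation_intensity.
have r0 : (0 <= rate A)%E by apply: integral_ge0.
have fin : rate A \is a fin_num by rewrite ge0_fin_numE.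
transitivity (\int[@lebesgue_measure R]_(t in `[0%R, +oo[)
    ((fine (rate A))%:E * (\1_(`]0%R, 1%R]%classic : set R) t)%:E))%E.
  apply: eq_integral => t _; rewrite indicE.
  have [t01|t01] := boolP (t \in (`]0, 1]%classic : set R)).
    rewrite mule1 fineK //; apply: eq_integral => s _; congr (kappa s _).
    by apply/seteqP; split=> p; rewrite /xsection /= inE /=;
      [case|rewrite inE in t01].
  rewrite mule0 (eq_integral (cst 0%E)) ?integral0 // => s _.
  rewrite (_ : xsection _ t = set0) ?measure0 //.
  apply/seteqP; split=> p //; rewrite /xsection /= inE => -[h _].
  by move/negP: t01; apply; rewrite inE.
rewrite ge0_integralZl_EFin //; last 2 first.
- by apply/measurable_EFinP; apply: measurable_indic.
- exact: fine_ge0.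
rewrite integral_indic // fineK // (_ : _ `&` _ = `]0%R, 1%R]%classic); last first.
  apply/seteqP; split=> t /=; rewrite !in_itv /=; first by case.
  by move=> /andP[t0 t1]; rewrite t0 t1 ltW.
by rewrite /= lebesgue_measure_itv /= lte_fin ltr01 oppr0 adde0 mule1.
Qed.

Lemma measurable_kappa A : measurable A -> measurable_fun setT (fun s => kappa s A).
Proof. by move=> mA; exact: measurable_kernel. Qed.

(** If the largest mass [m] has type [a], the probability is at most [1 - m ^+ 2], hence at most
    [2 * (1 - m)]; otherwise the right-hand side is 2. *)
Lemma kappa_split_le s :
  (kappa s (~` typed_together 0 1 (gtype a)) <=
   2%:E * (1 - mass s 0 * (mtyp s 0 == gtype a)%:R)%:E)%E.
Proof.
have k1 : kappa s setT = 1%E by exact: prob_kernel.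
have mT := measurable_typed_together (R := R) (A := setT) (gtype a) (n_Sn 0).
rewrite total1_setC // -EFinM.
have [e|_] := eqVneq (mtyp s 0) (gtype a); last first.
  rewrite mulr0 subr0 mulr1; apply: (@le_trans _ _ 1%E).
    by rewrite -[leRHS]sube0 leeB.
  by rewrite lee_fin ler1n.
have h := paintbox_typed_ge k1 (hk s) e.
rewrite mulr1; apply: (@le_trans _ _ (1 - (mass s 0 ^+ 2)%:E)%E).
  exact: leeB.
rewrite -EFinB lee_fin; have := sqr_ge0 (1 - mass s 0); lra.
Qed.

Lemma rate_finite A : measurable A -> A `<=` ~` typed_together 0 1 (gtype a) ->
  (rate A < +oo)%E.
Proof.
move=> mA sA.
have mT := measurable_typed_together (R := R) (A := setT) (gtype a) (n_Sn 0).
have le (s : MP) : (kappa s A <=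
    2%:E * (1 - mass s 0 * (mtyp s 0 == gtype a)%:R)%:E)%E.
  apply: le_trans (kappa_split_le s); apply: le_measure; rewrite ?inE //.
  exact: measurableC.
have int0 (s : MP) : (0 <= (1 - mass s 0 * (mtyp s 0 == gtype a)%:R)%:E)%E.
  have := le_trans (measure_ge0 (kappa s) A) (le s).
  by rewrite pmule_rge0 // lte_fin.
have mint : measurable_fun setT
    (fun s : MP => (1 - mass s 0 * (mtyp s 0 == gtype a)%:R)%:E).
  apply/measurable_EFinP; apply: measurable_funB => //.
  by apply: measurable_funM; [exact: measurable_mass|exact: measurable_mtyp].
apply: (@le_lt_trans _ _ (\int[nu a]_s
    (2%:E * (1 - mass s 0 * (mtyp s 0 == gtype a)%:R)%:E))%E).
  apply: ge0_le_integral => //.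
  - exact: measurable_kappa.
  - exact: measurable_funeM.
rewrite ge0_integralZl_EFin // lte_mul_pinfty //.
Qed.

(** If the rate were zero, then for almost every [s] the measure [kappa s] would not charge the set,
    so that [s] would have no mass of type [b], and [type_rate nu a b] would vanish. *)
Lemma rate_pos (J : 'I_K -> Prop) b : b <> a -> ~ J b -> (0 < type_rate nu a b)%E ->
  rate (~` typed_together 0 1 (gtype a) `\` one_blocks J) <> 0%E.
Proof.
move=> ba Jb; set A := (X in rate X) => tr r0.
have mA : measurable A.
  apply: measurableD; last exact: measurable_one_blocks.
  by apply: measurableC; exact: measurable_typed_together (n_Sn 0).
move: tr; suff -> : type_rate nu a b = 0%E by rewrite ltxx.
pose f (s : MP) := (\sum_(0 <= n <oo) (mass s n * (mtyp s n == gtype b)%:R)%:E)%E.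
have ms n : measurable_fun setT
    (fun s : MP => (mass s n * (mtyp s n == gtype b)%:R)%:E).
  apply/measurable_EFinP.
  by apply: measurable_funM; [exact: measurable_mass|exact: measurable_mtyp].
have mf : measurable_fun setT f.
  apply: ge0_emeasurable_sum => // n s _ _.
  by rewrite lee_fin mulr_ge0 // mass_ge0.
have h0 : ae_eq (nu a) setT (fun s => kappa s A) (cst 0%E).
  apply/(ae_eq_integral_abs _ measurableT (measurable_kappa mA)).1.
  by under eq_integral do rewrite gee0_abs //.
rewrite /type_rate (ae_eq_integral (cst 0%E)) ?integral0 //.
apply: filterS h0 => s /(_ I) k0 _ /=.
apply: eseries0 => n _ _; congr (_%:E).
have [e|] := eqVneq (mtyp s n) (gtype b); last by rewrite mulr0.
rewrite mulr1; apply: contrapT => /eqP m0.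
apply: (paintbox_splits (n := n) _ (hk s) ba Jb _ e k0); first exact: prob_kernel.
by rewrite lt_neqAle eq_sym m0 mass_ge0.
Qed.

End Intensities.

Lemma atoms_event0 d (T : measurableType d) (O : Type)
    (D : O -> set T) (A : set T) w : atoms_event D A 0 w <-> D w `&` A = set0.
Proof. by rewrite /atoms_event /= II0 card_eq0; split=> /eqP. Qed.

(** * Unbroken types lead only to unbroken types *)

Section NonDegeneracy.
Variables (R : realType) (K : nat).
Local Notation PN := (mpart R K setT).
Context d (Omega : measurableType d).
Variables (X : R -> Omega -> PN) (P : R.-pker PN ~> Omega).
Hypothesis hX : homogeneous_fragmentation X P.

(* By exchangeability and the branching property, a block of such a type is
   almost surely never broken. *)
Definition unbroken (j : 'I_K) : Prop :=
  forall t, 0 <= t -> same_block_prob X P j t = 1.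

Let P1 p : P p setT = 1%E. Proof. exact: prob_kernel. Qed.

(** Integers together in a block of type [c] at time [t] would be apart at some time [t + u] with
    conditional probability [1 - same_block_prob X P c u > 0]. *)
Lemma unbroken_avoids a c t : unbroken a -> ~ unbroken c -> 0 <= t ->
  P (one_block R a) (X t @^-1` typed_together 0 1 (gtype c)) = 0%E.
Proof.
move=> ua /existsNP[u /not_implyP[u0 /eqP qu]] t0.
set p := one_block R a; set C := X t @^-1` _.
have mC : measurable C.
  by apply: (measurable_event hX t0); exact: measurable_typed_together (n_Sn 0).
have tu0 := addr_ge0 t0 u0.
have mT : measurable (X (t + u) @^-1` together 0 1).
  by apply: (measurable_event hX tu0).
have T1 : P p (X (t + u) @^-1` together 0 1) = 1%E.
  by rewrite (same_block_probE hX) // ua.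
have E1 := same_block_prob_typed hX p c t0 u0.
have E2 : P p (C `&` X (t + u) @^-1` together 0 1) = P p C.
  apply/eqP; rewrite eq_le; apply/andP; split.
    by apply: le_measure; rewrite ?inE //; exact: measurableI.
  apply: (@le_trans _ _ (P p ((C `&` X (t + u) @^-1` together 0 1)
      `|` ~` (X (t + u) @^-1` together 0 1)))).
    apply: le_measure; rewrite ?inE //.
      by apply: measurableU; [exact: measurableI|exact: measurableC].
    move=> w Cw; have [h|h] := pselect ((X (t + u) @^-1` together 0 1) w).
      by left.
    by right.
  apply: le_trans (measureU2 _ _ _) _; [exact: measurableI|exact: measurableC|].
  by rewrite [X in (_ + X)%E](total1_setC (P1 p) mT) T1 subee // adde0.
have fin : P p C \is a fin_num by exact: kernel_fin.
move: E1; rewrite E2 -(fineK fin) -EFinM => -[e].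
have /eqP : (1 - same_block_prob X P c u) * fine (P p C) = 0.
  by rewrite mulrBl mul1r -e subrr.
by rewrite mulf_eq0 subr_eq0 eq_sym (negPf qu) /= => /eqP ->.
Qed.

Lemma unbroken_one_blocks a t : unbroken a -> 0 <= t ->
  P (one_block R a) (X t @^-1` one_blocks unbroken) = 1%E.
Proof.
move=> ua t0; set p := one_block R a.
have mE B : measurable B -> measurable (X t @^-1` B) by exact: (measurable_event hX t0).
have mJ := measurable_one_blocks (R := R) unbroken.
suff : P p (~` (X t @^-1` one_blocks unbroken)) = 0%E.
  rewrite (total1_setC (P1 p) (mE _ mJ)) => e.
  have fin : P p (X t @^-1` one_blocks unbroken) \is a fin_num.
    by apply: kernel_fin; exact: mE.
  by move: e; rewrite -(fineK fin) -EFinB => -[/eqP]; rewrite subr_eq0 => /eqP <-.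
have apart k l : P p (X t @^-1` ~` together k l) = 0%E.
  rewrite -preimage_setC (total1_setC (P1 p) (mE _ (measurable_together k l))).
  have [<-|/eqP kl] := eqVneq k l.
    rewrite (_ : X t @^-1` _ = setT) ?P1 ?subee //.
    by apply/seteqP; split=> // w _; exact: blkxx.
  by rewrite (same_block_prob_pair hX _ t0 kl) ua // subee.
apply: measure_negligible; first by apply: measurableC; exact: mE.
apply: (@negligibleS _ _ _ _ ((\bigcup_k \bigcup_l (X t @^-1` ~` together k l)) `|`
   \bigcup_(c in [set c | ~ unbroken c]) X t @^-1` typed_together 0 1 (gtype c))).
  move=> w /= nw; apply: contrapT => /not_orP[h1 h2]; apply: nw.
  have hb k l : blk (X t w) k l.
    by apply: contrapT => nkl; apply: h1; exists k => //; exists l.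
  apply/one_blocksP; split=> //.
  have [c ec] := typ_gtype (n_Sn 0) (hb 0%N 1%N).
  by exists c => //; apply: contrapT => nc; apply: h2; exists c => //; split.
apply: negligibleU.
  apply: negligible_bigcup => k; apply: negligible_bigcup => l.
  exists (X t @^-1` ~` together k l); split; [|exact: apart|by []].
  by apply: mE; exact: measurableC.
exists (\bigcup_(c in [set c | ~ unbroken c]) X t @^-1` typed_together 0 1 (gtype c)).
have mc c : measurable (X t @^-1` typed_together 0 1 (gtype c)).
  by apply: mE; exact: measurable_typed_together (n_Sn 0).
have mU : measurable (\bigcup_(c in [set c | ~ unbroken c])
    X t @^-1` typed_together 0 1 (gtype c)).
  by apply: fin_bigcup_measurable => // c _; exact: mc.
split=> //.
apply: measure_negligible => //.
have -> : \bigcup_(c in [set c | ~ unbroken c])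
    X t @^-1` typed_together 0 1 (gtype c) =
  \big[setU/set0]_(c <- enum 'I_K | `[< ~ unbroken c >])
    X t @^-1` typed_together 0 1 (gtype c).
  rewrite -bigcup_seq_cond; apply/seteqP; split=> w [c /= hc wc]; exists c => //=.
    by rewrite mem_enum; apply/andP; split=> //; exact/asboolP.
  by case/andP: hc => _ /asboolP.
elim/big_ind: _ => [||c /asboolP nc]; first exact: negligible_set0.
  exact: negligibleU.
exists (X t @^-1` typed_together 0 1 (gtype c)); split=> //.
exact: unbroken_avoids.
Qed.

Lemma ae_unbroken a : unbroken a ->
  {ae P (one_block R a), forall w, forall t, 0 <= t -> one_blocks unbroken (X t w)}.
Proof.
move=> ua; apply: ae_one_blocks => //.
- by have [[]] := hX.
- exact: (frag_cadlag hX).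
- by move=> t t0; exact: unbroken_one_blocks.
Qed.

Lemma exists_broken : exists j, ~ unbroken j.
Proof.
apply: contrapT => /forallNP h; apply: (frag_nonconstant hX) => j.
have uj : unbroken j by apply: contrapT; exact: h.
apply: filterS (ae_unbroken uj) => w hw t t0 m.
have /one_blocksP[ht _] := hw t t0; have /one_blocksP[h0 _] := hw 0 (lexx 0).
by apply/seteqP; split=> k _.
Qed.

Section rates.
Variables (c : 'I_K -> R) (nu : 'I_K -> {measure set (massp R K) -> \bar R}).
Hypothesis hc : has_characteristics X P c nu.

Lemma unbroken_closed a b : unbroken a -> (0 < type_rate nu a b)%E -> b <> a ->
  unbroken b.
Proof.
move=> ua tr ba; apply: contrapT => nb.
have [_ dm [kappa [hk hka]]] := hc.
have [dO [W [Q [D [E [Y [pd mY dY sl]]]]]]] := hka a.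
have [_ nu_fin] := dm a.
pose S : set PN := ~` typed_together 0 1 (gtype a).
pose J : set PN := one_blocks unbroken.
have mS : measurable S.
  by apply: measurableC; exact: measurable_typed_together (n_Sn 0).
have mJ : measurable J by exact: measurable_one_blocks.
have mSJ : measurable (S `&` J) by exact: measurableI.
have mSD : measurable (S `\` J) by exact: measurableD.
have f0 : (rate nu kappa a (S `&` J) < +oo)%E.
  by apply: rate_finite => // p [].
have f1 : (rate nu kappa a (S `\` J) < +oo)%E.
  by apply: rate_finite => // p [].
have r1 : rate nu kappa a (S `\` J) <> 0%E by exact: (rate_pos hk ba nb tr).
have i0 := dislocation_intensity_strip f0 mSJ.
have i1 := dislocation_intensity_strip f1 mSD.
(* Over []0, 1]] the intensity equals the rate, and [driven_by] places jumps at positive times. Only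
   the terms 0 and 1 of the sequence enter. *)
pose B (l : nat) : set (R * PN) :=
  if l == 0%N then `]0, 1] `*` (S `&` J) else `]0, 1] `*` (S `\` J).
have mB l : measurable (B l).
  by rewrite /B; case: ifP => _; exact: measurableX.
have iB l : (dislocation_intensity nu kappa a (B l) < +oo)%E.
  by rewrite /B; case: ifP => _; rewrite ?i0 ?i1.
have [hD _ _] := pd; have [mD pD indD] := hD 0%N a.
pose G l := atoms_event (D 0%N a) (B l) 0.
have mG l : measurable (G l) by exact: mD.
have dis : trivIset `I_2 B.
  by apply/trivIsetP => -[|[|//]] [|[|//]] //= _ _ _; rewrite /B /=;
    apply/seteqP; split=> // -[t p] [[_ [_ pJ]] [_ [_ npJ]]].
have QG l : Q (G l) = (expR (- fine (dislocation_intensity nu kappa a (B l))))%:E.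
  by rewrite pD // expr0 fact0 divr1 mul1r.
have QGG : Q (G 0%N `&` G 1%N) = (Q (G 0%N) * Q (G 1%N))%E.
  have := indD 2%N B (fun=> 0%N) mB iB dis.
  rewrite 2!big_ord_recl big_ord0 mule1 /= => <-; congr (Q _).
  apply/seteqP; split=> w.
    by move=> [h0 h1] [|[|//]] _.
  by move=> h; split; exact: h.
have hYJ : {ae Q, forall w, forall t, 0 <= t -> J (Y t w)}.
  apply: ae_one_blocks => //.
  - exact: probability_setT.
  - by apply: filterS dY => w [].
  - move=> t t0; apply: etrans (esym (same_law1 sl t0 mJ)) _.
    exact: unbroken_one_blocks.
have neg : Q (G 0%N `\` G 1%N) = 0%E.
  apply: measure_negligible; first exact: measurableD.
  have imp w : driven_by a (fun n j => D n j w) (fun n j => E n j w) (Y^~ w) ->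
      (forall t, 0 <= t -> J (Y t w)) -> ~ (G 0%N `\` G 1%N) w.
    move=> dr yJ [g0 g1].
    have noat t Delta : 0 < t -> t <= 1 -> D 0%N a w (t, Delta) -> S Delta ->
        ~ J Delta.
      move=> t0 t1 at_ SD JD; move/atoms_event0: g0 => /seteqP[h _].
      by apply: (h (t, Delta)); split=> //; split=> //=; rewrite in_itv /= t0 t1.
    apply: g1; apply/atoms_event0; apply/seteqP; split=> // -[t Delta] [at_].
    rewrite /B /= in_itv /= => -[/andP[t0 t1] [_ nJ]]; apply: nJ.
    exact: (driven_path_no_split dr yJ noat t0 t1 at_).
  have aeG : {ae Q, forall w, ~ (G 0%N `\` G 1%N) w}.
    by apply: filterS2 dY hYJ => w; exact: imp.
  by apply: negligibleS aeG => w h nh; exact: nh h.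
(* As [Q (G 0%N)] is positive, [G 1%N] has probability 1, so its intensity is 0, contradicting
   [r1]. *)
have QE : Q (G 0%N) = (Q (G 0%N) * Q (G 1%N))%E.
  by rewrite -QGG (measureDI Q (mG 0%N) (mG 1%N)) [X in (X + _)%E]neg add0e.
move: QE; rewrite !QG -EFinM => -[] /eqP; rewrite -subr_eq0 -{1}[expR _]mulr1 -mulrBr.
rewrite mulf_eq0 gt_eqF ?expR_gt0 //= subr_eq0 -expR0.
move=> /eqP /expR_inj /esym /eqP; rewrite oppr_eq0 => /eqP.
rewrite /B /= i1 => rf; apply: r1.
have r1ge : (0 <= rate nu kappa a (S `\` J))%E by exact: integral_ge0.
by rewrite -[LHS]fineK ?rf // ge0_fin_numE.
Qed.

End rates.

End NonDegeneracy.

Section UniformBreaking.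
Variables (R : realType) (K : nat).
Local Notation PN := (mpart R K setT).
Context d (Omega : measurableType d).
Variables (X : R -> Omega -> PN) (P : R.-pker PN ~> Omega).
Hypothesis hX : homogeneous_fragmentation X P.
Hypothesis hirr : irreducible_fragmentation X P.

Lemma all_broken j : ~ unbroken X P j.
Proof.
move=> uj; have [b nb] := exists_broken hX; apply: nb.
have [c [nu [hc /(_ j b) /connectP[p pth ->]]]] := hirr.
elim: p j uj pth => [//|k p IH] j uj /= /andP[/andP[jk rjk] pth].
by apply: (IH k) => //; apply: (unbroken_closed hX hc uj rjk);
  apply/eqP; rewrite eq_sym.
Qed.

Lemma uniform_breaking (i0 : 'I_K) : exists t0 theta,
  [/\ 0 < t0, 0 < theta, theta < 1 & forall j, same_block_prob X P j t0 <= theta].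
Proof.
have br j : exists t, 0 <= t /\ same_block_prob X P j t < 1.
  have /existsNP[t /not_implyP[t0 /eqP qt]] := @all_broken j.
  by exists t; split=> //; rewrite lt_neqAle qt; exact: same_block_prob_le1.
have [t ht] := choice br.
(* A positive time beyond all the [t j]; the probabilities are nonincreasing in time. *)
pose t0 := 1 + \sum_j t j.
have tj j : t j <= t0.
  rewrite /t0 (bigD1 j) //= addrCA lerDl addr_ge0 // sumr_ge0 // => k _.
  by have [] := ht k.
have t00 : 0 < t0 by rewrite ltr_wpDr // sumr_ge0 // => k _; have [] := ht k.
have q1 j : same_block_prob X P j t0 < 1.
  have [tj0 qj] := ht j; apply: le_lt_trans qj.
  exact: (same_block_prob_decr hX).
have [j _ hj] := @Order.TotalTheory.arg_maxP _ _ _ i0 xpredT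
  (fun j => same_block_prob X P j t0) isT.
(* The [1 / 2] keeps [theta] positive, as the decay argument divides by powers of its square
   root. *)
exists t0, (Num.max (1 / 2) (same_block_prob X P j t0)); split=> //.
- by rewrite lt_max divr_gt0.
- by rewrite gt_max q1 andbT; lra.
- by move=> k; rewrite le_max; apply/orP; right; exact: hj.
Qed.

End UniformBreaking.

Theorem proposition3p3 (R : realType) (K : nat) (alpha : R) (halpha : alpha < 0)
    (d : measure_display) (Omega : measurableType d)
    (X : R -> Omega -> mpart R K setT) (P : R.-pker (mpart R K setT) ~> Omega)
    (hfrag : homogeneous_fragmentation X P)
    (hirr : irreducible_fragmentation X P) (i : 'I_K) :
  {ae P (one_block R i), forall w, exists_unique_tree alpha (fun t => X t w)}.
Proof.
have [t0 [theta [t00 th0 th1 hth]]] := uniform_breaking hfrag hirr i.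
have dec := frequencies_decay hfrag i t00 th0 th1 hth.
have fr := frag_freq hfrag i.
have mono := blocks_decrease hfrag (one_block R i).
have init := starts_at hfrag (one_block R i).
apply: filterS2 (filterI dec init) (filterI fr mono) => w [hdec h0] [hfr hmono].
apply: path_exists_unique_tree => //.
- by move=> m; rewrite h0.
- by move=> t m t0'; have [] := hfr m t t0'.
- have [rho [C h]] := hdec; by exists t0, rho, C; case: h.
Qed.
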